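(* Let $H$ be a complex Hilbert space and let $\mathcal{G}(\sigma,d)$ be the conjugacy class of finite-rank self-adjoint operators on $H$ with spectrum $\sigma=\{a_1,\dots,a_k\}$ and eigenspace dimensions $d=\{n_1,\dots,n_k\}$, where $n_i$ is the dimension of the eigenspace for the eigenvalue $a_i$. Suppose that $k\ge 2$, that $n_i>1$ for all $i\in\{1,\dots,k\}$, and that there is at most one $i$ such that $n_i=2$. Then for every automorphism $f$ of the graph $\Gamma^{c}(\sigma,d)$ there are a unitary or anti-unitary operator $U$ on $H$ and a permutation $\delta\in S(d)$ such that $$f(A)=U\,\delta(A)\,U^{*}$$ for all $A\in\mathcal{G}(\sigma,d)$.
   Context: Two operators $A,B$ on $H$ are unitary conjugate if $B=UAU^{*}$ for some unitary operator $U$ on $H$. A conjugacy class of finite-rank self-adjoint operators on $H$ is determined by the spectrum $\sigma=\{a_1,\dots,a_k\}$ (distinct real eigenvalues) and the indexed list of dimensions $d=\{n_1,\dots,n_k\}$, $n_i$ being the dimension of the eigenspace corresponding to $a_i$; it is denoted by $\mathcal{G}(\sigma,d)$. The eigenspaces of each such operator are mutually orthogonal with sum $H$, and $n_i$ is finite whenever $a_i\ne 0$; if $H$ is infinite-dimensional, then $0\in\sigma$ and the corresponding eigenspace (the kernel) is infinite-dimensional. $S(d)$ is the group of all permutations $\delta$ of $\{1,\dots,k\}$ with $n_{\delta(i)}=n_i$ for all $i$. If $A=\sum_{i=1}^{k}a_iP_{X_i}\in\mathcal{G}(\sigma,d)$, where $X_i$ is the eigenspace of $A$ for $a_i$ and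 $P_{X}$ is the orthogonal projection onto $X$, then $\delta(A)=\sum_{i=1}^{k}a_iP_{X_{\delta(i)}}\in\mathcal{G}(\sigma,d)$. Operators $A,B\in\mathcal{G}(\sigma,d)$ are commutatively adjacent if $AB=BA$ and $\operatorname{rank}(A-B)=2$. $\Gamma^{c}(\sigma,d)$ is the simple graph with vertex set $\mathcal{G}(\sigma,d)$ in which two operators are joined by an edge if and only if they are commutatively adjacent. An automorphism of a graph is a bijection of the vertex set preserving edges in both directions. An anti-unitary operator is an invertible conjugate-linear operator $U$ with $\langle U(x),U(y)\rangle=\overline{\langle x,y\rangle}$ for all $x,y$; its adjoint satisfies $U^{*}=U^{-1}$. *)

(* Defs.v *)
From mathcomp Require Import all_boot all_order all_algebra all_fingroup.
From mathcomp Require Import complex.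
From mathcomp Require Import boolp classical_sets functions reals.
From mathcomp Require Import topology normedtype.

Set Implicit Arguments.
Unset Strict Implicit.
Unset Printing Implicit Defensive.

Import Order.TTheory GRing.Theory Num.Theory Num.Def.
Import numFieldNormedType.Exports.

Local Open Scope classical_set_scope.
Local Open Scope ring_scope.
Local Open Scope complex_scope.

Section LinearAlgebra.
Variables (K : fieldType) (V : lmodType K).

Definition has_basis (X : set V) (n : nat) : Prop :=
  exists e : 'I_n -> V,
    (forall c : 'I_n -> K, \sum_i c i *: e i = 0 -> forall i, c i = 0) /\
    X = [set \sum_i c i *: e i | c in [set: 'I_n -> K]].

(* Dimensions are valued in [option nat], [None] standing for an infinite
   dimension. The cardinal of an infinite dimension need not be recorded: the
   only eigenspace of a finite-rank operator that may be infinite-dimensional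
   is its kernel. *)
Definition has_dim (X : set V) (n : option nat) : Prop :=
  if n is Some m then has_basis X m else forall m, ~ has_basis X m.

Definition has_rank (A : V -> V) (n : nat) : Prop := has_basis (range A) n.

Definition eigenspace (A : V -> V) (l : K) : set V := [set x | A x = l *: x].

End LinearAlgebra.

Definition dim_gt (m : nat) (n : option nat) : bool :=
  if n is Some n' then (m < n')%N else true.

Section Graph.
Variables (T : Type) (vertices : set T) (edge : T -> T -> Prop).

Definition graph_automorphism (f : T -> T) : Prop :=
  set_bij vertices vertices f /\
  forall x y, vertices x -> vertices y -> (edge x y <-> edge (f x) (f y)).

End Graph.

Section Operators.
Variables (R : realType) (H : completeNormedModType R[i]).
Variable dot : {dot H for conjC}.

Definition bounded_operator (A : H -> H) : Prop := linear A /\ continuous A.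

Definition self_adjoint (A : H -> H) : Prop :=
  forall x y, dot (A x) y = dot x (A y).

Definition finite_rank (A : H -> H) : Prop := exists n, has_rank A n.

Definition spectrum (A : H -> H) : set R[i] :=
  [set l | ~ exists B : H -> H, bounded_operator B /\
             cancel (fun x => A x - l *: x) B /\
             cancel B (fun x => A x - l *: x)].

(* The orthogonal projection of [x] to [X]; the value 0 is only taken when no
   such point exists, which does not happen when [X] is a closed subspace. *)
Definition proj (X : set H) (x : H) : H :=
  xget 0 [set y | X y /\ forall z, X z -> dot (x - y) z = 0].

Definition unitary (U : H -> H) : Prop :=
  [/\ linear U, bijective U & forall x y, dot (U x) (U y) = dot x y].

Definition anti_unitary (U : H -> H) : Prop :=
  [/\ linear_for (conjC \; *:%R) U, bijective U &
      forall x y, dot (U x) (U y) = conjC (dot x y)].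

(* By Riesz' theorem the vector [z] below exists and is unique for a bounded
   linear (resp. conjugate-linear) [U]. *)
Definition adjoint (U : H -> H) (y : H) : H :=
  xget 0 [set z | forall x, dot (U x) y = dot x z].

Definition anti_adjoint (U : H -> H) (y : H) : H :=
  xget 0 [set z | forall x, dot (U x) y = conjC (dot x z)].

Section ConjugacyClass.
Variables (k : nat) (a : 'I_k -> R) (d : 'I_k -> option nat).

Definition conj_class : set (H -> H) :=
  [set A | [/\ bounded_operator A, self_adjoint A, finite_rank A,
               spectrum A = [set (a i)%:C | i in [set: 'I_k]] &
               forall i, has_dim (eigenspace A (a i)%:C) (d i)]].

Definition comm_adjacent (A B : H -> H) : Prop :=
  A \o B = B \o A /\ has_rank (A \- B) 2.

Definition dim_perms : {set 'S_k} :=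
  [set s : 'S_k | [forall i, d (s i) == d i]].

Definition perm_op (s : 'S_k) (A : H -> H) (x : H) : H :=
  \sum_i (a i)%:C *: proj (eigenspace A (a (s i))%:C) x.

End ConjugacyClass.

End Operators.

(* Main.v *)
(** Vertices are orthogonal decompositions of H into coloured eigenspaces X_i,
and two of them are adjacent exactly when one arises from the other by swapping
a line p of X_i with a line q of X_l.

The neighbours of A that swap a fixed line p of colour i with the lines of
colour l (a pencil) are recognised inside the graph as soon as n_l > 2: by
orthogonality of the lines q, and because two neighbours of a vertex of the link
of A lying in different directions have exactly two common neighbours in that
link. Pencils at adjacent vertices belonging to the same label (i, p, l) are
recognised as well, and the vertices whose i-th eigenspace contains p are
connected by swaps that involve the colour i and fix p. Hence an automorphism f
acts on coloured lines: A has p in colour i iff f(A) has p' in colour i'.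

Vertices with p in colour i and q in colour l <> i exist iff p and q are
orthogonal, whereas for equal colours they always exist. So the colours are
permuted by some delta independently of the lines, and p |-> p' is, for all
colours, the same bijection on lines preserving orthogonality in both
directions. By Uhlhorn's theorem it is induced by a unitary or anti-unitary U.
At most one colour i has no l <> i with n_l > 2, and then k = 2; its eigenspace
is the orthogonal complement of the other one. *)

Require Import Defs.
From HB Require Import structures.
From mathcomp Require Import all_boot all_order all_algebra all_fingroup.
From mathcomp Require Import complex.
From mathcomp Require Import boolp classical_sets functions reals.
From mathcomp Require Import topology normedtype.
From mathcomp Require Import ring.

Import Order.TTheory GRing.Theory Num.Theory Num.Def.
Import numFieldNormedType.Exports.

Local Open Scope classical_set_scope.
Local Open Scope ring_scope.

Set Implicit Arguments.
Unset Strict Implicit.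
Unset Printing Implicit Defensive.

(** * Inner products and dimensions *)

(** Lines are unit vectors up to [par], and the geometry rests on the interface [orbit_class]. One
    colour [c0] is therefore set aside: dimensions are counted only in the others, and a vertex is
    recovered from all its eigenspaces but one. Another obstacle is that the line map is at first
    only induced by a map semilinear for an unknown endomorphism of the complex field, and such
    endomorphisms can be wild. Up to conjugation this one sends squared norms to squared norms, so
    it is monotone on the reals and fixes them. The permutation of the statement is the inverse of
    the colour map [de], because [perm_op] permutes eigenspaces and not eigenvalues. *)

Section InnerProduct.
Variables (C : numClosedFieldType) (H : lmodType C) (dot : {dot H for conjC}).
Implicit Types (x y z : H) (c : C).
Local Notation "''[' u , v ]" := (dot u v) : ring_scope.

Lemma dotDl x y z : '[x + y, z] = '[x, z] + '[y, z].
Proof. exact: linearDl. Qed.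
Lemma dotBl x y z : '[x - y, z] = '[x, z] - '[y, z].
Proof. exact: linearBl. Qed.
Lemma dotNl x z : '[- x, z] = - '[x, z].
Proof. exact: linearNl. Qed.
Lemma dotZl c x z : '[c *: x, z] = c * '[x, z].
Proof. exact: linearZl_LR. Qed.
Lemma dot0l z : '[0, z] = 0.
Proof. exact: linear0l. Qed.
Lemma dotDr x y z : '[z, x + y] = '[z, x] + '[z, y].
Proof. exact: linearDr. Qed.
Lemma dotBr x y z : '[z, x - y] = '[z, x] - '[z, y].
Proof. exact: linearBr. Qed.
Lemma dotNr x z : '[z, - x] = - '[z, x].
Proof. exact: linearNr. Qed.
Lemma dotZr c x z : '[z, c *: x] = c^* * '[z, x].
Proof. exact: linearZr_LR. Qed.
Lemma dot0r z : '[z, 0] = 0.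
Proof. exact: linear0r. Qed.
Lemma dot_suml (I : Type) (r : seq I) (P : pred I) (F : I -> H) z :
  '[\sum_(i <- r | P i) F i, z] = \sum_(i <- r | P i) '[F i, z].
Proof. exact: linear_sumlz. Qed.
Lemma dotC x y : '[x, y] = '[y, x]^*.
Proof. by rewrite (hermC dot) expr0 mul1r. Qed.

Definition dotlE := (dotDl, dotBl, dotNl, dotZl, dot0l).
Definition dotrE := (dotDr, dotBr, dotNr, dotZr, dot0r).

Lemma dot_eq0P x : '[x, x] = 0 -> x = 0.
Proof. by move/eqP; rewrite dnorm_eq0 => /eqP. Qed.

Lemma dot_inj x y : (forall z, '[x, z] = '[y, z]) -> x = y.
Proof.
move=> e; apply/eqP; rewrite -subr_eq0; apply/eqP/dot_eq0P.
by rewrite dotBl e subrr.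
Qed.

Lemma dotC0 x y : '[x, y] = 0 -> '[y, x] = 0.
Proof. by move=> e; rewrite dotC e rmorph0. Qed.

Lemma normalize x : x <> 0 -> exists2 c, c != 0 & '[c *: x, c *: x] = 1.
Proof.
move/eqP => x0; have s0: sqrtC '[x, x] != 0 by rewrite sqrtC_eq0 dnorm_eq0.
exists (sqrtC '[x, x])^-1; first by rewrite invr_eq0.
rewrite dnormZ ger0_norm ?invr_ge0 ?sqrtC_ge0 ?dnorm_ge0 //.
by rewrite exprVn sqrtCK mulVf // dnorm_eq0.
Qed.

Lemma unit_neq0 x : '[x, x] = 1 -> x <> 0.
Proof. by move=> h x0; move: h; rewrite x0 dot0l => /esym/eqP; rewrite oner_eq0. Qed.

(** Equality of lines, for lines represented by unit vectors; it is symmetric only away from 0. *)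
Definition par (p q : H) := exists c, q = c *: p.

Lemma par_refl (p : H) : par p p.
Proof. by exists 1; rewrite scale1r. Qed.

Lemma par_unit (p q : H) : '[p, p] = 1 -> '[q, q] = 1 -> par p q ->
  forall x, '[x, q] *: q = '[x, p] *: p.
Proof.
move=> p1 q1 [c qE] x; move: q1; rewrite qE !dotZl !dotZr p1 mulr1 => cc.
by rewrite scalerA mulrAC [c^* * c]mulrC cc mul1r.
Qed.

Lemma par_sym (p q : H) : '[q, q] = 1 -> par p q -> par q p.
Proof.
move=> q1 [c qE]; have c0 : c != 0.
  by apply/eqP => c0; move: q1; rewrite qE c0 scale0r dot0l => /esym/eqP; rewrite oner_eq0.
by exists c^-1; rewrite qE scalerA mulVf // scale1r.
Qed.

Lemma par_trans (p q r : H) : par p q -> par q r -> par p r.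
Proof. by move=> [c ->] [c' ->]; exists (c' * c); rewrite scalerA. Qed.

Lemma par_dot0 (p q : H) x : par p q -> '[x, p] = 0 -> '[x, q] = 0.
Proof. by move=> [c ->] e; rewrite dotZr e mulr0. Qed.

Lemma parP (p q : H) : '[p, p] = 1 -> par p q <-> q - '[q, p] *: p = 0.
Proof.
move=> p1; split => [[c ->]|/eqP]; first by rewrite dotZl p1 mulr1 subrr.
by rewrite subr_eq0 => /eqP qE; exists '[q, p].
Qed.

Lemma par_orth_unit (p q : H) : '[p, p] = 1 -> par p q -> '[p, q] = 0 -> q = 0.
Proof.
move=> p1 [c ->]; rewrite dotZr p1 mulr1 => /eqP; rewrite conjC_eq0 => /eqP ->.
by rewrite scale0r.
Qed.

Lemma npar_orth (p q : H) : '[p, p] = 1 -> '[q, q] = 1 -> '[p, q] = 0 -> ~ par p q.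
Proof. by move=> p1 q1 pq h; apply: (unit_neq0 q1); exact: par_orth_unit h pq. Qed.

Lemma gram_dot (p q : H) : '[p, p] = 1 -> '[q - '[q, p] *: p, p] = 0.
Proof. by move=> p1; rewrite dotBl dotZl p1 mulr1 subrr. Qed.

(** * Subspaces, independent families and orthogonal vectors *)

Definition subspace (X : set H) := X 0 /\ forall c x y, X x -> X y -> X (c *: x + y).

Lemma subspaceZ X c x : subspace X -> X x -> X (c *: x).
Proof. by case=> X0 XD Xx; rewrite -[_ *: _]addr0; apply: XD. Qed.
Lemma subspaceD X x y : subspace X -> X x -> X y -> X (x + y).
Proof. by case=> X0 XD Xx Xy; rewrite -[x]scale1r; apply: XD. Qed.
Lemma subspaceB X x y : subspace X -> X x -> X y -> X (x - y).
Proof.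
move=> sX Xx Xy; apply: subspaceD => //; rewrite -scaleN1r.
exact: subspaceZ.
Qed.
Lemma subspace_sum X n (F : 'I_n -> H) :
  subspace X -> (forall i, X (F i)) -> X (\sum_i F i).
Proof.
move=> sX XF; apply: (big_ind X) => //; first by case: sX.
by move=> *; apply: subspaceD.
Qed.

Definition indep n (e : 'I_n -> H) :=
  forall c : 'I_n -> C, \sum_i c i *: e i = 0 -> forall i, c i = 0.

Lemma short_kernel m n (M : 'M[C]_(m, n)) :
  (n < m)%N -> exists2 r : 'rV_m, r != 0 & r *m M = 0.
Proof.
move=> nm; have : kermx M != 0.
  rewrite kermx_eq0 -row_leq_rank -ltnNge; exact: leq_ltn_trans (rank_leq_col M) nm.
by case/rowV0Pn => v /sub_kermxP vM vertex0; exists v.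
Qed.

Lemma indep_le_basis X n m (v : 'I_m -> H) :
  has_basis X n -> indep v -> (forall j, X (v j)) -> (m <= n)%N.
Proof.
move=> [e [_ eX]] iv Xv; rewrite leqNgt; apply/negP => nm.
have /choice [f fP] j : exists c : 'I_n -> C, v j = \sum_i c i *: e i.
  by have := Xv j; rewrite eX => -[c _ <-]; exists c.
have [r r0 rM] := short_kernel (\matrix_(j, i) f j i) nm.
have {}r0: exists j, r 0 j != 0.
  by move: r0 => /rV0Pn.
case: r0 => j; rewrite (iv (fun j => r 0 j)) ?eqxx //.
under eq_bigr => l _ do rewrite fP scaler_sumr.
rewrite exchange_big /= big1 // => i _.
under eq_bigr => l _ do rewrite scalerA.
rewrite -scaler_suml; have /matrixP /(_ 0 i) := rM; rewrite !mxE => e0.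
rewrite [X in X *: _](_ : _ = 0) ?scale0r // -[RHS]e0.
by apply: eq_bigr => l _; rewrite mxE.
Qed.

(** In infinite dimension an independent family can always be extended: if it spanned [X], it would
    be a finite basis. *)
Lemma indep_has_dim X dd m : subspace X -> has_dim X dd -> dim_gt m dd ->
  exists2 e : 'I_m.+1 -> H, indep e & forall i, X (e i).
Proof.
move=> sX; case: dd => [n|] /=.
  move=> [e [ie eX]] mn; exists (fun i => e (widen_ord mn i)).
    move=> c c0 i.
    pose c' (j : 'I_n) := if insub (j : nat) is Some i then c i else 0.
    have valI : insub (val (widen_ord mn i)) = Some i by rewrite valK.
    have /(_ _ (widen_ord mn i)) := ie c'; rewrite /c' valI; apply.
    pose F j := (if insub j is Some i then c i *: e (widen_ord mn i) else 0).
    transitivity (\sum_(j < m.+1) F j).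
      rewrite (big_ord_widen _ F mn) [RHS]big_mkcond /=; apply: eq_bigr => j _.
      rewrite /c' /F; case: insubP => [l -> lj|/negPf ->]; last exact: scale0r.
      by congr (_ *: e _); apply: val_inj.
    by rewrite -[RHS]c0; apply: eq_bigr => j _; rewrite /F valK.
  by move=> i; rewrite eX; exists (fun j => (j == widen_ord mn i)%:R) => //;
    rewrite (bigD1 (widen_ord mn i)) //= eqxx scale1r big1 ?addr0 // => j /negPf ->;
    rewrite scale0r.
move=> hX _; elim: m.+1 => [|{}m [e ie Xe]].
  by exists (fun i => 0) => [c _ []|[]].
have : exists2 x, X x & forall c : 'I_m -> C, x <> \sum_i c i *: e i.
  apply: contrapT => hn; apply: (hX m); exists e; split => //.
  apply/seteqP; split => x /=; last first.
    by case=> c _ <-; apply: subspace_sum => // i; apply: subspaceZ.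
  move=> Xx; apply: contrapT => hx; apply: hn; exists x => // c xc.
  by apply: hx; exists c.
case=> x Xx hx.
exists (fun i => if unlift ord_max i is Some j then e j else x); last first.
  by move=> i; case: unlift.
move=> c; rewrite big_ord_recr /= unlift_none.
have uE (i : 'I_m) : unlift ord_max (widen_ord (leqnSn m) i) = Some i.
  by rewrite -[widen_ord _ _]/(widen_ord _ i)
     (_ : widen_ord (leqnSn m) i = lift ord_max i) ?liftK //; apply: val_inj;
     rewrite /= /bump leqNgt ltn_ord.
under eq_bigr => i _ do rewrite uE.
have [cm|cm] := eqVneq (c ord_max) 0.
  rewrite cm scale0r addr0 => s0 i; case: (unliftP ord_max i) => [j ->|-> //].
  have := ie _ s0 j; rewrite (_ : widen_ord (leqnSn m) j = lift ord_max j) //.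
  by apply: val_inj; rewrite /= /bump leqNgt ltn_ord.
move=> s0; exfalso.
apply: (hx (fun i => - (c ord_max)^-1 * c (widen_ord (leqnSn m) i))).
under eq_bigr => i _ do rewrite -scalerA.
rewrite -scaler_sumr scaleNr; apply: (scalerI cm).
by rewrite scalerN scalerA mulfV // scale1r; apply/eqP; rewrite -addr_eq0 addrC s0.
Qed.

(** [size s] linear conditions leave a nonzero combination of [(size s).+1] independent vectors of
    [X]; the vectors of [s] may lie outside [X]. *)
Lemma orth_ex X dd (s : seq H) : subspace X -> has_dim X dd -> dim_gt (size s) dd ->
  exists x, [/\ X x, '[x, x] = 1 & forall y, y \in s -> '[x, y] = 0].
Proof.
move=> sX hX ds; have [e ie Xe] := indep_has_dim sX hX ds.
have [r r0 rM] := short_kernel (\matrix_(i < (size s).+1, j < size s) '[e i, s`_j]) (ltnSn _).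
pose x := \sum_i r 0 i *: e i.
have x0 : x <> 0.
  move=> x0; case/rV0Pn: r0 => j; rewrite (ie (fun j => r 0 j)) ?eqxx //.
have [c c0 cx] := normalize x0.
exists (c *: x); split => //.
  by apply: subspaceZ => //; apply: subspace_sum => // i; apply: subspaceZ.
move=> y ys; have iy := ys; rewrite -index_mem in iy.
have /matrixP /(_ 0 (Ordinal iy)) := rM; rewrite !mxE => e0.
rewrite dotZl dot_suml [X in _ * X](_ : _ = 0) ?mulr0 // -[RHS]e0.
by apply: eq_bigr => i _; rewrite mxE dotZl nth_index.
Qed.

Lemma orthogonal_le_basis X n (s : seq H) : has_basis X n ->
  pairwise_orthogonal dot s -> (forall x, x \in s -> X x) -> (size s <= n)%N.
Proof.
move=> hX /pairwise_orthogonalP [/= /andP[s0 us] os] Xs.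
apply: (indep_le_basis (v := fun i : 'I_(size s) => s`_i) hX) => [c c0 i|i]; last first.
  by apply: Xs; rewrite mem_nth.
have : '[\sum_i c i *: s`_i, s`_i] = 0 by rewrite c0 dot0l.
rewrite dot_suml (bigD1 i) //= big1 => [|j ji]; last first.
  rewrite dotZl os ?mulr0 ?mem_nth // nth_uniq //.
rewrite addr0 dotZl => /eqP; rewrite mulf_eq0 dnorm_eq0 => /orP[/eqP //|/eqP si].
by move: s0; rewrite -si mem_nth.
Qed.

End InnerProduct.

(* Two vectors are equal when all their inner products are, which turns vector
   identities into scalar ones. *)
Ltac vec dot := apply: (@dot_inj _ _ dot) => ?; rewrite ?dotlE; ring.

(** * Uhlhorn's theorem *)

Section Uhlhorn.
Variables (C : numClosedFieldType) (H : lmodType C) (dot : {dot H for conjC}).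
Variable phi : H -> H.
Implicit Types (x y z p q t : H).
Local Notation "''[' u , v ]" := (dot u v) : ring_scope.

Hypothesis phi_unit : forall p, '[p, p] = 1 -> '[phi p, phi p] = 1.
Hypothesis phi_orth : forall p q, '[p, p] = 1 -> '[q, q] = 1 ->
  '[p, q] = 0 <-> '[phi p, phi q] = 0.
Hypothesis phi_onto : forall x, '[x, x] = 1 -> exists2 p, '[p, p] = 1 & par (phi p) x.
Hypothesis dim3 : forall x y, exists z, [/\ '[z, z] = 1, '[z, x] = 0 & '[z, y] = 0].

(** A span of two vectors is its own double orthogonal complement: the residue of [z] after
    projection to the span, if nonzero, would itself be a test vector [t]. *)
Lemma biorth x y z : '[x, x] = 1 ->
  (forall t, '[t, t] = 1 -> '[t, x] = 0 -> '[t, y] = 0 -> '[t, z] = 0) ->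
  exists al be, z = al *: x + be *: y.
Proof.
move=> x1 h.
have key z' : '[z', x] = 0 -> '[z', y] = 0 -> (exists al be, z' = z - (al *: x + be *: y)) ->
    exists al be, z = al *: x + be *: y.
  move=> zx zy [al [be zE]]; exists al, be; apply/eqP; rewrite -subr_eq0 -zE; apply/eqP.
  apply: contrapT => n0; have [c c0 c1] := normalize dot n0.
  have := h _ c1; rewrite !dotZl zx zy !mulr0 => /(_ erefl erefl) /eqP.
  rewrite mulf_eq0 (negPf c0) /= => /eqP z0; apply: n0; apply: (@dot_eq0P _ _ dot).
  by rewrite {2}zE dotBr dotDr !dotZr z0 zx zy !mulr0 !addr0 subr0.
have [yx|yx] := pselect (par x y).
  apply: (key (z - '[z, x] *: x)); first exact: gram_dot.
    by case: yx => c ->; rewrite dotZr gram_dot // mulr0.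
  by exists '[z, x], 0; rewrite scale0r addr0.
have [c c0 c1] : exists2 c, c != 0 &
    '[c *: (y - '[y, x] *: x), c *: (y - '[y, x] *: x)] = 1.
  by apply: normalize; move/(parP y x1).
set e := c *: _ in c1; have ex : '[e, x] = 0 by rewrite /e dotZl gram_dot // mulr0.
have yE : y = '[y, x] *: x + c^-1 *: e.
  by rewrite /e scalerA mulVf // scale1r addrC subrK.
have eE : e = c *: (y - '[y, x] *: x) by []; clearbody e.
have wx : '[z - '[z, x] *: x - '[z, e] *: e, x] = 0.
  by rewrite dotBl gram_dot // dotZl ex mulr0 subr0.
have we : '[z - '[z, x] *: x - '[z, e] *: e, e] = 0.
  by rewrite !dotBl !dotZl (dotC0 ex) c1 mulr0 subr0 mulr1 subrr.
apply: (key _ wx); first by rewrite yE dotDr !dotZr wx we !mulr0 addr0.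
exists ('[z, x] - '[z, e] * c * '[y, x]), ('[z, e] * c).
rewrite -addrA -opprD; congr (_ - _); rewrite {2}eE.
by vec dot.
Qed.

(* [img x y] : the line of [x] is sent to the line of [y]. *)
Definition img x y := [/\ x <> 0, y <> 0 &
  forall z, '[z, z] = 1 -> '[x, z] = 0 <-> '[y, phi z] = 0].

Lemma img_phi p : '[p, p] = 1 -> img p (phi p).
Proof.
move=> p1; split; [exact: (unit_neq0 p1)|exact: (unit_neq0 (phi_unit p1))|].
by move=> z z1; exact: phi_orth.
Qed.

Lemma imgZ x y c c' : c != 0 -> c' != 0 -> img x y -> img (c *: x) (c' *: y).
Proof.
move=> c0 c0' [x0 y0 h]; have sz (b : C) (u : H) : b != 0 -> u <> 0 -> b *: u <> 0.
  by move=> b0 /eqP u0; apply/eqP; rewrite scaler_eq0 negb_or b0.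
split; [exact: sz|exact: sz|move=> z z1].
have dz (b r : C) : b != 0 -> b * r = 0 <-> r = 0.
  by move=> b0; split => [/eqP|->]; rewrite ?mulr0 // mulf_eq0 (negPf b0) => /eqP.
by rewrite !dotZl !dz //; exact: h.
Qed.

Lemma img_ex x : x <> 0 -> exists2 y, img x y & '[y, y] = 1.
Proof.
move=> x0; have [c c0 c1] := normalize dot x0; exists (phi (c *: x)); last exact: phi_unit.
have := imgZ (invr_neq0 c0) (oner_neq0 C) (img_phi c1).
by rewrite scalerA mulVf // !scale1r.
Qed.

Lemma img_onto y : y <> 0 -> exists x, img x y.
Proof.
move=> y0; have [c c0 c1] := normalize dot y0.
have [p p1 [b yE]] := phi_onto c1; exists p.
have b0 : b != 0 by apply/eqP => b0; apply: (unit_neq0 c1); rewrite yE b0 scale0r.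
have := imgZ (oner_neq0 C) (mulf_neq0 (invr_neq0 c0) b0) (img_phi p1).
by rewrite scale1r -scalerA -yE scalerA mulVf // scale1r.
Qed.

(** [img] tests its pair only against unit vectors and their images. To compare two pairs, [y'] is
    shown to span the line of [phi (c *: x')]: every direction orthogonal to [y'] is the image of
    some [p] orthogonal to [x'], and [biorth] applies. *)
Lemma img_orth x y x' y' : img x y -> img x' y' -> '[x, x'] = 0 <-> '[y, y'] = 0.
Proof.
move=> [x0 y0 h] [x0' y0' h'].
have [c c0 c1] := normalize dot x0'.
have dz (b r : C) : b != 0 -> b^* * r = 0 <-> r = 0.
  by move=> b0; split => [/eqP|->]; rewrite ?mulr0 // mulf_eq0 conjC_eq0 (negPf b0) => /eqP.
rewrite -(dz c _ c0) -dotZr (h _ c1).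
suff [b yE] : par y' (phi (c *: x')).
  rewrite yE dotZr dz //; apply/eqP => b0.
  by apply: (unit_neq0 (phi_unit c1)); rewrite yE b0 scale0r.
have [ka ka0 k1] := normalize dot y0'.
have := @biorth (ka *: y') (ka *: y') (phi (c *: x')) k1.
case=> [t t1 ty _|al [be ->]]; last by exists (al * ka + be * ka); rewrite !scalerA -scalerDl.
have [p p1 [b tE]] := phi_onto t1.
have b0 : b != 0 by apply/eqP => b0; apply: (unit_neq0 t1); rewrite tE b0 scale0r.
move: ty; rewrite tE dotZl => /eqP; rewrite mulf_eq0 (negPf b0) dotZr mulf_eq0.
rewrite conjC_eq0 (negPf ka0) /= => /eqP /dotC0 /(h' p p1) xp.
rewrite dotZl (_ : '[phi p, phi (c *: x')] = 0) ?mulr0 //.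
by apply/(phi_orth p1 c1); rewrite dotZr (dotC0 xp) mulr0.
Qed.

(** Spans of two lines are double orthogonal complements, so a bijection of lines preserving
    orthogonality preserves collinearity. *)
Lemma img_span x1 y1 x2 y2 x y al be : img x1 y1 -> img x2 y2 -> img x y ->
  x = al *: x1 + be *: x2 -> exists ga de, y = ga *: y1 + de *: y2.
Proof.
move=> i1 i2 ix xE; have [_ y10 _] := i1; have [ka ka0 k1] := normalize dot y10.
have [|ga [de ->]] := @biorth (ka *: y1) y2 y k1; last first.
  by exists (ga * ka), de; rewrite scalerA.
move=> t t1 ty1 ty2; have [s it] := img_onto (unit_neq0 t1).
apply/(img_orth it ix); rewrite xE dotDr !dotZr.
have -> : '[s, x1] = 0.
  apply/(img_orth it i1); move: ty1; rewrite dotZr => /eqP.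
  by rewrite mulf_eq0 conjC_eq0 (negPf ka0) => /eqP.
have -> : '[s, x2] = 0 by apply/(img_orth it i2).
by rewrite !mulr0 addr0.
Qed.

Lemma img_par x y y' : img x y -> img x y' -> exists2 c, c != 0 & y' = c *: y.
Proof.
move=> i i'; have [|ga [de e]] := @img_span x y x y x y' 1 0 i i i'.
  by rewrite scale1r scale0r addr0.
exists (ga + de); last by rewrite e scalerDl.
have [_ y0' _] := i'; apply/eqP => c0; apply: y0'.
by rewrite e -scalerDl c0 scale0r.
Qed.

Lemma img_parl x x' y : img x y -> img x' y -> par x x'.
Proof.
move=> i i'; have [x0 _ _] := i; have [ka ka0 k1] := normalize dot x0.
have [|al [be ->]] := @biorth (ka *: x) (ka *: x) x' k1; last first.
  by exists (al * ka + be * ka); rewrite !scalerA -scalerDl.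
move=> t t1 tx _; have [s it _] := img_ex (unit_neq0 t1).
apply/(img_orth it i')/(img_orth it i); move: tx; rewrite dotZr => /eqP.
by rewrite mulf_eq0 conjC_eq0 (negPf ka0) => /eqP.
Qed.

(** * An affine chart of the projective space *)

Variable e : H.
Hypothesis e1 : '[e, e] = 1.
Let e' := phi e.
Let e1' : '[e', e'] = 1. Proof. exact: phi_unit. Qed.

Lemma add_unit_neq0 f x : '[f, f] = 1 -> '[x, f] = 0 -> f + x <> 0.
Proof.
move=> f1 xf h; have : '[f + x, f] = 0 by rewrite h dot0l.
by rewrite dotDl f1 xf addr0 => /eqP; rewrite oner_eq0.
Qed.

(* In the affine chart [e + x], [x] orthogonal to [e], of the projective space
   the line map is a map [T] on the orthogonal complement of [e]. *)
Lemma chart_ex x : '[x, e] = 0 -> exists t, '[t, e'] = 0 /\ img (e + x) (e' + t).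
Proof.
move=> xe; have [y iy y1] := img_ex (add_unit_neq0 e1 xe).
have ye : '[y, e'] != 0.
  apply/eqP => /(img_orth iy (img_phi e1)); rewrite dotDl e1 xe addr0 => /eqP.
  by rewrite oner_eq0.
exists ('[y, e']^-1 *: y - e'); split.
  by rewrite dotBl dotZl mulVf // e1' subrr.
have -> : e' + ('[y, e']^-1 *: y - e') = '[y, e']^-1 *: y by rewrite addrC subrK.
rewrite -[e + x]scale1r; apply: imgZ => //; first exact: oner_neq0.
by rewrite invr_eq0.
Qed.

Definition chart x := xget 0 [set t | '[t, e'] = 0 /\ img (e + x) (e' + t)].
Local Notation T := chart.

Lemma chartP x : '[x, e] = 0 -> '[T x, e'] = 0 /\ img (e + x) (e' + T x).
Proof. by move=> /chart_ex [t ht]; rewrite /chart; case: xgetP => [y _ //|/(_ t)]. Qed.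

Lemma chartE x t : '[x, e] = 0 -> '[t, e'] = 0 -> img (e + x) (e' + t) -> T x = t.
Proof.
move=> xe te it; have [Txe iT] := chartP xe.
have [c c0 tE] := img_par it iT.
have : '[e' + T x, e'] = c * '[e' + t, e'] by rewrite tE dotZl.
rewrite !dotDl e1' Txe te !addr0 mulr1 => c1.
by move: tE; rewrite -c1 scale1r => /addrI.
Qed.

Lemma chart0 : T 0 = 0.
Proof.
apply: chartE; rewrite ?dot0l // !addr0; exact: img_phi.
Qed.

(** The line of [x] is the point at infinity in direction [x]: it lies in the span of [e + x] and
    [e] and is orthogonal to [e]. Its image lies in the span of [e' + T x] and [e'] and is
    orthogonal to [e'], which leaves the line of [T x]. *)
Lemma chart_img x : '[x, e] = 0 -> x <> 0 -> img x (T x).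
Proof.
move=> xe x0; have [Txe iT] := chartP xe; have [y iy _] := img_ex x0.
have [|ga [de yE]] := img_span iT (img_phi e1) iy (al := 1) (be := -1).
  by rewrite scale1r scaleN1r addrAC subrr add0r.
have : '[y, e'] = 0 by apply/(img_orth iy (img_phi e1)).
rewrite yE -/e' dotDl !dotZl dotDl e1' Txe addr0 !mulr1 => /eqP; rewrite addr_eq0 => /eqP gd.
have {}yE : y = ga *: T x by rewrite yE -/e' gd scalerDr !scaleNr; vec dot.
have ga0 : ga != 0.
  by apply/eqP => g0; have [_ y0 _] := iy; apply: y0; rewrite yE g0 scale0r.
have := imgZ (oner_neq0 C) (invr_neq0 ga0) iy.
by rewrite yE scalerA mulVf // !scale1r.
Qed.

Lemma perpD x y : '[x, e] = 0 -> '[y, e] = 0 -> '[x + y, e] = 0.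
Proof. by move=> xe ye; rewrite dotDl xe ye addr0. Qed.
Lemma perpZ c x : '[x, e] = 0 -> '[c *: x, e] = 0.
Proof. by move=> xe; rewrite dotZl xe mulr0. Qed.

Lemma chart_par x y : '[x, e] = 0 -> '[y, e] = 0 -> x <> 0 -> y <> 0 ->
  par (T x) (T y) -> par x y.
Proof.
move=> xe ye x0 y0 [c TE]; have ix := chart_img xe x0; have iy := chart_img ye y0.
have c0 : c != 0.
  by apply/eqP => c0; have [_ h _] := iy; apply: h; rewrite TE c0 scale0r.
have := imgZ (oner_neq0 C) c0 ix; rewrite -TE scale1r => ix'.
exact: img_parl ix' iy.
Qed.

(** [e + (x + y)] lies in the span of [e + x] and [y], so [T (x + y)] is [T x] plus a multiple of
    [T y]. The symmetric computation and independence force both multiples to be 1. *)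
Lemma chartD_indep x y : '[x, e] = 0 -> '[y, e] = 0 -> x <> 0 -> y <> 0 -> ~ par x y ->
  T (x + y) = T x + T y.
Proof.
have half x' y' : '[x', e] = 0 -> '[y', e] = 0 -> y' <> 0 ->
    exists b, T (x' + y') = T x' + b *: T y'.
  move=> xe ye y0; have [Txe ix] := chartP xe; have iy := chart_img ye y0.
  have [Txye ixy] := chartP (perpD xe ye).
  have [|ga [de E]] := img_span ix iy ixy (al := 1) (be := 1).
    by rewrite !scale1r addrA.
  have Tye : '[T y', e'] = 0 by apply/(img_orth iy (img_phi e1)).
  have := congr1 (dot^~ e') E; rewrite !dotDl !dotZl dotDl e1' Txye Txe Tye.
  rewrite !addr0 mulr0 addr0 mulr1 => g1.
  by exists de; move: E; rewrite -g1 scale1r -addrA => /addrI.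
move=> xe ye x0 y0 nxy; have [b E] := half x y xe ye y0.
have [c E'] := half y x ye xe x0; rewrite addrC in E'.
have [b1|b1] := eqVneq b 1; first by rewrite E b1 scale1r.
exfalso; apply: nxy; apply: chart_par => //.
exists ((b - 1)^-1 * (c - 1)); rewrite -scalerA.
have nz : b - 1 != 0 by rewrite subr_eq0.
apply: (scalerI nz); rewrite [RHS]scalerA mulfV // scale1r.
have := E; rewrite E' => EE.
have -> : (b - 1) *: T y = (T x + b *: T y) - T x - T y by vec dot.
by rewrite -EE; vec dot.
Qed.

Lemma par_symN x y : y <> 0 -> par x y -> par y x.
Proof.
move=> y0 [c yE]; have c0 : c != 0 by apply/eqP => c0; apply: y0; rewrite yE c0 scale0r.
by exists c^-1; rewrite yE scalerA mulVf // scale1r.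
Qed.

Lemma chartD x y : '[x, e] = 0 -> '[y, e] = 0 -> T (x + y) = T x + T y.
Proof.
move=> xe ye.
have [->|x0] := pselect (x = 0); first by rewrite chart0 !add0r.
have [->|y0] := pselect (y = 0); first by rewrite chart0 !addr0.
have [pxy|npxy] := pselect (par x y); last exact: chartD_indep.
(* For parallel [x] and [y] a third direction [z] reduces additivity to the independent case:
   [T (x + y + z)] is computed in two ways. *)
have [z [z1 zx ze]] := dim3 x e.
have z0 := unit_neq0 z1.
have zpar b : b *: x <> 0 -> ~ par (b *: x) z.
  move=> bx [c zE]; apply: z0; apply: (@dot_eq0P _ _ dot).
  by rewrite {2}zE !dotZr zx !mulr0.
have [b yE] := pxy.
have xz : '[x + z, e] = 0 by exact: perpD.
have yz : '[y + z, e] = 0 by exact: perpD.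
have nyz : ~ par y z by rewrite yE; apply: zpar; rewrite -yE.
have S1 : T (x + y + z) = T (x + y) + T z.
  have [s0|s0] := pselect (x + y = 0); first by rewrite s0 chart0 !add0r.
  apply: chartD_indep => //; first exact: perpD.
  have sE : x + y = (1 + b) *: x by rewrite yE scalerDl scale1r.
  by rewrite sE; apply: zpar; rewrite -sE.
have S2 : T (x + y + z) = T x + (T y + T z).
  rewrite -addrA -(chartD_indep ye ze y0 z0 nyz).
  have yz0 : y + z <> 0.
    move=> h; apply: nyz; exists (-1); rewrite scaleN1r; apply/eqP.
    by rewrite -addr_eq0 addrC h.
  apply: chartD_indep => // -[c cE]; apply: z0; apply: (@dot_eq0P _ _ dot).
  have -> : '[z, z] = '[z, (y + z) - y] by rewrite addrC addKr.
  by rewrite cE yE dotBr !dotZr zx !mulr0 subr0.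
by apply: (addIr (T z)); rewrite -S1 S2 addrA.
Qed.

(** * The scalar twist of the chart and its semilinear extension *)

Variable x0 : H.
Hypotheses (x01 : '[x0, x0] = 1) (x0e : '[x0, e] = 0).

Lemma chart_neq0 x : '[x, e] = 0 -> x <> 0 -> T x <> 0.
Proof. by move=> xe n0; have [] := chart_img xe n0. Qed.

Definition twist c := '[T (c *: x0), T x0] / '[T x0, T x0].
Local Notation s := twist.

Lemma chart_scale x c : '[x, e] = 0 -> exists b, T (c *: x) = b *: T x.
Proof.
move=> xe; have [->|n0] := pselect (x = 0); first by exists 0; rewrite scaler0 chart0 scaler0.
have [->|c0] := eqVneq c 0; first by exists 0; rewrite !scale0r chart0.
have cx0 : c *: x <> 0 by move/eqP; rewrite scaler_eq0 (negPf c0) => /eqP.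
have := imgZ c0 (oner_neq0 C) (chart_img xe n0); rewrite scale1r => i.
by have [b _ ->] := img_par i (chart_img (perpZ c xe) cx0); exists b.
Qed.

Lemma Tx0_neq0 : '[T x0, T x0] != 0.
Proof.
rewrite dnorm_eq0; apply/eqP; apply: chart_neq0 => //; exact: (unit_neq0 x01).
Qed.

Lemma scale_eq0 (b : C) x : x <> 0 -> b *: x = 0 -> b = 0.
Proof. by move=> n0 /eqP; rewrite scaler_eq0 => /orP[/eqP //|/eqP]. Qed.

(** Additivity on [c *: (y + z)] with [y], [z] independent forces the same scalar for both. A vector
    parallel to [x0] is reached through a third one. *)
Lemma chartZ c x : '[x, e] = 0 -> T (c *: x) = s c *: T x.
Proof.
have T0 : T (c *: x0) = s c *: T x0.
  have [b E] := chart_scale c x0e; rewrite /twist E dotZl mulfK //; exact: Tx0_neq0.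
have key y z : '[y, e] = 0 -> '[z, e] = 0 -> y <> 0 -> z <> 0 -> ~ par y z ->
    T (c *: y) = s c *: T y -> T (c *: z) = s c *: T z.
  move=> ye ze y0 z0 nyz yE; have [b zE] := chart_scale c ze.
  have [b' sE] := chart_scale c (perpD ye ze).
  move: sE; rewrite scalerDr !chartD ?perpZ // yE zE scalerDr => sE.
  have [bb|nb] := eqVneq b (s c); first by rewrite bb.
  have nTyz : ~ par (T y) (T z) by move/(chart_par ye ze y0 z0).
  have E : (s c - b') *: T y = (b' - b) *: T z.
    have -> : (s c - b') *: T y = (s c *: T y + b *: T z) - (b' *: T y + b' *: T z) + (b' - b) *: T z.
      by vec dot.
    by rewrite sE subrr add0r.
  have [b'b|nb'] := eqVneq b' b.
    move: E; rewrite b'b subrr scale0r => /scale_eq0 h.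
    have /eqP := h (chart_neq0 ye y0); rewrite subr_eq0 => /eqP sb.
    by rewrite sb.
  case: nTyz; exists ((b' - b)^-1 * (s c - b')); rewrite -scalerA E scalerA mulVf ?scale1r //.
  by rewrite subr_eq0.
move=> xe; have [->|n0] := pselect (x = 0); first by rewrite scaler0 chart0 scaler0.
have x0n := unit_neq0 x01.
have [px|npx] := pselect (par x0 x); last exact: (key x0 x).
have [z [z1 zx ze]] := dim3 x0 e; have z0 := unit_neq0 z1.
have nz : ~ par x0 z by move=> [b zE]; apply: z0; apply: (@dot_eq0P _ _ dot); rewrite {2}zE dotZr zx mulr0.
apply: (key z x) => //; last exact: (key x0 z).
move=> /(par_symN n0) xz; apply: nz; exact: par_trans px xz.
Qed.

Lemma twistD b c : s (b + c) = s b + s c.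
Proof.
have Tn := chart_neq0 x0e (unit_neq0 x01).
apply/eqP; rewrite -subr_eq0; apply/eqP; apply: (scale_eq0 Tn).
rewrite scalerBl -chartZ // !scalerDl chartD ?perpZ // !chartZ //.
by rewrite subrr.
Qed.

Lemma twistM b c : s (b * c) = s b * s c.
Proof.
have Tn := chart_neq0 x0e (unit_neq0 x01).
apply/eqP; rewrite -subr_eq0; apply/eqP; apply: (scale_eq0 Tn).
by rewrite scalerBl -chartZ // -scalerA chartZ ?perpZ // chartZ // scalerA subrr.
Qed.

Lemma twist1 : s 1 = 1.
Proof. by rewrite /twist scale1r divff // Tx0_neq0. Qed.

Lemma twistN c : s (- c) = - s c.
Proof.
apply/eqP; rewrite -addr_eq0 -twistD addNr /twist scale0r chart0 dot0l mul0r.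
exact: eqxx.
Qed.

Lemma twist_neq0 c : c != 0 -> s c != 0.
Proof.
move=> c0; apply/eqP => sc; have := twistM c c^-1.
by rewrite mulfV // twist1 sc mul0r => /eqP; rewrite oner_eq0.
Qed.

Lemma twistV c : s c^-1 = (s c)^-1.
Proof.
have [->|c0] := eqVneq c 0.
  by rewrite invr0 /twist scale0r chart0 dot0l mul0r invr0.
apply: (mulfI (twist_neq0 c0)); rewrite -twistM mulfV // twist1 mulfV //.
exact: twist_neq0.
Qed.

(** The value -1 is visible to orthogonality, namely of [e + x] and [e + y]. Other nonzero inner
    products reduce to it by rescaling. *)
Lemma chart_dotN1 x y : '[x, e] = 0 -> '[y, e] = 0 -> '[x, y] = -1 -> '[T x, T y] = -1.
Proof.
move=> xe ye xy; have [Txe ix] := chartP xe; have [Tye iy] := chartP ye.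
have : '[e + x, e + y] = 0.
  by rewrite dotDl !dotDr e1 xe xy (dotC0 ye) addr0 add0r subrr.
move/(img_orth ix iy); rewrite dotDl !dotDr e1' Txe (dotC0 Tye) addr0 add0r.
by move/eqP; rewrite addrC addr_eq0 => /eqP.
Qed.

Lemma chart_dot x y : '[x, e] = 0 -> '[y, e] = 0 -> '[T x, T y] = (s '[x, y]^*)^*.
Proof.
move=> xe ye; have [c0|c0] := eqVneq '[x, y] 0.
  rewrite c0 rmorph0 /twist scale0r chart0 dot0l mul0r rmorph0.
  have [->|xn] := pselect (x = 0); first by rewrite chart0 dot0l.
  have [->|yn] := pselect (y = 0); first by rewrite chart0 dot0r.
  by apply/(img_orth (chart_img xe xn) (chart_img ye yn)).
pose mu := - ('[x, y]^*)^-1.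
have cc0 : '[x, y]^* != 0 by rewrite conjC_eq0.
have : '[x, mu *: y] = -1.
  by rewrite dotZr /mu rmorphN fmorphV /= conjCK mulNr mulVf.
move/(chart_dotN1 xe (perpZ mu ye)); rewrite chartZ // dotZr /mu twistN twistV.
rewrite rmorphN fmorphV /= mulNr => /oppr_inj h.
have nz : (s '[x, y]^*)^* != 0 by rewrite conjC_eq0; exact: twist_neq0.
by rewrite -[LHS]mul1r -(mulfV nz) -mulrA h mulr1.
Qed.

(** [r] is the squared norm of [sqrtC r *: x0], and [s r] is, up to conjugation, that of its
    image. *)
Lemma twist_ge0 r : 0 <= r -> 0 <= s r.
Proof.
move=> r0; have := chart_dot (perpZ (sqrtC r) x0e) (perpZ (sqrtC r) x0e).
rewrite dnormZ x01 mulr1 ger0_norm ?sqrtC_ge0 // sqrtCK (conj_Creal (ger0_real r0)) => h.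
have : 0 <= (s r)^* by rewrite -h dnorm_ge0.
by move=> h0; rewrite -[s r]conjCK (conj_Creal (ger0_real h0)).
Qed.

Lemma chart_onto t : '[t, e'] = 0 -> exists2 x, '[x, e] = 0 & T x = t.
Proof.
move=> te; have [w iw] := img_onto (add_unit_neq0 e1' te).
have we : '[w, e] != 0.
  apply/eqP => /(img_orth iw (img_phi e1)); rewrite dotDl e1' te addr0 => /eqP.
  by rewrite oner_eq0.
have xe : '[('[w, e])^-1 *: w - e, e] = 0 by rewrite dotBl dotZl mulVf // e1 subrr.
exists ('[w, e]^-1 *: w - e) => //; apply: chartE => //.
have -> : e + ('[w, e]^-1 *: w - e) = '[w, e]^-1 *: w by rewrite addrC subrK.
rewrite -[e' + t]scale1r; apply: imgZ => //; last exact: oner_neq0.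
by rewrite invr_eq0.
Qed.

(* Semilinear extension of the chart by [e |-> phi e]. *)
Definition uhlhorn_map x := T (x - '[x, e] *: e) + s '[x, e] *: e'.

Lemma perp_proj x : '[x - '[x, e] *: e, e] = 0.
Proof. exact: gram_dot. Qed.

Lemma uhlhorn_map_semilinear c x y : uhlhorn_map (c *: x + y) = s c *: uhlhorn_map x + uhlhorn_map y.
Proof.
rewrite /uhlhorn_map dotDl dotZl twistD twistM.
have -> : c *: x + y - (c * '[x, e] + '[y, e]) *: e =
    c *: (x - '[x, e] *: e) + (y - '[y, e] *: e) by vec dot.
rewrite (chartD (perpZ c (perp_proj x)) (perp_proj y)) (chartZ c (perp_proj x)).
by vec dot.
Qed.

Lemma uhlhorn_mapD x y : uhlhorn_map (x + y) = uhlhorn_map x + uhlhorn_map y.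
Proof. by rewrite -{1}[x]scale1r uhlhorn_map_semilinear twist1 scale1r. Qed.

Lemma uhlhorn_mapZ c x : uhlhorn_map (c *: x) = s c *: uhlhorn_map x.
Proof.
have u0 : uhlhorn_map 0 = 0 by apply: (addrI (uhlhorn_map 0)); rewrite -uhlhorn_mapD !addr0.
by rewrite -[c *: x]addr0 uhlhorn_map_semilinear u0 addr0.
Qed.

Lemma uhlhorn_map_dot x y : '[uhlhorn_map x, uhlhorn_map y] =
  (s '[x - '[x, e] *: e, y - '[y, e] *: e]^*)^* + s '[x, e] * (s '[y, e])^*.
Proof.
have px := (chartP (perp_proj x)).1; have py := (chartP (perp_proj y)).1.
rewrite /uhlhorn_map -(chart_dot (perp_proj x) (perp_proj y)).
move: px py; set u := T (x - _); set v := T (y - _) => px py; clearbody u v.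
by rewrite dotDl !dotDr !dotZl !dotZr px (dotC0 py) e1'; ring.
Qed.

Lemma uhlhorn_map_img x : x <> 0 -> img x (uhlhorn_map x).
Proof.
move=> n0; have [xe|xe] := eqVneq '[x, e] 0.
  have -> : uhlhorn_map x = T x.
    by rewrite /uhlhorn_map xe scale0r subr0 /twist scale0r chart0 dot0l mul0r scale0r addr0.
  exact: chart_img.
have xE : x = '[x, e] *: (e + '[x, e]^-1 *: (x - '[x, e] *: e)).
  by rewrite scalerDr scalerA mulfV // scale1r addrC subrK.
have uE : uhlhorn_map x = s '[x, e] *: (e' + T ('[x, e]^-1 *: (x - '[x, e] *: e))).
  rewrite chartZ ?perp_proj // scalerDr scalerA -twistM mulfV // twist1 scale1r addrC.
  by [].
rewrite uE {1}xE; apply: imgZ => //; first exact: twist_neq0.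
by apply: (chartP _).2; apply: perpZ; exact: perp_proj.
Qed.

Lemma uhlhorn_map_onto (s_onto : forall c, exists b, s b = c) y : exists x, uhlhorn_map x = y.
Proof.
have [b sb] := s_onto '[y, e'].
have ye : '[y - '[y, e'] *: e', e'] = 0 by exact: gram_dot.
have [x xe TE] := chart_onto ye; exists (x + b *: e).
have be : '[x + b *: e, e] = b by rewrite dotDl dotZl xe e1 add0r mulr1.
by rewrite /uhlhorn_map be addrK TE sb subrK.
Qed.

End Uhlhorn.

(** * Swaps of lines and adjacency *)

Section OrbitClass.
Variables (C : numClosedFieldType) (H : lmodType C) (dot : {dot H for conjC}).
Variables (k : nat) (a : 'I_k -> C) (d : 'I_k -> option nat).
Implicit Types (A B D : H -> H) (x y z p q u v w : H).
Local Notation "''[' u , v ]" := (dot u v) : ring_scope.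

(** Householder reflection for a unit vector [w]. With [w] along their difference it exchanges two
    unit vectors whose inner product is real, which is how vertices are moved. *)
Definition hreflect w x := x - (2 * '[x, w]) *: w.

(* All that the argument uses about [conj_class]. *)
Record orbit_class (V : set (H -> H)) : Prop := OrbitClass {
  oc_linear : forall A, V A -> linear A;
  oc_self_adjoint : forall A, V A -> forall x y, '[A x, y] = '[x, A y];
  oc_decomp : forall A, V A -> forall x, exists xs : 'I_k -> H,
    x = \sum_i xs i /\ forall i, A (xs i) = a i *: xs i;
  oc_dim : forall A, V A -> forall i, has_dim [set x | A x = a i *: x] (d i);
  oc_reflect : forall A w, V A -> '[w, w] = 1 ->
    V (hreflect w \o A \o hreflect w) }.

Variable V : set (H -> H).
Hypothesis ocV : orbit_class V.
Hypothesis a_real : forall i, (a i)^* = a i.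
Hypothesis a_inj : injective a.

Lemma vertexD A (VA : V A) x y : A (x + y) = A x + A y.
Proof. by have /(_ 1 x y) := oc_linear ocV VA; rewrite !scale1r. Qed.
Lemma vertex0 A (VA : V A) : A 0 = 0.
Proof. by apply: (addrI (A 0)); rewrite -(vertexD VA) !addr0. Qed.
Lemma vertexZ A (VA : V A) c x : A (c *: x) = c *: A x.
Proof. by have /(_ c x 0) := oc_linear ocV VA; rewrite (vertex0 VA) !addr0. Qed.
Lemma vertexN A (VA : V A) x : A (- x) = - A x.
Proof. by rewrite -scaleN1r (vertexZ VA) scaleN1r. Qed.
Lemma vertexB A (VA : V A) x y : A (x - y) = A x - A y.
Proof. by rewrite (vertexD VA) (vertexN VA). Qed.
Lemma vertex_sum A (VA : V A) n (F : 'I_n -> H) : A (\sum_i F i) = \sum_i A (F i).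
Proof. by apply: (big_morph A); [move=> *; exact: vertexD | exact: vertex0]. Qed.
Lemma vertex_sa A (VA : V A) x y : '[A x, y] = '[x, A y].
Proof. exact: (oc_self_adjoint ocV). Qed.

Lemma eig_subspace A i : V A -> subspace [set x | A x = a i *: x].
Proof.
move=> VA; split => [|c x y /= Ax Ay]; first by rewrite /= (vertex0 VA) scaler0.
by rewrite (vertexD VA) (vertexZ VA) Ax Ay scalerDr !scalerA mulrC.
Qed.

Lemma eig_orth A i j x y : V A -> i != j -> A x = a i *: x -> A y = a j *: y ->
  '[x, y] = 0.
Proof.
move=> VA ij Ax Ay; have := vertex_sa VA x y; rewrite Ax Ay dotZl dotZr a_real => /eqP.
rewrite -subr_eq0 -mulrBl mulf_eq0 subr_eq0 => /orP[/eqP /a_inj e|/eqP //].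
by rewrite e eqxx in ij.
Qed.

Lemma eig_inj A i j x : V A -> x <> 0 -> A x = a i *: x -> A x = a j *: x -> i = j.
Proof.
move=> VA x0 -> /eqP; rewrite -subr_eq0 -scalerBl scaler_eq0 subr_eq0.
by case/orP => [/eqP /a_inj //|/eqP].
Qed.

(* This unfolds to [proj] applied to the [i]-th eigenspace. *)
Definition eigcomp A i x :=
  xget 0 [set y | A y = a i *: y /\ forall z, A z = a i *: z -> '[x - y, z] = 0].

Lemma eigcomp_uniq A i x y : V A -> A y = a i *: y ->
  (forall z, A z = a i *: z -> '[x - y, z] = 0) -> eigcomp A i x = y.
Proof.
move=> VA Ay hy; rewrite /eigcomp; case: xgetP => [y' _ /= [Ay' hy']|/(_ y)]; last first.
  by case; split.
apply/eqP; rewrite -subr_eq0; apply/eqP/(@dot_eq0P _ _ dot).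
have e : A (y' - y) = a i *: (y' - y) by rewrite (vertexB VA) Ay Ay' scalerBr.
have -> : '[y' - y, y' - y] = '[x - y, y' - y] - '[x - y', y' - y].
  by rewrite !dotlE; ring.
by rewrite hy // hy' // subrr.
Qed.

Lemma eigcomp_sum A x : V A -> \sum_i eigcomp A i x = x.
Proof.
move=> VA; have [xs [xE Axs]] := oc_decomp ocV VA x.
rewrite [RHS]xE; apply: eq_bigr => i _; apply: eigcomp_uniq => // z Az.
rewrite xE (bigD1 i) //= addrAC subrr add0r dot_suml big1 // => j ji.
exact: (eig_orth VA ji).
Qed.

Lemma eigcomp_eigP A i x : V A -> A (eigcomp A i x) = a i *: eigcomp A i x /\
  forall z, A z = a i *: z -> '[x - eigcomp A i x, z] = 0.
Proof.
move=> VA; rewrite /eigcomp; case: xgetP => [y' _ //|].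
have [xs [xE Axs]] := oc_decomp ocV VA x.
move=> /(_ (xs i)) []; split => // z Az.
rewrite xE (bigD1 i) //= addrAC subrr add0r dot_suml big1 // => j ji.
exact: (eig_orth VA ji).
Qed.

Lemma eigcompE A i x : V A -> A (eigcomp A i x) = a i *: eigcomp A i x.
Proof. by move=> /(eigcomp_eigP i x) []. Qed.

Lemma eigcomp_dot A i x z : V A -> A z = a i *: z -> '[eigcomp A i x, z] = '[x, z].
Proof.
by move=> VA Az; apply/esym/eqP; rewrite -subr_eq0 -dotBl; apply/eqP;
  apply: (eigcomp_eigP i x VA).2.
Qed.

Lemma eigcomp_dot0 A i j x z : V A -> A z = a j *: z -> '[x, z] = 0 ->
  '[eigcomp A i x, z] = 0.
Proof.
move=> VA Az xz; have [ij|ij] := eqVneq i j; first by rewrite eigcomp_dot // ij.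
by apply: (eig_orth VA ij) => //; exact: eigcompE.
Qed.

Lemma eigcomp_comm A D i x : V A -> (forall x y, D (x - y) = D x - D y) ->
  (forall x y, '[D x, y] = '[x, D y]) -> (forall c x, D (c *: x) = c *: D x) ->
  (forall x, A (D x) = D (A x)) -> eigcomp A i (D x) = D (eigcomp A i x).
Proof.
move=> VA DB Dsa DZ cAD; have [e h] := eigcomp_eigP i x VA.
apply: eigcomp_uniq => // [|z Az]; first by rewrite cAD e DZ.
by rewrite -DB Dsa h // cAD Az DZ.
Qed.

Lemma eigcompZ A i c x : V A -> eigcomp A i (c *: x) = c *: eigcomp A i x.
Proof.
move=> VA; have [e h] := eigcomp_eigP i x VA.
apply: eigcomp_uniq => // [|z Az]; first by rewrite (vertexZ VA) e !scalerA mulrC.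
by rewrite -scalerBr dotZl h // mulr0.
Qed.

Lemma eigcomp_exists A x : V A -> x <> 0 -> exists i, eigcomp A i x <> 0.
Proof.
move=> VA x0; apply: contrapT => h; apply: x0.
rewrite -(eigcomp_sum x VA) big1 // => i _.
by apply: contrapT => h'; apply: h; exists i.
Qed.

Lemma vertex_eq A B : V A -> V B ->
  (forall n x, A x = a n *: x -> B x = a n *: x) -> A = B.
Proof.
move=> VA VB h; apply/funext => x; rewrite -(eigcomp_sum x VA) (vertex_sum VA) (vertex_sum VB).
by apply: eq_bigr => i _; rewrite eigcompE // (h i) // eigcompE.
Qed.

(** The missing eigenspace is the orthogonal complement of the others, so vertices can be compared
    without touching an infinite-dimensional colour. *)
Lemma vertex_eq_but_one A B c : V A -> V B ->
  (forall n, n != c -> forall x, A x = a n *: x <-> B x = a n *: x) -> A = B.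
Proof.
move=> VA VB h; apply: vertex_eq => // n x Ax.
have [nc|nc] := eqVneq n c; last by apply/(h n nc).
have e m : m != c -> eigcomp B m x = 0.
  move=> mc; apply: (@dot_eq0P _ _ dot); have Bm := eigcompE m x VB.
  rewrite eigcomp_dot //; apply: (eig_orth (i := n) (j := m) VA _ Ax).
    by rewrite nc eq_sym.
  by apply/(h m mc).
have := eigcomp_sum x VB; rewrite (bigD1 c) //= big1 ?addr0 => [<-|m /e //].
by rewrite nc (eigcompE c x VB).
Qed.

(* [B] arises from [A] by exchanging the line of [p] in the [i]-th eigenspace
   with the line of [q] in the [l]-th one; see [swap_adj] and [adj_swap]. *)
Definition swap A B i p l q := [/\ i != l, '[p, p] = 1 /\ '[q, q] = 1,
  A p = a i *: p, A q = a l *: q &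
  forall x, B x = A x + (a l - a i) *: ('[x, p] *: p - '[x, q] *: q)].

Section Swap.
Variables (A B : H -> H) (i l : 'I_k) (p q : H).
Hypotheses (VA : V A) (AB : swap A B i p l q).

Lemma swap_ne : i != l. Proof. by case: AB. Qed.
Lemma swap_p1 : '[p, p] = 1. Proof. by case: AB => _ []. Qed.
Lemma swap_q1 : '[q, q] = 1. Proof. by case: AB => _ []. Qed.
Lemma swap_p : A p = a i *: p. Proof. by case: AB. Qed.
Lemma swap_q : A q = a l *: q. Proof. by case: AB. Qed.
Lemma swap_pq : '[p, q] = 0.
Proof. by case: AB => il _ Ap Aq _; apply: (eig_orth VA il). Qed.
Lemma swap_qp : '[q, p] = 0.
Proof. exact: (dotC0 swap_pq). Qed.
Lemma swapE x : B x = A x + (a l - a i) *: ('[x, p] *: p - '[x, q] *: q).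
Proof. by case: AB. Qed.

Lemma swap_flip : swap A B l q i p.
Proof.
split; rewrite 1?eq_sym ?swap_ne ?swap_p ?swap_q ?swap_p1 ?swap_q1 // => x.
by rewrite swapE -opprB scaleNr -scalerN opprB.
Qed.

Lemma swap_Bp : B p = a l *: p.
Proof.
rewrite swapE swap_p swap_p1 swap_pq scale0r subr0 scale1r -scalerDl.
by congr (_ *: _); ring.
Qed.
Lemma swap_Bq : B q = a i *: q.
Proof.
rewrite swapE swap_q swap_q1 swap_qp scale0r sub0r scale1r scalerN -scalerBl.
by congr (_ *: _); ring.
Qed.

Lemma swap_back : swap B A i q l p.
Proof.
split; rewrite ?swap_ne ?swap_p1 ?swap_q1 ?swap_Bp ?swap_Bq // => x.
by rewrite swapE; vec dot.
Qed.

Lemma swap_orth x n : A x = a n *: x -> '[x, p] = 0 -> '[x, q] = 0 -> B x = a n *: x.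
Proof. by move=> Ax xp xq; rewrite swapE Ax xp xq !scale0r subrr scaler0 addr0. Qed.

(** [B] is the conjugate of [A] by the reflection along [p - q], which exchanges [p] and [q]. *)
Lemma swap_V : V B.
Proof.
have pq0 : p - q <> 0.
  move=> e; have := swap_p1; rewrite -{2}(subrK q p) e add0r swap_pq => /eqP.
  by rewrite eq_sym oner_eq0.
have [c c0 cw] := normalize dot pq0.
have cc : c * c^* * 2 = 1.
  rewrite -[RHS]cw dotZl dotZr !dotlE !dotrE swap_p1 swap_q1 swap_pq swap_qp; ring.
have TE x : hreflect (c *: (p - q)) x = x - '[x, p - q] *: (p - q).
  rewrite /hreflect scalerA dotZr; congr (_ - _ *: _).
  by rewrite -[RHS]mul1r -[X in _ = X * _]cc; ring.
have -> : B = hreflect (c *: (p - q)) \o A \o hreflect (c *: (p - q)).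
  apply/funext => x /=; rewrite swapE !TE (vertexB VA) (vertexZ VA) (vertexB VA) swap_p swap_q.
  apply: (@dot_inj _ _ dot) => z.
  have eAp : '[A x, p] = a i * '[x, p] by rewrite (vertex_sa VA) swap_p dotZr a_real.
  have eAq : '[A x, q] = a l * '[x, q] by rewrite (vertex_sa VA) swap_q dotZr a_real.
  rewrite !(dotlE, dotrE) eAp eAq swap_p1 swap_q1 swap_pq swap_qp; ring.
exact: (oc_reflect ocV).
Qed.

End Swap.

Lemma swap_fun A B B' i l p p' q q' : swap A B i p l q -> swap A B' i p' l q' ->
  par p p' -> par q q' -> B = B'.
Proof.
move=> [_ [p1 q1] _ _ BE] [_ [p1' q1'] _ _ BE'] pp qq; apply/funext => x.
by rewrite BE BE' (par_unit p1 p1' pp) (par_unit q1 q1' qq).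
Qed.

Lemma swap_par A B i l p p' q q' : V A -> swap A B i p l q ->
  '[p', p'] = 1 -> '[q', q'] = 1 -> par p p' -> par q q' -> swap A B i p' l q'.
Proof.
move=> VA [il [p1 q1] Ap Aq BE] p1' q1' pp qq; split => // [||x].
- by case: pp => c ->; rewrite (vertexZ VA) Ap !scalerA mulrC.
- by case: qq => c ->; rewrite (vertexZ VA) Aq !scalerA mulrC.
by rewrite BE (par_unit p1 p1' pp) (par_unit q1 q1' qq).
Qed.

Definition swap_op A i l p q x := A x + (a l - a i) *: ('[x, p] *: p - '[x, q] *: q).

Lemma swap_swap_op A i l p q : i != l -> '[p, p] = 1 -> '[q, q] = 1 ->
  A p = a i *: p -> A q = a l *: q -> swap A (swap_op A i l p q) i p l q.
Proof. by []. Qed.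

Lemma swap_other A B i l p q n x : V A -> swap A B i p l q -> n != i -> n != l ->
  A x = a n *: x <-> B x = a n *: x.
Proof.
move=> VA AB ni nl; have VB := swap_V VA AB; split => [Ax|Bx].
  apply: (swap_orth AB Ax); first exact: (eig_orth VA ni Ax (swap_p AB)).
  exact: (eig_orth VA nl Ax (swap_q AB)).
have BA := swap_back VA AB; apply: (swap_orth BA Bx).
  exact: (eig_orth VB ni Bx (swap_p BA)).
exact: (eig_orth VB nl Bx (swap_q BA)).
Qed.

Lemma swap_eig_i A B i l p q x : V A -> swap A B i p l q -> A x = a i *: x ->
  '[x, p] = 0 -> B x = a i *: x.
Proof.
move=> VA AB Ax xp; apply: (swap_orth AB Ax xp).
exact: (eig_orth VA (swap_ne AB) Ax (swap_q AB)).
Qed.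

Lemma a_sub_neq0 i j : i != j -> a i - a j != 0.
Proof. by move=> ij; rewrite subr_eq0; apply: contra ij => /eqP/a_inj ->. Qed.

Lemma swap_neq A B i l p q : V A -> swap A B i p l q -> A <> B.
Proof.
move=> VA AB e; have := swap_Bp VA AB; rewrite -e => h.
have := swap_ne AB; rewrite (eig_inj VA (unit_neq0 (swap_p1 AB)) (swap_p AB) h).
by rewrite eqxx.
Qed.

Lemma swap_uniq_par A B i l p q r s : V A -> swap A B i p l q -> swap A B i r l s ->
  par p r.
Proof.
move=> VA AB AB'; have Ar := swap_p AB'; exists '[r, p].
have := swapE AB r; rewrite (swapE AB') => /addrI.
have := a_sub_neq0 (swap_ne AB); rewrite -opprB oppr_eq0 => nz /(scalerI nz).
rewrite (eig_orth VA (swap_ne AB) Ar (swap_q AB)) (eig_orth VA (swap_ne AB) Ar (swap_q AB')).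
by rewrite !scale0r !subr0 (swap_p1 AB') scale1r.
Qed.

(** A swap changes the eigenspaces of its two colours only, which fixes the pair of colours; the
    lines are then read off from the difference. Only the order of the two sides is free. *)
Lemma swap_uniq A B i l p q i' l' p' q' : V A -> swap A B i p l q -> swap A B i' p' l' q' ->
  [/\ i = i', l = l', par p p' & par q q'] \/
  [/\ i = l', l = i', par p q' & par q p'].
Proof.
move=> VA AB AB'; have VB := swap_V VA AB.
have key j m r s : swap A B j r m s -> (j == i) || (j == l).
  move=> AB0; apply: contraT; rewrite negb_or => /andP[ji jl].
  have := (swap_other r VA AB ji jl).1 (swap_p AB0) => Br.
  have := eig_inj VB (unit_neq0 (swap_p1 AB0)) Br (swap_Bp VA AB0) => jm.
  by have := swap_ne AB0; rewrite jm eqxx.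
have AB'f := swap_flip AB'; have ABf := swap_flip AB; have il' := swap_ne AB'.
have := key _ _ _ _ AB'; have := key _ _ _ _ AB'f.
case/orP => /eqP e1 /orP[] /eqP e2; subst; rewrite ?eqxx // in il' *.
  right; split => //; first exact: (swap_uniq_par VA AB AB'f).
  exact: (swap_uniq_par VA ABf AB').
left; split => //; first exact: (swap_uniq_par VA AB AB').
exact: (swap_uniq_par VA ABf AB'f).
Qed.

(** * Adjacent vertices differ by a swap *)

Definition adj A B := [/\ V A, V B, A \o B = B \o A & has_rank (A \- B) 2].

Lemma swap_adj A B i p l q : V A -> swap A B i p l q -> adj A B.
Proof.
move=> VA AB; have VB := swap_V VA AB; split => //.
  apply/funext => x /=; rewrite !(swapE AB) (vertexD VA) (vertexZ VA) (vertexB VA) !(vertexZ VA).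
  rewrite (swap_p AB) (swap_q AB) !(vertex_sa VA) (swap_p AB) (swap_q AB) !dotZr !a_real.
  by vec dot.
have nz := a_sub_neq0 (swap_ne AB).
have DE x : (A \- B) x = ((a i - a l) * '[x, p]) *: p - ((a i - a l) * '[x, q]) *: q.
  by rewrite /= (swapE AB); vec dot.
exists (fun j : 'I_2 => if j == ord0 then p else q); split => [c|].
  rewrite !big_ord_recl big_ord0 /= addr0 => c0.
  have := congr1 (dot^~ p) c0; have := congr1 (dot^~ q) c0.
  rewrite !dotlE (swap_p1 AB) (swap_q1 AB) (swap_pq VA AB) (swap_qp VA AB).
  rewrite !mulr0 !mulr1 addr0 add0r => e1 e0 j.
  by case: (unliftP ord0 j) => [j'|] -> //; rewrite (ord1 j').
apply/seteqP; split => [x [y _ <-]|x [c _ <-]].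
  exists (fun j => if j == ord0 then (a i - a l) * '[y, p] else - ((a i - a l) * '[y, q])) => //.
  by rewrite DE !big_ord_recl big_ord0 /= addr0 scaleNr.
exists ((a i - a l)^-1 *: (c ord0 *: p - c (lift ord0 ord0) *: q)) => //.
rewrite DE !big_ord_recl big_ord0 /= addr0 !dotlE (swap_p1 AB) (swap_q1 AB).
rewrite (swap_pq VA AB) (swap_qp VA AB) !mulr0 !mulr1 !subr0 sub0r !mulrN !mulrA.
by rewrite mulfV // !mul1r scaleNr opprK.
Qed.

(** The only colour that may be infinite-dimensional; if there is none, any colour serves. *)
Variable c0 : 'I_k.
Hypothesis d_fin : forall c, c != c0 -> d c <> None.

Lemma orthogonal_cons_unit x (s : seq H) : '[x, x] = 1 ->
  (forall y, y \in s -> '[x, y] = 0) -> pairwise_orthogonal dot s ->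
  pairwise_orthogonal dot (x :: s).
Proof.
move=> x1 xs /pairwise_orthogonalP [/= /andP[s0 us] ps].
have x0 : 0 == x = false by apply/eqP => x0; apply: (unit_neq0 x1).
have xns : x \notin s.
  by apply/negP => /xs; rewrite x1 => /eqP; rewrite oner_eq0.
apply/pairwise_orthogonalP; rewrite /= inE x0 s0 us xns; split => // y z.
rewrite !inE => /predU1P[->|ys] /predU1P[->|zs] yz; first by rewrite eqxx in yz.
- exact: xs.
- by apply: dotC0; apply: xs.
- exact: ps.
Qed.

Lemma ortho_seq_ex (X : set H) n m : subspace X -> has_basis X n -> (m <= n)%N ->
  exists s : seq H, [/\ size s = m, pairwise_orthogonal dot s &
    forall x, x \in s -> X x].
Proof.
move=> sX hX; elim: m => [|m IH] mn; first by exists [::].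
have [s [sm os Xs]] := IH (ltnW mn).
have [|x [Xx x1 xs]] := orth_ex dot (s := s) (dd := Some n) sX hX; first by rewrite sm.
exists (x :: s); split; first by rewrite /= sm.
  exact: orthogonal_cons_unit.
by move=> y; rewrite inE => /predU1P[->|/Xs].
Qed.

(** Otherwise the [i1]-eigenspace of [B] would be orthogonal to [e1] and [e2], hence contained in
    that of [A], which has [e1] in addition. This contradicts the equality of their finite
    dimensions. *)
Lemma swap_color A B e1 e2 i1 j1 j2 : V A -> V B -> '[e1, e1] = 1 ->
  A e1 = a i1 *: e1 -> B e1 = a j1 *: e1 -> B e2 = a j2 *: e2 ->
  (forall x, '[x, e1] = 0 -> '[x, e2] = 0 -> A x = B x) -> i1 != j1 -> i1 != c0 ->
  i1 = j2.
Proof.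
move=> VA VB e11 Ae1 Be1 Be2 AB ij ic; apply/eqP; apply: contraT => ij2.
have := oc_dim ocV VA i1; have := oc_dim ocV VB i1.
case di: (d i1) => [n|]; last by have := d_fin ic.
move=> /= hB hA; have [s [sn os Bs]] := ortho_seq_ex (eig_subspace i1 VB) hB (leqnn n).
have : (size (e1 :: s) <= n)%N; last by rewrite /= sn ltnn.
have s1 x : x \in s -> '[x, e1] = 0 by move=> /Bs Bx; exact: (eig_orth VB ij Bx Be1).
apply: (orthogonal_le_basis hA (dot := dot)).
  by apply: orthogonal_cons_unit => // y ys; apply: dotC0; apply: s1.
move=> y; rewrite inE => /predU1P[-> //|ys /=].
by rewrite AB ?s1 //; [apply: Bs|exact: (eig_orth VB ij2 (Bs _ ys) Be2)].
Qed.

(** The spectral projections of [A] and [B] commute with [A - B], so they keep [m] in its range, and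
    they keep it orthogonal to joint eigenvectors. *)
Lemma common_eigenvector A B m (s : seq H) : V A -> V B ->
  (forall x, A (B x) = B (A x)) -> range (A \- B) m -> m <> 0 ->
  (forall e, e \in s -> '[m, e] = 0 /\ exists i j, A e = a i *: e /\ B e = a j *: e) ->
  exists e i j, [/\ range (A \- B) e, '[e, e] = 1, A e = a i *: e, B e = a j *: e
    & forall x, x \in s -> '[e, x] = 0].
Proof.
move=> VA VB AB [x _ mE] m0 ms.
have [i mi0] := eigcomp_exists VA m0; have [j mj0] := eigcomp_exists VB mi0.
have DB y z : (A \- B) (y - z) = (A \- B) y - (A \- B) z.
  by rewrite /= (vertexB VA) (vertexB VB); vec dot.
have DZ c z : (A \- B) (c *: z) = c *: (A \- B) z.
  by rewrite /= (vertexZ VA) (vertexZ VB) scalerBr.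
have Dsa y z : '[(A \- B) y, z] = '[y, (A \- B) z].
  by rewrite /= dotBl dotBr (vertex_sa VA) (vertex_sa VB).
have [c cn0 c1] := normalize dot mj0.
exists (c *: eigcomp B j (eigcomp A i m)), i, j; split => //.
- exists (c *: eigcomp B j (eigcomp A i x)) => //; rewrite DZ -mE.
  rewrite (eigcomp_comm i x VA DB Dsa DZ) => [|z].
    by rewrite (eigcomp_comm j _ VB DB Dsa DZ) // => z; rewrite /= (vertexB VB) AB.
  by rewrite /= (vertexB VA) AB.
- rewrite (vertexZ VA) !scalerA mulrC -scalerA; congr (_ *: _).
  rewrite -(eigcomp_comm j _ VB (vertexB VA) (vertex_sa VA) (vertexZ VA)); last by move=> z; rewrite AB.
  by rewrite (eigcompE i m VA) (eigcompZ _ _ _ VB).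
- by rewrite (vertexZ VB) (eigcompE j _ VB) !scalerA mulrC.
move=> e /ms [me [i' [j' [Ae Be]]]]; rewrite dotZl.
by rewrite (eigcomp_dot0 j VB Be) ?mulr0 // (eigcomp_dot0 i VA Ae).
Qed.

(** The range of [A - B] has an orthonormal basis [e1], [e2] of joint eigenvectors, so only these
    two lines change colour; counting dimensions shows that their colours are exchanged. *)
Lemma adj_swap A B : adj A B -> exists i p l q, swap A B i p l q.
Proof.
case=> VA VB /funeqP /= cAB rk.
have sM : subspace (range (A \- B)).
  split => [|c x y [u _ <-] [v _ <-]].
    by exists 0 => //=; rewrite (vertex0 VA) (vertex0 VB) subrr.
  exists (c *: u + v) => //=; rewrite (vertexD VA) (vertexD VB) (vertexZ VA) (vertexZ VB).
  by vec dot.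
have [||m1 [Mm1 m11 _]] := orth_ex dot (s := [::]) (dd := Some 2%N) sM => //.
have [|//|e1 [i1 [j1 [Me1 e11 Ae1 Be1 _]]]] :=
  common_eigenvector (s := [::]) VA VB cAB Mm1; first exact: (unit_neq0 m11).
have [||m2 [Mm2 m22 m2e]] := orth_ex dot (s := [:: e1]) (dd := Some 2%N) sM => //.
have [||e2 [i2 [j2 [Me2 e22 Ae2 Be2 e2s]]]] :=
  common_eigenvector (s := [:: e1]) VA VB cAB Mm2; first exact: (unit_neq0 m22).
  move=> e; rewrite inE => /eqP ->; split; first by apply: m2e; rewrite inE.
  by exists i1, j1.
have e21 : '[e2, e1] = 0 by apply: e2s; rewrite inE.
have e12 := dotC0 e21.
have MD z : range (A \- B) z -> z = '[z, e1] *: e1 + '[z, e2] *: e2.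
  move=> Mz; apply/eqP; rewrite -subr_eq0; apply/negPn/negP => nz.
  set w := _ - _ in nz.
  have Mw : range (A \- B) w.
    apply: (subspaceB sM) => //; apply: (subspaceD sM); exact: (subspaceZ _ sM).
  have w1 : '[w, e1] = 0 by rewrite /w !dotlE e11 e21; ring.
  have w2 : '[w, e2] = 0 by rewrite /w !dotlE e22 e12; ring.
  have : (size [:: w; e1; e2] <= 2)%N; last by [].
  apply: (orthogonal_le_basis rk (dot := dot)); last first.
    by move=> x; rewrite !inE => /or3P[] /eqP ->.
  rewrite /pairwise_orthogonal /= !inE !negb_or w1 w2 e12 !eqxx ![0 == _]eq_sym nz.
  by rewrite -(dnorm_eq0 dot e1) -(dnorm_eq0 dot e2) e11 e22 oner_eq0.
have Dsa y z : '[(A \- B) y, z] = '[y, (A \- B) z].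
  by rewrite /= dotBl dotBr (vertex_sa VA) (vertex_sa VB).
have ne e i j : range (A \- B) e -> '[e, e] = 1 -> A e = a i *: e ->
    B e = a j *: e -> i != j.
  move=> [y _ eE] ee Ae Be; apply/eqP => ij; have /eqP := ee; rewrite -{1}eE Dsa.
  by rewrite /= Ae Be ij subrr dot0r eq_sym oner_eq0.
have n1 := ne _ _ _ Me1 e11 Ae1 Be1; have n2 := ne _ _ _ Me2 e22 Ae2 Be2.
have DE x : (A \- B) x = ((a i1 - a j1) * '[x, e1]) *: e1 + ((a i2 - a j2) * '[x, e2]) *: e2.
  rewrite [LHS]MD; last by exists x.
  rewrite !Dsa /= Ae1 Be1 Ae2 Be2 -!scalerBl !dotZr !rmorphB /= !a_real.
  by [].
have eqAB x : '[x, e1] = 0 -> '[x, e2] = 0 -> A x = B x.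
  move=> x1 x2; apply/eqP; rewrite -subr_eq0; apply/eqP.
  by have := DE x; rewrite x1 x2 !mulr0 !scale0r addr0.
have eqAB' x : '[x, e2] = 0 -> '[x, e1] = 0 -> A x = B x by move=> *; exact: eqAB.
(* If [i1] is [c0], the dimensions are counted at [j2] with [A] and [B] exchanged; if both are [c0],
   they agree. *)
have i1j2 : i1 = j2.
  have [ic|ic] := eqVneq i1 c0; last exact: (swap_color VA VB e11 Ae1 Be1 Be2 eqAB n1 ic).
  have [-> //|jc] := eqVneq j2 c0.
  apply/esym; apply: (swap_color VB VA e22 Be2 Ae2 Ae1) jc; last by rewrite eq_sym.
  by move=> x *; rewrite eqAB.
have i2j1 : i2 = j1.
  have [ic|ic] := eqVneq i2 c0; last exact: (swap_color VA VB e22 Ae2 Be2 Be1 eqAB' n2 ic).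
  have [-> //|jc] := eqVneq j1 c0.
  apply/esym; apply: (swap_color VB VA e11 Be1 Ae1 Ae2) jc; last by rewrite eq_sym.
  by move=> x *; rewrite eqAB.
exists i1, e1, i2, e2; split => // [|x]; first by rewrite i2j1.
have := DE x; rewrite -i1j2 -i2j1 /= => h.
by rewrite -[LHS](subKr (A x)) h; vec dot.
Qed.

(** * Pencils *)

Lemma adj_irr A : ~ adj A A.
Proof.
move=> AA; have [VA _ _ _] := AA; have [i [p [l [q h]]]] := adj_swap AA.
exact: (swap_neq VA h).
Qed.

Lemma adj_sym A B : adj A B -> adj B A.
Proof.
move=> AB; have [VA VB _ _] := AB; have [i [p [l [q h]]]] := adj_swap AB.
by apply: swap_adj VB (swap_back VA h).
Qed.

Lemma swap_change_q A B B' i l p q q' : V A -> swap A B i p l q -> swap A B' i p l q' ->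
  '[q, q'] = 0 -> swap B B' i q l q'.
Proof.
move=> VA AB AB' qq; split; first exact: (swap_ne AB).
- by rewrite (swap_q1 AB) (swap_q1 AB').
- exact: swap_Bq VA AB.
- apply: (swap_eig_i VA (swap_flip AB) (swap_q AB')); exact: dotC0.
by move=> x; rewrite (swapE AB) (swapE AB'); vec dot.
Qed.

Lemma swap_change_p A B B' i l p p' q : V A -> swap A B i p l q -> swap A B' i p' l q ->
  '[p, p'] = 0 -> swap B B' l p i p'.
Proof. by move=> VA AB AB'; apply: swap_change_q VA (swap_flip AB) (swap_flip AB'). Qed.

Lemma no_three_orth A B x y z : adj A B ->
  range (A \- B) x -> range (A \- B) y -> range (A \- B) z ->
  x <> 0 -> y <> 0 -> z <> 0 -> '[x, y] = 0 -> '[x, z] = 0 -> '[y, z] = 0 -> False.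
Proof.
move=> [_ _ _ rk] Rx Ry Rz /eqP x0 /eqP y0 /eqP z0 xy xz yz.
have : (size [:: x; y; z] <= 2)%N; last by [].
apply: (orthogonal_le_basis rk (dot := dot)); last first.
  by move=> u; rewrite !inE => /or3P[] /eqP ->.
by rewrite /pairwise_orthogonal /= !inE !negb_or xy xz yz !eqxx ![0 == _]eq_sym x0 y0 z0.
Qed.

Lemma range_diff A B m n x : V A -> V B -> m != n -> A x = a m *: x -> B x = a n *: x ->
  range (A \- B) x.
Proof.
move=> VA VB mn Ax Bx; exists ((a m - a n)^-1 *: x) => //=.
rewrite (vertexZ VA) (vertexZ VB) Ax Bx -scalerBr -scalerBl scalerA mulVf ?scale1r //.
exact: a_sub_neq0.
Qed.

(* Distinct colours of the two swaps would make [B - C0] of rank at least 3. *)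
Lemma nbr_adj_color A B C0 i p l q i' p' l' q' : V A ->
  swap A B i p l q -> swap A C0 i' p' l' q' -> adj B C0 -> (i == i') || (i == l').
Proof.
move=> VA AB AC BC; apply: contraT; rewrite negb_or => /andP[ii il].
have VB := swap_V VA AB; have VC := swap_V VA AC.
have [Bp Bq Cp' Cq'] := And4 (swap_Bp VA AB) (swap_Bq VA AB) (swap_Bp VA AC) (swap_Bq VA AC).
have [Ap Aq Ap' Aq'] := And4 (swap_p AB) (swap_q AB) (swap_p AC) (swap_q AC).
have [p1 q1 p1' q1'] := And4 (swap_p1 AB) (swap_q1 AB) (swap_p1 AC) (swap_q1 AC).
have u0 := @unit_neq0 _ _ dot.
have Cp := (swap_other p VA AC ii il).1 Ap.
have Rp : range (B \- C0) p by apply: (range_diff VB VC _ Bp Cp); rewrite eq_sym (swap_ne AB).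
exfalso.
wlog li : i' l' p' q' AC ii il Cp' Cq' Ap' Aq' p1' q1' / l = i' \/ (l != i') && (l != l').
  move=> h; have [li|li] := eqVneq l i'; first by apply: (h i' l' p' q') => //; left.
  have [ll|ll] := eqVneq l l'; last by apply: (h i' l' p' q') => //; right; rewrite li ll.
  by apply: (h l' i' q' p') => //; [exact: swap_flip|left].
case: li => [e|/andP[li ll]]; last first.
  have Cq := (swap_other q VA AC li ll).1 Aq.
  have Rq := range_diff VB VC (swap_ne AB) Bq Cq.
  have Bp' : B p' = a i' *: p'.
    by apply/(swap_other p' VA AB) => //; rewrite eq_sym.
  have Rp' := range_diff VB VC (swap_ne AC) Bp' Cp'.
  apply: (no_three_orth BC Rp Rq Rp'); try exact: u0.
  - exact: (swap_pq VA AB).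
  - exact: (eig_orth VA ii Ap Ap').
  - exact: (eig_orth VA li Aq Ap').
subst i'; have ne := swap_ne AC; rewrite eq_sym in ne.
have Bq' : B q' = a l' *: q' by apply/(swap_other q' VA AB) => //; rewrite eq_sym.
have Rq' : range (B \- C0) q' by apply: (range_diff VB VC _ Bq' Cq').
(* Both [q] and [p'] have colour [l] in [A] and need not be orthogonal, so the third vector is the
   image of [q], which still has colour [l] in [A]. *)
have Rz : range (B \- C0) (B q - C0 q) by exists q.
have Az : A (B q - C0 q) = a l *: (B q - C0 q).
  rewrite Bq (swapE AC) (eig_orth VA (swap_ne AC) Aq Aq') scale0r subr0 Aq.
  by rewrite !(vertexB VA) !(vertexD VA) !(vertexZ VA) Aq Ap'; vec dot.
apply: (no_three_orth BC Rp Rq' Rz); try exact: u0.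
- move=> z0; have e : B q = C0 q by apply/eqP; rewrite -subr_eq0 z0.
  have : par p' q.
    exists ((a i - a l)^-1 * ((a l' - a l) * '[q, p'])).
    apply: (scalerI (a_sub_neq0 (swap_ne AB))); rewrite !scalerA mulrA mulfV ?a_sub_neq0 ?(swap_ne AB) //.
    rewrite mul1r; have := swapE AC q; rewrite -e Bq Aq (eig_orth VA (swap_ne AC) Aq Aq').
    by rewrite scale0r subr0 => h; rewrite scalerBl h; vec dot.
  case=> c qE; have Cq : C0 q = a l' *: q by rewrite qE (vertexZ VC) Cp' !scalerA mulrC.
  by have := il; rewrite (eig_inj VB (u0 _ q1) Bq (etrans e Cq)) eqxx.
- exact: (eig_orth VA il Ap Aq').
- exact: (eig_orth VA (swap_ne AB) Ap Az).
- exact: (eig_orth VA ne Aq' Az).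
Qed.

(** If [q] and [q'] were not orthogonal, commutativity evaluated at [q] would make [q'] an
    eigenvector of [B] of colour [i]; then [q'] lies on the line of [q] and [B = C0]. *)
Lemma nbr_adj_same A B C0 i p l q q' : V A ->
  swap A B i p l q -> swap A C0 i p l q' -> adj B C0 -> '[q, q'] = 0.
Proof.
move=> VA AB AC BC; have VB := swap_V VA AB; have VC := swap_V VA AC.
apply: contrapT => /eqP qq; have [_ _ /funeqP /= cBC _] := BC.
have il := a_sub_neq0 (swap_ne AB).
have Cq : C0 q = a l *: q - ((a l - a i) * '[q, q']) *: q'.
  by rewrite (swapE AC) (swap_qp VA AB) (swap_q AB); vec dot.
have Bq' : B q' = a i *: q'.
  apply: (scalerI (a := (a i - a l) * '[q, q'])); first by rewrite mulf_neq0.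
  have /= := cBC q; rewrite (swap_Bq VA AB) (vertexZ VC) Cq (vertexB VB) !(vertexZ VB) (swap_Bq VA AB) => h.
  have -> : ((a i - a l) * '[q, q']) *: B q' =
     (a l *: (a i *: q) - ((a l - a i) * '[q, q']) *: B q') - a l *: (a i *: q) by vec dot.
  by rewrite h; vec dot.
apply: (@adj_irr B); suff {2}-> : B = C0 by [].
apply: (swap_fun AB AC); first exact: par_refl.
exists '[q', q]; apply: (scalerI il).
have := swapE AB q'; rewrite Bq' (swap_qp VA AC) (swap_q AC) => h.
by rewrite scalerBl h; vec dot.
Qed.

(** The link of [A] is like a grid: one line is kept and the other is replaced by an orthogonal one.
    If both lines changed, the range of [B - C0] would contain three nonzero orthogonal vectors. *)
Lemma nbr_adj A B C0 i p l q : V A -> swap A B i p l q -> adj A C0 -> adj B C0 ->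
  (exists2 q', swap A C0 i p l q' & '[q, q'] = 0) \/
  (exists2 p', swap A C0 i p' l q & '[p, p'] = 0).
Proof.
move=> VA AB AC BC; have [i1 [p' [l1 [q' {}AC]]]] := adj_swap AC.
have VB := swap_V VA AB; have VC := swap_V VA AC.
have {i1 l1 p' q' AC} [p' [q' AC]] : exists p' q', swap A C0 i p' l q'.
  have := nbr_adj_color VA AB AC BC; have := nbr_adj_color VA (swap_flip AB) AC BC.
  have ne := swap_ne AB.
  case/orP => /eqP e1 /orP[] /eqP e2; subst; rewrite ?eqxx // in ne *.
    by exists q', p'; apply: swap_flip.
  by exists p', q'.
have [Bp Bq Cp' Cq'] := And4 (swap_Bp VA AB) (swap_Bq VA AB) (swap_Bp VA AC) (swap_Bq VA AC).
have [Ap Aq Ap' Aq'] := And4 (swap_p AB) (swap_q AB) (swap_p AC) (swap_q AC).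
have [p1 q1 p1' q1'] := And4 (swap_p1 AB) (swap_q1 AB) (swap_p1 AC) (swap_q1 AC).
have [pp|pp] := pselect (par p p').
  have AC' : swap A C0 i p l q'.
    exact: (swap_par VA AC p1 q1' (par_sym p1' pp) (par_refl _)).
  by left; exists q' => //; exact: nbr_adj_same AB AC' BC.
have [qq|qq] := pselect (par q q').
  have AC' : swap A C0 i p' l q.
    exact: (swap_par VA AC p1' q1 (par_refl _) (par_sym q1' qq)).
  by right; exists p' => //; exact: nbr_adj_same (swap_flip AB) (swap_flip AC') BC.
exfalso; have il := a_sub_neq0 (swap_ne AB).
have [pq' qp'] := (eig_orth VA (swap_ne AB) Ap Aq', dotC0 (eig_orth VA (swap_ne AB) Ap' Aq)).
have sR : subspace (range (B \- C0)).
  split => [|c x y [u _ <-] [v _ <-]].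
    by exists 0 => //=; rewrite (vertex0 VB) (vertex0 VC) subrr.
  exists (c *: u + v) => //=; rewrite (vertexD VB) (vertexD VC) (vertexZ VB) (vertexZ VC).
  by vec dot.
have E1 : (B \- C0) p = (a l - a i) *: (p - '[p, p'] *: p').
  by rewrite /= Bp (swapE AC) Ap pq'; vec dot.
have E2 : (B \- C0) q = (a i - a l) *: (q - '[q, q'] *: q').
  by rewrite /= Bq (swapE AC) Aq qp'; vec dot.
have E3 : (B \- C0) (p' - '[p', p] *: p) =
    ((a i - a l) * (1 - '[p', p] * '[p, p'])) *: p'.
  rewrite /= (vertexB VB) (vertexB VC) (vertexZ VB) (vertexZ VC) Bp Cp' (swapE AB) (swapE AC) Ap Ap' pq'.
  by rewrite (eig_orth VA (swap_ne AB) Ap' Aq); vec dot.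
have il' : a l - a i != 0 by rewrite a_sub_neq0 // eq_sym (swap_ne AB).
have R1 : range (B \- C0) (p - '[p, p'] *: p').
  rewrite -[X in range _ X](scalerK il') -E1; apply: subspaceZ sR _.
  by exists p.
have R2 : range (B \- C0) (q - '[q, q'] *: q').
  rewrite -[X in range _ X](scalerK il) -E2; apply: subspaceZ sR _.
  by exists q.
have R3 : range (B \- C0) (((a i - a l) * (1 - '[p', p] * '[p, p'])) *: p').
  by rewrite -E3; exists (p' - '[p', p] *: p).
apply: (no_three_orth BC R1 R2 R3).
- by move/(parP p p1') => /(par_sym p1).
- by move/(parP q q1') => /(par_sym q1).
- move/eqP; rewrite scaler_eq0 mulf_eq0 (negPf il) /= => /orP[/eqP h|/eqP]; last exact: (unit_neq0 p1').
  apply: pp; apply/(parP p' p1); apply: (@dot_eq0P _ _ dot).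
  by rewrite -[RHS]h !(dotlE, dotrE) p1 p1' -(dotC dot p p'); ring.
- by rewrite !(dotlE, dotrE) (swap_pq VA AB) pq' (eig_orth VA (swap_ne AB) Ap' Aq) (swap_pq VA AC); ring.
- by rewrite dotZr !dotlE p1'; ring.
- by rewrite dotZr !dotlE qp' (swap_qp VA AC); ring.
Qed.

(* Let [B] swap the lines [p], [q] and [C0] the lines [p], [r], with [r] of the
   colour of [q] and orthogonal to it. The neighbours [D] of [A] and [C0] swap
   [p] with a line orthogonal to [r], or [r] with a line orthogonal to [p]; [row]
   singles out the former ([rowP]), and [pencil] collects all swaps of [p] with
   lines of the colour of [q], provided there is room for a third orthogonal
   line ([pencilP]). *)
Definition common2 A B D := exists u v : H -> H, [/\ u <> v,
  [/\ adj A u, adj B u & adj D u], [/\ adj A v, adj B v & adj D v] &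
  forall w : H -> H, adj A w -> adj B w -> adj D w -> w = u \/ w = v].

Definition row A B C0 D := [/\ adj A B, adj A C0, adj A D, adj B C0 & adj C0 D] /\
  [\/ B = D, adj B D | ~ common2 A B D].

Definition pencil A B C0 D := exists E, row A C0 B E /\ row A B E D.

(** In a colour of dimension 2, passing twice to an orthogonal line leads back to the line of [B]; a
    member other than [B] certifies room for a third orthogonal line. *)
Definition good A B C0 := [/\ adj A B, adj B C0, adj A C0 &
  exists2 D, pencil A B C0 D & D <> B].

Lemma swap_adj_q A B B' i l p q q' : V A -> swap A B i p l q -> swap A B' i p l q' ->
  '[q, q'] = 0 -> adj B B'.
Proof.
by move=> VA AB AB' qq; apply: swap_adj (swap_V VA AB) (swap_change_q VA AB AB' qq).
Qed.

Lemma swap_adj_p A B B' i l p p' q : V A -> swap A B i p l q -> swap A B' i p' l q ->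
  '[p, p'] = 0 -> adj B B'.
Proof.
by move=> VA AB AB' pp; apply: swap_adj (swap_V VA AB) (swap_change_p VA AB AB' pp).
Qed.

Lemma swap_uniq_same A B i l p q p' q' : V A -> swap A B i p l q -> swap A B i p' l q' ->
  par p p' /\ par q q'.
Proof.
move=> VA AB AB'; case: (swap_uniq VA AB AB') => [[] //|[il]].
by have := swap_ne AB; rewrite il eqxx.
Qed.

Lemma rowP A B C0 D i p l q r : V A -> swap A B i p l q -> swap A C0 i p l r ->
  '[q, r] = 0 -> row A B C0 D <-> exists2 s, swap A D i p l s & '[r, s] = 0.
Proof.
move=> VA AB AC qr.
have [p1 q1 r1] := And3 (swap_p1 AB) (swap_q1 AB) (swap_q1 AC).
split => [[[_ _ aAD aBC aCD] h]|[s AD rs]].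
  case: (nbr_adj VA AC aAD aCD) => [//|[p' AD pp]]; exfalso.
  have p1' := swap_p1 AD; have npp := npar_orth p1 p1' pp; have nqr := npar_orth q1 r1 qr.
  case: h => [e|aBD|].
  - by rewrite -e in AD; have [/npp] := swap_uniq_same VA AB AD.
  - case: (nbr_adj VA AB aAD aBD) => [[s AD' _]|[s AD' _]].
      by have [/npp] := swap_uniq_same VA AD' AD.
    by have [_ /nqr] := swap_uniq_same VA AD' AD.
  (* In different directions the common neighbours are the two other corners of a square: [C0] swaps
     [p] with [r], and [G] swaps [p'] with [q]. *)
  pose G := swap_op A i l p' q.
  have AG : swap A G i p' l q := swap_swap_op (swap_ne AD) p1' q1 (swap_p AD) (swap_q AB).
  apply; exists C0, G; split.
  - by move=> e; rewrite e in AC; have [/npp] := swap_uniq_same VA AC AG.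
  - by split => //; [exact: swap_adj AC|exact: adj_sym].
  - split; first exact: swap_adj AG.
      exact: swap_adj_p AB AG pp.
    by apply: swap_adj_q AD AG (dotC0 qr).
  move=> w aw bw dw; case: (nbr_adj VA AB aw bw) => [[s Aw _]|[s Aw _]];
    case: (nbr_adj VA AD aw dw) => [[t Aw' _]|[t Aw' _]];
    have [pt st] := swap_uniq_same VA Aw' Aw.
  - by have := npp (par_sym p1 pt).
  - by left; apply: swap_fun Aw AC (par_refl _) (par_sym (swap_q1 Aw) st).
  - by right; apply: swap_fun Aw AG (par_sym (swap_p1 Aw) pt) (par_refl _).
  - by have := nqr (par_sym q1 st).
have [qs|qs] := pselect (par q s).
  split; last by apply: Or31; apply: swap_fun AB AD (par_refl _) qs.
  by split; [exact: swap_adj AB|exact: swap_adj AC|exact: swap_adj AD|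
    exact: swap_adj_q AB AC qr|exact: swap_adj_q AC AD rs].
split.
  by split; [exact: swap_adj AB|exact: swap_adj AC|exact: swap_adj AD|
    exact: swap_adj_q AB AC qr|exact: swap_adj_q AC AD rs].
have [s0|s0] := pselect ('[q, s] = 0).
  by apply: Or32; exact: swap_adj_q AB AD s0.
apply: Or33 => -[u [v [uv [au bu du] [av bv dv] h]]].
have key (w : H -> H) : adj A w -> adj B w -> adj D w ->
    exists t, [/\ swap A w i p l t, '[q, t] = 0 & '[s, t] = 0].
  move=> aw bw dw; case: (nbr_adj VA AB aw bw) => [[t Aw qt]|[t Aw pt]];
    case: (nbr_adj VA AD aw dw) => [[t' Aw' st]|[t' Aw' pt']];
    have [pp tt] := swap_uniq_same VA Aw' Aw.
  - by exists t; split => //; apply: par_dot0 tt st.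
  - by case: (npar_orth p1 (swap_p1 Aw') pt' (par_sym p1 pp)).
  - by case: (npar_orth p1 (swap_p1 Aw) pt pp).
  - by case: qs; apply: par_sym q1 tt.
have [t [Au qt st]] := key u au bu du.
have [t' [Av qt' st']] := key v av bv dv.
have ntt : ~ par t t' by move=> tt; apply: uv; apply: swap_fun Au Av (par_refl _) tt.
(* In the same direction two common neighbours yield a third: the line of [t + t'] is again
   orthogonal to [q] and [s]. *)
have tt0 : t + t' <> 0.
  by move=> e; apply: ntt; exists (-1); rewrite scaleN1r; apply/eqP; rewrite -addr_eq0 addrC e.
have [c c0' c1] := normalize dot tt0.
have AG : swap A (swap_op A i l p (c *: (t + t'))) i p l (c *: (t + t')).
  apply: swap_swap_op; rewrite ?(swap_ne AB) ?(swap_p AB) //.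
  by rewrite (vertexZ VA) (vertexD VA) (swap_q Au) (swap_q Av) -scalerDr !scalerA mulrC.
have := h _ (swap_adj VA AG).
have nAu : ~ par t (c *: (t + t')).
  case=> b /(congr1 (fun x => c^-1 *: x)); rewrite !scalerA mulVf // scale1r => e.
  apply: ntt; exists (c^-1 * b - 1); rewrite scalerBl scale1r -e.
  by rewrite addrC addKr.
have nAv : ~ par t' (c *: (t + t')).
  case=> b /(congr1 (fun x => c^-1 *: x)); rewrite !scalerA mulVf // scale1r => e.
  apply: ntt; apply: par_sym (swap_q1 Au) _; exists (c^-1 * b - 1).
  by rewrite scalerBl scale1r -e addrK.
case.
- by apply: (swap_adj_q VA AB AG); rewrite dotZr dotDr qt qt' addr0 mulr0.
- by apply: (swap_adj_q VA AD AG); rewrite dotZr dotDr st st' addr0 mulr0.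
- by move=> e; rewrite e in AG; have [_ /nAu] := swap_uniq_same VA Au AG.
by move=> e; rewrite e in AG; have [_ /nAv] := swap_uniq_same VA Av AG.
Qed.

(** The graph-theoretic substitute for a label: the orthogonal lines [q] and [r] of the two
    neighbours tell which line is held fixed. *)
Definition labelled A B C0 i p l := [/\ V A, dim_gt 2 (d l) &
  exists q r, [/\ swap A B i p l q, swap A C0 i p l r & '[q, r] = 0]].

Lemma orth_in A l (s : seq H) : V A -> dim_gt (size s) (d l) ->
  exists x, [/\ A x = a l *: x, '[x, x] = 1 & forall y, y \in s -> '[x, y] = 0].
Proof.
move=> VA ds; have [x [Ax x1 xs]] := orth_ex dot (eig_subspace l VA) (oc_dim ocV VA l) ds.
by exists x.
Qed.

(** One [row] only reaches lines orthogonal to a given one. A [t] orthogonal to both [q] and [s]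
    gives a detour to every [s]. *)
Lemma pencilP A B C0 D i p l : labelled A B C0 i p l ->
  pencil A B C0 D <-> exists q, swap A D i p l q.
Proof.
move=> [VA dl [q [r [AB AC qr]]]]; split => [[E [h1 h2]]|[s AD]].
  have [t AE qt] := (rowP E VA AC AB (dotC0 qr)).1 h1.
  by have [s AD _] := (rowP D VA AB AE qt).1 h2; exists s.
have [t [At t1 ts]] := orth_in (s := [:: q; s]) VA dl.
have AE : swap A (swap_op A i l p t) i p l t := swap_swap_op (swap_ne AB) (swap_p1 AB) t1 (swap_p AB) At.
have tq : '[q, t] = 0 by apply: dotC0; apply: ts; rewrite inE eqxx.
exists (swap_op A i l p t); split.
  by apply/(rowP _ VA AC AB (dotC0 qr)); exists t.
by apply/(rowP _ VA AB AE tq); exists s => //; apply: ts; rewrite !inE eqxx orbT.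
Qed.

Lemma labelled_good A B C0 i p l : labelled A B C0 i p l -> good A B C0.
Proof.
move=> L; have [VA dl [q [r [AB AC qr]]]] := L.
have BC := swap_adj_q VA AB AC qr.
split => //; [exact: swap_adj AB|exact: swap_adj AC|exists C0].
  by apply/(pencilP _ L); exists r.
by move=> e; rewrite e in BC; apply: adj_irr BC.
Qed.

(** [q], the part of [s] orthogonal to [q], and [t] are orthogonal vectors of colour [l]; the second
    is nonzero because [D] differs from [B]. *)
Lemma good_lab A B C0 : good A B C0 -> exists i p l, labelled A B C0 i p l.
Proof.
move=> [aAB aBC aAC [D [E [h1 h2]] DB]]; have [VA _ _ _] := aAB.
have {aAB aBC aAC} [i [p [l [q [r [AB AC qr]]]]]] : exists i p l q r,
    [/\ swap A B i p l q, swap A C0 i p l r & '[q, r] = 0].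
  have [i [p [l [q AB]]]] := adj_swap aAB.
  case: (nbr_adj VA AB aAC aBC) => [[r AC qr]|[r AC pr]].
    by exists i, p, l, q, r.
  by exists l, q, i, p, r; split => //; apply: swap_flip.
exists i, p, l; split => //; last by exists q, r.
have [t AE qt] := (rowP E VA AC AB (dotC0 qr)).1 h1.
have [s AD ts] := (rowP D VA AB AE qt).1 h2.
case dl: (d l) => [n|//]; have := oc_dim ocV VA l; rewrite dl /= => hl.
have [q1 s1 t1] := And3 (swap_q1 AB) (swap_q1 AD) (swap_q1 AE).
have : (size [:: q; (s - '[s, q] *: q)%R; t] <= n)%N; last by [].
apply: (orthogonal_le_basis hl (dot := dot)); last first.
  move=> x; rewrite !inE => /or3P[] /eqP -> /=; rewrite ?(swap_q AB) ?(swap_q AE) //.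
  by rewrite (vertexB VA) (vertexZ VA) (swap_q AB) (swap_q AD) !scalerBr !scalerA mulrC.
have nz x : '[x, x] = 1 -> 0 == x = false.
  by move=> x1; apply/eqP => x0; apply: (unit_neq0 x1).
have sq : 0 == s - '[s, q] *: q = false.
  apply/eqP => /esym /(parP s q1) => qs; apply: DB.
  by apply: swap_fun AD AB (par_refl _) (par_sym s1 qs).
rewrite /pairwise_orthogonal /= !inE !negb_or (nz _ q1) (nz _ t1) sq.
rewrite !(dotlE, dotrE) qt q1 (dotC0 ts) -(dotC dot q s) mulr1 subrr mulr0 subr0.
by rewrite !eqxx.
Qed.

(** * Comparing pencils at adjacent vertices *)

Lemma eig_contra A m n x : V A -> m != n -> '[x, x] = 1 -> A x = a m *: x ->
  A x = a n *: x -> False.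
Proof. by move=> VA mn x1 Am An; move: mn; rewrite (eig_inj VA (unit_neq0 x1) Am An) eqxx. Qed.

Lemma swap_commute A A' D i p l q i' u l' v : V A -> swap A D i p l q -> swap A A' i' u l' v ->
  '[p, u] = 0 -> '[p, v] = 0 -> '[q, u] = 0 -> '[q, v] = 0 ->
  swap A' (swap_op A' i l p q) i p l q /\ swap D (swap_op A' i l p q) i' u l' v.
Proof.
move=> VA AD AA' pu pv qu qv; split.
  apply: (swap_swap_op (swap_ne AD) (swap_p1 AD) (swap_q1 AD) _ _).
    exact: (swap_orth AA' (swap_p AD) pu pv).
  exact: (swap_orth AA' (swap_q AD) qu qv).
split; first exact: (swap_ne AA').
- by rewrite (swap_p1 AA') (swap_q1 AA').
- by apply: (swap_orth AD (swap_p AA') _ _); exact: dotC0.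
- by apply: (swap_orth AD (swap_q AA') _ _); exact: dotC0.
by move=> x; rewrite /swap_op (swapE AA') (swapE AD); vec dot.
Qed.

(* If [B] and [C0] move the same line to different colours, the two
   3-cycles of the lines involved are common neighbours besides [A]. *)
Lemma three_cycles A B C0 i p l q m r : V A -> swap A B i p l q -> swap A C0 i p m r ->
  l != m -> exists w1 w2 : H -> H, [/\ w1 <> w2, w1 <> A, w2 <> A,
    adj w1 B /\ adj w1 C0 & adj w2 B /\ adj w2 C0].
Proof.
move=> VA AB AC lm; have VB := swap_V VA AB; have VC := swap_V VA AC.
have [il im] := (swap_ne AB, swap_ne AC).
have [p1 q1 r1] := And3 (swap_p1 AB) (swap_q1 AB) (swap_q1 AC).
have [mi ml] : m != i /\ m != l by rewrite !(eq_sym m) im lm.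
have qr := eig_orth VA lm (swap_q AB) (swap_q AC).
have Br := (swap_other r VA AB mi ml).1 (swap_q AC).
have li : l != i by rewrite eq_sym.
have Cq := (swap_other q VA AC li lm).1 (swap_q AB).
have B1 : swap B (swap_op B i m q r) i q m r by apply: swap_swap_op => //; exact: (swap_Bq VA AB).
have B2 : swap B (swap_op B l m p r) l p m r by apply: swap_swap_op => //; exact: (swap_Bp VA AB).
have C1 : swap C0 (swap_op B i m q r) l q m p.
  split => //; first exact: (swap_Bp VA AC).
  by move=> x; rewrite /swap_op (swapE AB) (swapE AC); vec dot.
have C2 : swap C0 (swap_op B l m p r) i r l q.
  split => //; first exact: (swap_Bq VA AC).
  by move=> x; rewrite /swap_op (swapE AB) (swapE AC); vec dot.
have [V1 V2] := (swap_V VB B1, swap_V VB B2).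
have W1 := swap_Bq VB B1; have W2 := swap_Bq VB B2.
exists (swap_op B i m q r), (swap_op B l m p r); split.
- by move=> e; rewrite e in W1; exact: (eig_contra V2 il r1 W1 W2).
- by move=> e; rewrite e in W1; exact: (eig_contra VA im r1 W1 (swap_q AC)).
- by move=> e; rewrite e in W2; exact: (eig_contra VA lm r1 W2 (swap_q AC)).
- by split; apply: adj_sym; [exact: (swap_adj VB B1)|exact: (swap_adj VC C1)].
- by split; apply: adj_sym; [exact: (swap_adj VB B2)|exact: (swap_adj VC C2)].
Qed.

(** For [t] of colour [l] orthogonal to [v], give the whole plane of [p] and [u] colour [l], and
    both [v] and [t] colour [i]: the result is adjacent to [B] and [D]. Two such [t] give two
    vertices. If [p] and [u] are parallel, [B] equals [D] and other members of the pencil serve. *)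
Lemma shared_line A B D i u p l v : V A -> dim_gt 2 (d l) -> swap A B i u l v ->
  swap A D i p l v -> exists w1 w2 : H -> H, [/\ w1 <> w2, w1 <> A, w2 <> A,
    adj w1 B /\ adj w1 D & adj w2 B /\ adj w2 D].
Proof.
move=> VA dl AB AD; have VB := swap_V VA AB; have VD := swap_V VA AD.
have [il p1 v1 u1] := And4 (swap_ne AB) (swap_p1 AD) (swap_q1 AD) (swap_p1 AB).
have [Au Ap Av] := And3 (swap_p AB) (swap_p AD) (swap_q AD).
have [t [At t1 tv]] : exists t, [/\ A t = a l *: t, '[t, t] = 1 & '[t, v] = 0].
  have [|t [At t1 ts]] := orth_in (s := [:: v]) (l := l) VA; first by case: (d l) dl => //= n /ltnW.
  by exists t; split => //; apply: ts; rewrite inE.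
have [t' [At' t1' ts]] := orth_in (s := [:: v; t]) (l := l) VA dl.
have tv' : '[t', v] = 0 by apply: ts; rewrite inE eqxx.
have tt : '[t, t'] = 0 by apply: dotC0; apply: ts; rewrite !inE eqxx orbT.
have [pu|pu] := pselect (par p u).
  have e : D = B by apply: (swap_fun AD AB pu (par_refl _)).
  have D1 : swap A (swap_op A i l p t) i p l t by apply: swap_swap_op.
  have D2 : swap A (swap_op A i l p t') i p l t' by apply: swap_swap_op.
  exists (swap_op A i l p t), (swap_op A i l p t'); rewrite -e; split.
  - move=> e'; rewrite e' in D1; have [_] := swap_uniq_same VA D1 D2.
    exact: (npar_orth t1 t1' tt).
  - by move=> e'; rewrite e' in D1; exact: (swap_neq VA D1 erefl).
  - by move=> e'; rewrite e' in D2; exact: (swap_neq VA D2 erefl).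
  - by have : adj (swap_op A i l p t) D by exact: (swap_adj_q VA D1 AD tv).
  - by have : adj (swap_op A i l p t') D by exact: (swap_adj_q VA D2 AD tv').
pose s := '[u, p].
have sC : '[p, u] = s^* by rewrite /s -dotC.
have g0 : u - s *: p <> 0 by move/(parP u p1)/pu.
have [c cn0] := normalize dot g0; set g := c *: _ => g1.
have cN : c * c^* * (1 - s * s^*) = 1.
  by rewrite -[RHS]g1 /g dotZl dotZr !(dotlE, dotrE) p1 u1 sC -/s; ring.
pose h := c *: (p - s^* *: u).
have h1 : '[h, h] = 1.
  rewrite /h dotZl dotZr !(dotlE, dotrE) p1 u1 sC -/s conjCK -[RHS]cN; ring.
(* [p], [g] and [u], [h] are orthonormal bases of the same plane. *)
have proj2 x : '[x, p] *: p + '[x, g] *: g = '[x, u] *: u + '[x, h] *: h.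
  apply: (@dot_inj _ _ dot) => z; rewrite /g /h !(dotlE, dotrE) conjCK.
  have N0 : 1 - s * s^* != 0.
    by apply/eqP => N0; move: cN; rewrite N0 mulr0 => /esym/eqP; rewrite oner_eq0.
  (* The normalization eliminates [c^*], which leaves a rational identity for [field]. *)
  have cE : c^* = (c * (1 - s * s^*))^-1.
    apply: (mulIf (x := c * (1 - s * s^*))); first by rewrite mulf_neq0.
    by rewrite mulVf ?mulf_neq0 // -[RHS]cN; ring.
  by rewrite cE; field; rewrite cn0 N0.
have Ag : A g = a i *: g by rewrite /g (vertexZ VA) (vertexB VA) (vertexZ VA) Au Ap; vec dot.
have Ah : A h = a i *: h by rewrite /h (vertexZ VA) (vertexB VA) (vertexZ VA) Au Ap; vec dot.
have gp : '[g, p] = 0 by rewrite /g !dotlE p1 -/s; ring.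
have hu : '[h, u] = 0 by rewrite /h !dotlE u1 sC; ring.
have li : l != i by rewrite eq_sym.
have key y : A y = a l *: y -> '[y, y] = 1 -> '[y, v] = 0 ->
    swap D (swap_op D i l g y) i g l y /\ swap B (swap_op D i l g y) i h l y.
  move=> Ay y1 yv; split.
    apply: swap_swap_op => //; first exact: (swap_eig_i VA AD Ag gp).
    exact: (swap_eig_i VA (swap_flip AD) Ay yv).
  split => //; [exact: (swap_eig_i VA AB Ah hu)|exact: (swap_eig_i VA (swap_flip AB) Ay yv)|].
  move=> x; rewrite /swap_op (swapE AB) (swapE AD).
  have -> : '[x, g] *: g = ('[x, u] *: u + '[x, h] *: h) - '[x, p] *: p.
    by rewrite -proj2 addrC addKr.
  by vec dot.
have [D1 B1] := key t At t1 tv; have [D2 B2] := key t' At' t1' tv'.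
have Wv y : '[y, v] = 0 -> swap D (swap_op D i l g y) i g l y -> swap_op D i l g y <> A.
  move=> yv Dy e; rewrite e in Dy.
  have gv : '[v, g] = 0 by exact: (eig_orth VA li Av Ag).
  have := swap_orth Dy (swap_Bq VA AD) gv (dotC0 yv) => Av'.
  exact: (eig_contra VA il v1 Av' Av).
exists (swap_op D i l g t), (swap_op D i l g t'); split.
- move=> e; rewrite e in D1; have [_] := swap_uniq_same VD D1 D2.
  exact: (npar_orth t1 t1' tt).
- exact: Wv.
- exact: Wv.
- by split; apply: adj_sym; [exact: (swap_adj VB B1)|exact: (swap_adj VD D1)].
- by split; apply: adj_sym; [exact: (swap_adj VB B2)|exact: (swap_adj VD D2)].
Qed.

(* Comparing [w] with [D] and [A'] colour by colour leaves two possibilities. *)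
Lemma common_nbr A A' D (w : H -> H) i p l q u m v : V A -> swap A D i p l q -> swap A A' i u m v ->
  l != m -> ~ par p u -> adj w A' -> adj w D -> w <> A ->
  '[p, u] = 0 /\ ('[p, u] = 0 -> w = swap_op A' i l p q).
Proof.
move=> VA AD AA' lm pu wA' wD wA; have VD := swap_V VA AD; have VA' := swap_V VA AA'.
have [Vw _ _ _] := wA'.
have [c1 [r [c2 [s Dw]]]] := adj_swap (adj_sym wD).
have [c1' [r' [c2' [s' Aw]]]] := adj_swap (adj_sym wA').
(* [T] and [T'] are the pairs of colours that change from [D] to [w] and from [A'] to [w]. The facts
   below bound what can stay unchanged, until two distributions of [i], [l], [m] survive. *)
pose T n := (n == c1) || (n == c2); pose T' n := (n == c1') || (n == c2').
have eqD n x : ~~ T n -> D x = a n *: x <-> w x = a n *: x.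
  by rewrite negb_or => /andP[] /(swap_other x VD Dw) h /h.
have eqA n x : ~~ T' n -> A' x = a n *: x <-> w x = a n *: x.
  by rewrite negb_or => /andP[] /(swap_other x VA' Aw) h /h.
have [il im] := (swap_ne AD, swap_ne AA').
have [li mi ml] : [/\ l != i, m != i & m != l] by split; rewrite eq_sym.
have [p1 q1 u1 v1] := And4 (swap_p1 AD) (swap_q1 AD) (swap_p1 AA') (swap_q1 AA').
have [Ap Aq Au Av] := And4 (swap_p AD) (swap_q AD) (swap_p AA') (swap_q AA').
have X n x : n != i -> n != l -> A x = a n *: x <-> D x = a n *: x.
  exact: (swap_other x VA AD).
have X' n x : n != i -> n != m -> A x = a n *: x <-> A' x = a n *: x.
  exact: (swap_other x VA AA').
have [Dq Dp Dv] := And3 (swap_Bq VA AD) (swap_Bp VA AD) ((X m v mi ml).1 Av).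
have [A'v A'u A'q] := And3 (swap_Bq VA AA') (swap_Bp VA AA') ((X' l q li lm).1 Aq).
pose u' := u - '[u, p] *: p; pose p' := p - '[p, u] *: u.
have Au' : A u' = a i *: u' by rewrite /u' (vertexB VA) (vertexZ VA) Au Ap; vec dot.
have Ap' : A p' = a i *: p' by rewrite /p' (vertexB VA) (vertexZ VA) Au Ap; vec dot.
have u'p : '[u', p] = 0 by exact: gram_dot.
have p'u : '[p', u] = 0 by exact: gram_dot.
have Du' := swap_eig_i VA AD Au' u'p; have A'p' := swap_eig_i VA AA' Ap' p'u.
have u'n0 : '[u', u] <> 0.
  move=> e; apply: pu; apply/(parP u p1); apply: (@dot_eq0P _ _ dot).
  by rewrite -/u' {2}/u' dotBr dotZr e u'p mulr0 subrr.
have p'n0 : '[p', p] <> 0.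
  move=> e; apply: pu; apply: (par_sym p1); apply/(parP p u1); apply: (@dot_eq0P _ _ dot).
  by rewrite -/p' {2}/p' dotBr dotZr e p'u mulr0 subrr.
have Ti0 : T i -> T l -> T m -> False.
  rewrite /T => /orP[] /eqP <- /orP[] /eqP e /orP[] /eqP e';
    by move: il im lm; rewrite ?e ?e' ?eqxx.
have Ti0' : T' i -> T' l -> T' m -> False.
  rewrite /T' => /orP[] /eqP <- /orP[] /eqP e /orP[] /eqP e';
    by move: il im lm; rewrite ?e ?e' ?eqxx.
have Tout n (b1 b2 : 'I_k) : T b1 -> T b2 -> b1 != b2 -> n != b1 -> n != b2 -> ~~ T n.
  rewrite /T => /orP[] /eqP -> /orP[] /eqP -> bb nb1 nb2; rewrite ?eqxx // in bb *;
  by rewrite negb_or ?nb1 ?nb2.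
have Hl : ~~ T l -> ~~ T' l -> False.
  move=> /eqD h /eqA h'; have A'p : A' p = a l *: p by apply/h'/h.
  exact: eig_contra VA il p1 Ap ((X' l p li lm).2 A'p).
have Hm : ~~ T m -> ~~ T' m -> False.
  move=> /eqD h /eqA h'; have D'u : D u = a m *: u by apply/h/h'.
  exact: eig_contra VA im u1 Au ((X m u mi ml).2 D'u).
have Hi : ~~ T i -> ~~ T' i -> False.
  move=> /eqD h /eqA h'; have A'i : A' q = a i *: q by apply/h'/h.
  exact: (eig_contra VA' il q1 A'i A'q).
have Hmi : ~~ T m -> ~~ T' i -> False.
  move=> /eqD h /eqA h'; have w1 : w v = a m *: v by apply/h.
  have w2 : w v = a i *: v by apply/h'.
  exact: (eig_contra Vw mi v1 w1 w2).
have Hli : ~~ T l -> ~~ T' i -> False.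
  move=> /eqD h /eqA h'; have w1 : w p = a l *: p by apply/h.
  have w2 : w p' = a i *: p' by apply/h'.
  by apply: p'n0; exact: (eig_orth Vw il w2 w1).
have Him : ~~ T i -> ~~ T' m -> False.
  move=> /eqD h /eqA h'; have w1 : w u' = a i *: u' by apply/h.
  have w2 : w u = a m *: u by apply/h'.
  by apply: u'n0; exact: (eig_orth Vw im w1 w2).
have Hil : ~~ T i -> ~~ T' l -> False.
  move=> /eqD h /eqA h'; have w1 : w q = a i *: q by apply/h.
  have w2 : w q = a l *: q by apply/h'.
  exact: (eig_contra Vw il q1 w1 w2).
have Ti : T i.
  apply: contraT => Ti; apply: contrapT => _.
  have T'i : T' i by apply: contraT => /(Hi Ti).
  have T'l : T' l by apply: contraT => /(Hil Ti).
  have T'm : T' m by apply: contraT => /(Him Ti).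
  exact: Ti0'.
have T'i : T' i.
  apply: contraT => T'i; exfalso; apply: (Ti0 Ti); apply: contraT => h; exfalso.
    exact: (Hli h T'i).
  exact: (Hmi h T'i).
(* Changing [i], [m] from [D] and [i], [l] from [A'] closes the commuting square; the opposite
   distribution leads back to [A]. *)
have [Tm|Tm] := boolP (T m).
  have Tl : ~~ T l by apply/negP => Tl; exact: (Ti0 Ti Tl Tm).
  have T'l : T' l by apply: contraT => /(Hl Tl).
  have T'm : ~~ T' m by apply/negP => T'm; exact: (Ti0' T'i T'l T'm).
  have wp : w p = a l *: p by apply/(eqD l).
  have wu : w u = a m *: u by apply/(eqA m).
  have pu0 : '[p, u] = 0 by exact: (eig_orth Vw lm wp wu).
  split => // _.
  have [DA DD] := swap_commute VA AD AA' pu0 (eig_orth VA im Ap Av)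
     (eig_orth VA li Aq Au) (eig_orth VA lm Aq Av).
  apply: (@vertex_eq_but_one _ _ i) => //; first exact: (swap_V VA' DA).
  move=> n ni x; apply: iff_sym.
  have [->|nm] := eqVneq n m.
    by rewrite -(swap_other x VA' DA mi ml) -eqA.
  by rewrite -(swap_other x VD DD ni nm) -eqD // (Tout n i m).
have T'm : T' m by apply: contraT => /(Hm Tm).
have T'l : ~~ T' l by apply/negP => T'l; exact: (Ti0' T'i T'l T'm).
have Tl : T l by apply: contraT => /Hl /(_ T'l).
exfalso; apply: wA; apply: (@vertex_eq_but_one _ _ i) => // n ni x.
have [->|nl] := eqVneq n l; first by rewrite (X' l x li lm) -eqA.
by rewrite (X n x ni nl) -eqD // (Tout n i l).
Qed.

(* Two graph-theoretic conditions forcing the pencils at [A] and [A'] to have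
   the same label. They hold when [A'] swaps a line of colour [i] orthogonal to
   [p] with a line of colour [l] ([step1_move]), respectively with a line of
   another colour ([step2_move]). *)
Definition step1 A B C0 A' B' C0' := [/\ adj A A', ~ pencil A B C0 A',
  ~ pencil A' B' C0' A & exists2 D, pencil A B C0 D & pencil A' B' C0' D].

Definition step2 A B C0 A' B' C0' := adj A A' /\
  forall D, pencil A B C0 D -> exists D', [/\ pencil A' B' C0' D', D' <> A,
    adj D' A', adj D' D & forall w : H -> H, adj w A' -> adj w D -> w = A \/ w = D'].

Definition same_label (i : 'I_k) p (l i' : 'I_k) p' (l' : 'I_k) := [/\ i = i', l = l' & par p p'].

(** A common member [D] of the pencils is adjacent to [A] and [A'], so by [nbr_adj] [A'] swaps
    another line with the same [v]. Of the two readings of the swap from [A'] to [D], one would put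
    [A] into the pencil at [A']; the other is the desired label. *)
Lemma step1_same A B C0 A' B' C0' i p l i' p' l' :
  labelled A B C0 i p l -> labelled A' B' C0' i' p' l' -> step1 A B C0 A' B' C0' ->
  same_label i p l i' p' l'.
Proof.
move=> L L' [AA' nA nA' [D /(pencilP _ L) [v AD] /(pencilP _ L') [v' A'D]]].
have [VA _ _] := L; have [VA' _ _] := L'.
have p1 := swap_p1 AD; have p1' := swap_p1 A'D.
case: (nbr_adj VA AD AA') => [|[s As _]|[u Au pu]].
- by apply: adj_sym; exact: (swap_adj VA' A'D).
- by case: nA; apply/(pencilP _ L); exists s.
have A'D' := swap_change_p VA Au AD (dotC0 pu).
case: (swap_uniq VA' A'D A'D') => [[il li pu' _]|[ii ll pp _]]; last first.
  by split => //; exact: (par_sym p1 pp).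
case: nA'; apply/(pencilP _ L'); subst i' l'; exists v.
apply: (swap_par VA' (swap_flip (swap_back VA Au)) p1' (swap_q1 AD) _ (par_refl _)).
exact: (par_sym (swap_p1 Au) pu').
Qed.

Lemma step1_move A B C0 A' B' C0' i p l u v :
  labelled A B C0 i p l -> labelled A' B' C0' i p l -> swap A A' i u l v -> '[p, u] = 0 ->
  step1 A B C0 A' B' C0'.
Proof.
move=> L L' AA' pu; have [VA _ [q [r [AB _ _]]]] := L; have [VA' _ _] := L'.
have p1 := swap_p1 AB.
split; first exact: (swap_adj VA AA').
- move=> /(pencilP _ L) [s AA's]; have [pu' _] := swap_uniq_same VA AA's AA'.
  exact: (npar_orth p1 (swap_p1 AA') pu pu').
- move=> /(pencilP _ L') [s A'A]; have [pv _] := swap_uniq_same VA' A'A (swap_back VA AA').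
  apply: (npar_orth p1 (swap_q1 AA') _ pv).
  exact: (eig_orth VA (swap_ne AB) (swap_p AB) (swap_q AA')).
have AD : swap A (swap_op A i l p v) i p l v.
  exact: (swap_swap_op (swap_ne AB) p1 (swap_q1 AA') (swap_p AB) (swap_q AA')).
exists (swap_op A i l p v); first by apply/(pencilP _ L); exists v.
apply/(pencilP _ L'); exists u.
exact: (swap_flip (swap_change_p VA AA' AD (dotC0 pu))).
Qed.

(** When the swap to [A'] interferes with the pencil, some member has too many or too few common
    neighbours with [A']. Otherwise the swaps commute, the fourth corner of the square must be the
    prescribed [D'], and its place in the pencil at [A'] reveals the label. *)
Lemma step2_same A B C0 A' B' C0' i p l i' p' l' :
  labelled A B C0 i p l -> labelled A' B' C0' i' p' l' -> step2 A B C0 A' B' C0' ->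
  same_label i p l i' p' l'.
Proof.
move=> L L' [AA' h]; have [VA dl [q [r [AB AC qr]]]] := L.
have [VA' _ _] := L'.
have [p1 q1 r1] := And3 (swap_p1 AB) (swap_q1 AB) (swap_q1 AC).
have [il Ap] := (swap_ne AB, swap_p AB).
have p1' : '[p', p'] = 1 by case: L' => _ _ [? [? [/swap_p1]]].
have no_two D : (exists s, swap A D i p l s) -> ~ exists w1 w2 : H -> H,
    [/\ w1 <> w2, w1 <> A, w2 <> A, adj w1 A' /\ adj w1 D & adj w2 A' /\ adj w2 D].
  move=> /(pencilP _ L) /h [D' [_ _ _ _ hD']] [w1 [w2 [w12 w1A w2A [a1 b1] [a2 b2]]]].
  case: (hD' w1 a1 b1) => // e1; case: (hD' w2 a2 b2) => // e2.
  by apply: w12; rewrite e1 e2.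
have main i1 u l1 v : swap A A' i1 u l1 v -> '[p, u] = 0 -> '[p, v] = 0 ->
    (forall s, A s = a l *: s -> '[s, u] = 0 /\ '[s, v] = 0) -> same_label i p l i' p' l'.
  move=> Auv pu pv suv.
  have key D s : swap A D i p l s -> same_label i p l i' p' l' \/ par s p'.
    move=> AD; have [su sv] := suv s (swap_q AD).
    have [A'E DE] := swap_commute VA AD Auv pu pv su sv.
    have [|D' [/(pencilP _ L') [s' A'D'] _ _ _ hD']] := h D.
      by apply/(pencilP _ L); exists s.
    have [e|e] := hD' (swap_op A' i l p s) (adj_sym (swap_adj VA' A'E))
      (adj_sym (swap_adj (swap_V VA AD) DE)).
      exfalso; have := swap_Bp VA' A'E; rewrite e => Ap'.
      exact: (eig_contra VA il p1 Ap Ap').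
    rewrite -e in A'D'; case: (swap_uniq VA' A'E A'D') => [[? ? ? _]|[? ? _ ?]]; first by left.
    by right.
  (* The reversed reading for both [B] and [C0] would make [p'] parallel to the orthogonal lines [q]
     and [r]. *)
  case: (key _ _ AB) => // -[c qp']; case: (key _ _ AC) => // -[c' rp'].
  exfalso; apply: (unit_neq0 p1'); apply: (@dot_eq0P _ _ dot).
  by rewrite {1}qp' rp' dotZl dotZr qr !mulr0.
have caseA u v : ~ swap A A' i u l v.
  move=> Auv; have v1 := swap_q1 Auv.
  have AD : swap A (swap_op A i l p v) i p l v by apply: swap_swap_op => //; exact: (swap_q Auv).
  apply: (no_two (swap_op A i l p v)); first by exists v.
  exact: (shared_line VA dl Auv AD).
have caseB m u v : m != l -> swap A A' i u m v -> same_label i p l i' p' l'.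
  move=> ml Auv; have lm : l != m by rewrite eq_sym.
  have [pu|pu] := pselect (par p u).
    exfalso; apply: (no_two B); first by exists q.
    have Apv := swap_par VA Auv p1 (swap_q1 Auv) (par_sym (swap_p1 Auv) pu) (par_refl _).
    have [w1 [w2 [w12 w1A w2A [b1 c1] [b2 c2]]]] := three_cycles VA AB Apv lm.
    by exists w1, w2.
  have [pu0|pu0] := pselect ('[p, u] = 0).
    apply: (main _ _ _ _ Auv pu0); first exact: (eig_orth VA (swap_ne Auv) Ap (swap_q Auv)).
    move=> s As; split; last exact: (eig_orth VA lm As (swap_q Auv)).
    by apply: (eig_orth VA _ As (swap_p Auv)); rewrite eq_sym.
  have [|D' [_ D'A aD'A' aD'B _]] := h B; first by apply/(pencilP _ L); exists q.
  by have [/pu0] := common_nbr VA AB Auv lm pu aD'A' aD'B D'A.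
have caseC m u v : m != i -> swap A A' l u m v -> same_label i p l i' p' l'.
  move=> mi Auv; exfalso; have im : i != m by rewrite eq_sym.
  have AD : swap A (swap_op A i l p u) i p l u.
    by apply: swap_swap_op; rewrite ?(swap_p1 Auv) ?(swap_p Auv).
  apply: (no_two (swap_op A i l p u)); first by exists u.
  have [w1 [w2 [w12 w1A w2A [b1 c1] [b2 c2]]]] := three_cycles VA (swap_flip AD) Auv im.
  by exists w1, w2.
have [i1 [u [l1 [v Auv]]]] := adj_swap AA'.
have [e|ni] := eqVneq i1 i.
  subst i1; have [e|nl] := eqVneq l1 l; last exact: (caseB _ _ _ nl Auv).
  by subst l1; case: (caseA _ _ Auv).
have [e|nl] := eqVneq i1 l.
  subst i1; have [e|ni'] := eqVneq l1 i; last exact: (caseC _ _ _ ni' Auv).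
  by subst l1; case: (caseA _ _ (swap_flip Auv)).
have [e|ni'] := eqVneq l1 i; first by subst l1; apply: (caseB _ _ _ nl (swap_flip Auv)).
have [e|nl'] := eqVneq l1 l; first by subst l1; apply: (caseC _ _ _ ni (swap_flip Auv)).
apply: (main _ _ _ _ Auv).
- by apply: (eig_orth VA _ Ap (swap_p Auv)); rewrite eq_sym.
- by apply: (eig_orth VA _ Ap (swap_q Auv)); rewrite eq_sym.
move=> s As; split; first by apply: (eig_orth VA _ As (swap_p Auv)); rewrite eq_sym.
by apply: (eig_orth VA _ As (swap_q Auv)); rewrite eq_sym.
Qed.

Lemma step2_move A B C0 A' B' C0' i p l u m v :
  labelled A B C0 i p l -> labelled A' B' C0' i p l -> m != l -> swap A A' i u m v ->
  '[p, u] = 0 -> step2 A B C0 A' B' C0'.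
Proof.
move=> L L' ml AA' pu; have [VA _ [q [r [AB _ _]]]] := L; have [VA' _ _] := L'.
have lm : l != m by rewrite eq_sym.
split; first exact: (swap_adj VA AA').
move=> D /(pencilP _ L) [s AD]; exists (swap_op A' i l p s).
have [p1 u1] := (swap_p1 AD, swap_p1 AA').
have li : l != i by rewrite eq_sym (swap_ne AD).
have [A'E DE] := swap_commute VA AD AA' pu (eig_orth VA (swap_ne AA') (swap_p AD) (swap_q AA'))
  (eig_orth VA li (swap_q AD) (swap_p AA')) (eig_orth VA lm (swap_q AD) (swap_q AA')).
split.
- by apply/(pencilP _ L'); exists s.
- move=> e; have := swap_Bp VA' A'E; rewrite e => Ap'.
  exact: (eig_contra VA (swap_ne AD) p1 (swap_p AD) Ap').
- exact: (adj_sym (swap_adj VA' A'E)).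
- exact: (adj_sym (swap_adj (swap_V VA AD) DE)).
move=> w wA' wD; have [e|e] := pselect (w = A); [by left|right].
have [_] := common_nbr VA AD AA' lm (npar_orth p1 u1 pu) wA' wD e.
exact.
Qed.

(** * Connectedness of the vertices through a coloured line *)

Lemma hreflectD w x y : hreflect w (x + y) = hreflect w x + hreflect w y.
Proof. by rewrite /hreflect dotDl; vec dot. Qed.
Lemma hreflectZ w c x : hreflect w (c *: x) = c *: hreflect w x.
Proof. by rewrite /hreflect dotZl; vec dot. Qed.
Lemma hreflect_orth w x : '[x, w] = 0 -> hreflect w x = x.
Proof. by move=> xw; rewrite /hreflect xw mulr0 scale0r subr0. Qed.

Lemma vertex_through A c u y : V A -> A u = a c *: u -> '[u, u] = 1 -> '[y, y] = 1 ->
  exists B, [/\ V B, B y = a c *: y & forall e n, A e = a n *: e ->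
    '[e, u] = 0 -> '[e, y] = 0 -> B e = a n *: e].
Proof.
move=> VA Au u1 y1.
(* The phase [th] makes the inner product of [u] and [th *: y] real, as a reflection exchanging them
   requires. *)
have [th thC thE] : exists2 th, th * th^* = 1 & '[u, th *: y] = '[th *: y, u].
  have [s0|s0] := eqVneq '[u, y] 0.
    exists 1; first by rewrite rmorph1 mulr1.
    by rewrite scale1r s0 (dotC0 s0).
  have n0 : `|'[u, y]| != 0 by rewrite normr_eq0.
  exists ('[u, y] / `|'[u, y]|).
    rewrite rmorphM fmorphV /= conj_normC mulrACA -normCK -invfM -expr2 divff //.
    by rewrite expf_neq0.
  rewrite dotZr dotZl rmorphM fmorphV /= conj_normC -(dotC dot y u).
  ring.
set y' := th *: y in thE; have y1' : '[y', y'] = 1.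
  by rewrite /y' dotZl dotZr y1 mulr1.
have th0 : th != 0 by apply/eqP => e; move: thC; rewrite e mul0r => /esym/eqP; rewrite oner_eq0.
suff [B [VB By' Be]] : exists B, [/\ V B, B y' = a c *: y' & forall e n, A e = a n *: e ->
    '[e, u] = 0 -> '[e, y'] = 0 -> B e = a n *: e].
  exists B; split => // [|e n Ae eu ey]; last by apply: Be => //; rewrite dotZr ey mulr0.
  apply: (scalerI th0); rewrite -(vertexZ VB) By' !scalerA; congr (_ *: _); ring.
clearbody y'; have [uy|uy] := pselect (u = y'); first by exists A; rewrite -uy.
have uy0 : u - y' <> 0 by move=> /eqP; rewrite subr_eq0 => /eqP.
have [ka ka0 kaE] := normalize dot uy0; set w := _ *: _ in kaE.
have kk : ka * ka^* * (2 * (1 - '[u, y'])) = 1.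
  by rewrite -[RHS]kaE /w dotZl dotZr !(dotlE, dotrE) u1 y1' -thE; ring.
have Tu : hreflect w u = y'.
  rewrite /hreflect scalerA /w dotZr dotBr u1.
  have -> : 2 * (ka^* * (1 - '[u, y'])) * ka = 1 by rewrite -[RHS]kk; ring.
  by rewrite scale1r subKr.
have Ty : hreflect w y' = u.
  rewrite /hreflect scalerA /w dotZr dotBr y1' -thE.
  have -> : 2 * (ka^* * ('[u, y'] - 1)) * ka = -1 by rewrite -[in RHS]kk; ring.
  by rewrite scaleN1r opprK addrC subrK.
exists (hreflect w \o A \o hreflect w); split.
- exact: (oc_reflect ocV).
- by rewrite /= Ty Au hreflectZ Tu.
move=> e n Ae eu ey /=.
have Te : hreflect w e = e.
  by apply: hreflect_orth; rewrite /w dotZr dotBr eu ey subrr mulr0.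
by rewrite Te Ae hreflectZ Te.
Qed.

(** If [p] has colour [i], the other line [v] of such a swap is orthogonal to [p] by its colour, so
    [p] keeps colour [i] along the path. *)
Inductive reach (i : 'I_k) (p : H) : (H -> H) -> (H -> H) -> Prop :=
| Reach0 A : reach i p A A
| ReachS A A' A'' u m v : swap A A' i u m v -> '[p, u] = 0 -> reach i p A' A'' ->
    reach i p A A''.

Lemma reach1 i p A A' u m v : swap A A' i u m v -> '[p, u] = 0 -> reach i p A A'.
Proof. by move=> h pu; apply: ReachS h pu _; apply: Reach0. Qed.

Lemma reach_trans i p A A' A'' : reach i p A A' -> reach i p A' A'' -> reach i p A A''.
Proof. by move=> h; elim: h A'' => // {A A'} A A' A'' u m v s pu _ IH B /IH; exact: ReachS s pu. Qed.

Lemma reach_V i p A A' : V A -> A p = a i *: p -> reach i p A A' ->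
  V A' /\ A' p = a i *: p.
Proof.
move=> VA Ap h; elim: h VA Ap => // {A A'} A A' A'' u m v s pu _ IH VA Ap.
apply: IH; first exact: (swap_V VA s).
by apply: (swap_orth s Ap pu); exact: (eig_orth VA (swap_ne s) Ap (swap_q s)).
Qed.

(** In the plane of [u], of colour [c], and a line of colour [b], the unit vector [u'] takes over
    colour [c] and its complement in the plane gets colour [b]. *)
Definition rotate_op A c b u u' x := A x + (a b - a c) *: ('[x, u] *: u - '[x, u'] *: u').

Lemma proj_rotate u v al be : '[u, u] = 1 -> '[v, v] = 1 -> '[u, v] = 0 ->
  '[al *: u + be *: v, al *: u + be *: v] = 1 ->
  let u' := al *: u + be *: v in let v' := (- be^*) *: u + al^* *: v in
  '[v', v'] = 1 /\ forall x, '[x, u'] *: u' + '[x, v'] *: v' = '[x, u] *: u + '[x, v] *: v.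
Proof.
move=> u1 v1 uv; have vu := dotC0 uv.
rewrite !(dotlE, dotrE) u1 v1 uv vu => N.
have {}N : al * al^* + be * be^* = 1 by rewrite -[RHS]N; ring.
split; first by rewrite !(dotlE, dotrE) u1 v1 uv vu rmorphN /= !conjCK -[RHS]N; ring.
move=> x; apply: (@dot_inj _ _ dot) => z; rewrite !(dotlE, dotrE) rmorphN /= !conjCK.
transitivity ((al * al^* + be * be^*) * ('[x, u] * '[u, z] + '[x, v] * '[v, z])).
  by ring.
by rewrite N mul1r.
Qed.

Hypothesis d_gt1 : forall i, dim_gt 1 (d i).

Lemma orth_one A c x : V A -> exists t, [/\ A t = a c *: t, '[t, t] = 1 & '[t, x] = 0].
Proof.
move=> VA; have [t [At t1 tx]] := orth_in (s := [:: x]) VA (d_gt1 c).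
by exists t; split => //; apply: tx; rewrite inE.
Qed.

Section Rotation.
Variables (A : H -> H) (i : 'I_k) (p : H).
Hypotheses (VA : V A) (Ap : A p = a i *: p).

(** Exchanging [u] for some [t] of colour [m] orthogonal to [v] puts the plane of [u] and [v] into
    colour [m]; then [t] is exchanged for [u']. *)
Lemma reach_rotate_i m u v al be : m != i -> A u = a i *: u -> '[u, u] = 1 -> '[p, u] = 0 ->
  A v = a m *: v -> '[al *: u + be *: v, al *: u + be *: v] = 1 ->
  reach i p A (rotate_op A i m u (al *: u + be *: v)).
Proof.
move=> mi Au u1 pu Av u1'; set u' := _ + _ in u1' *.
have im : i != m by rewrite eq_sym.
have [t [At t1 tv]] := orth_one m v VA.
have S1 : swap A (swap_op A i m u t) i u m t by exact: swap_swap_op.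
have V1 := swap_V VA S1.
have Av1 : swap_op A i m u t v = a m *: v.
  by apply: (swap_orth S1 Av); [exact: (eig_orth VA mi Av Au)|exact: dotC0].
have Au1 : swap_op A i m u t u' = a m *: u'.
  by rewrite /u' (vertexD V1) !(vertexZ V1) Av1 (swap_Bp VA S1); vec dot.
have S2 : swap (swap_op A i m u t) (rotate_op A i m u u') i t m u'.
  split; rewrite ?t1 ?u1' ?(swap_Bq VA S1) // => x.
  by rewrite /rotate_op /swap_op; vec dot.
by apply: (ReachS S1 pu); apply: (reach1 S2); exact: (eig_orth VA im Ap At).
Qed.

Lemma rotate_op_flip c b u v al be : c != b -> A u = a c *: u -> '[u, u] = 1 ->
  A v = a b *: v -> '[v, v] = 1 -> '[al *: u + be *: v, al *: u + be *: v] = 1 ->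
  let v' := (- be^*) *: u + al^* *: v in
  '[v', v'] = 1 /\ rotate_op A c b u (al *: u + be *: v) = rotate_op A b c v v'.
Proof.
move=> cb Au u1 Av v1 u1' v'; have uv := eig_orth VA cb Au Av.
have [v1' E] := proj_rotate u1 v1 uv u1'; split => //.
apply/funext => x; rewrite /rotate_op -/v'; have := E x; rewrite -/v' => {}E.
have -> : '[x, v] *: v = '[x, al *: u + be *: v] *: (al *: u + be *: v) + '[x, v'] *: v' - '[x, u] *: u.
  by rewrite E addrC addKr.
by vec dot.
Qed.

End Rotation.

(** If neither colour is [i], [v] is parked in colour [i] in exchange for a line [t] orthogonal to
    [p], rotated there against [u], and the complement [v'] is exchanged back for [t]. *)
Lemma reach_rotate A i p c b u v al be : V A -> A p = a i *: p -> c != b ->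
  A u = a c *: u -> '[u, u] = 1 -> '[p, u] = 0 ->
  A v = a b *: v -> '[v, v] = 1 -> '[p, v] = 0 ->
  '[al *: u + be *: v, al *: u + be *: v] = 1 ->
  reach i p A (rotate_op A c b u (al *: u + be *: v)).
Proof.
move=> VA Ap cb Au u1 pu Av v1 pv u1'.
have [e|ci] := eqVneq c i.
  by subst c; apply: reach_rotate_i => //; rewrite eq_sym.
have conv B c' u2 v2 al' be' : V B -> B p = a i *: p -> c' != i ->
    B u2 = a c' *: u2 -> '[u2, u2] = 1 -> B v2 = a i *: v2 -> '[v2, v2] = 1 ->
    '[p, v2] = 0 -> '[al' *: u2 + be' *: v2, al' *: u2 + be' *: v2] = 1 ->
    reach i p B (rotate_op B c' i u2 (al' *: u2 + be' *: v2)).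
  move=> VB Bp ci' Bu2 u21 Bv2 v21 pv2 u21'.
  have [v21' ->] := rotate_op_flip VB ci' Bu2 u21 Bv2 v21 u21'.
  by rewrite addrC; apply: reach_rotate_i => //; rewrite addrC.
have [e|bi] := eqVneq b i; first by subst b; exact: conv.
have [t [At t1 tp]] := orth_one i p VA; have pt := dotC0 tp.
have ib : i != b by rewrite eq_sym.
have S1 : swap A (swap_op A i b t v) i t b v by exact: swap_swap_op.
have V1 := swap_V VA S1; set A1 := swap_op A i b t v in S1 V1.
have A1p : A1 p = a i *: p by apply: (swap_orth S1 Ap).
have ut := eig_orth VA ci Au At; have uv := eig_orth VA cb Au Av.
have vt := eig_orth VA bi Av At.
have A1u : A1 u = a c *: u by apply: (swap_orth S1 Au).
have A1v := swap_Bq VA S1; have A1t := swap_Bp VA S1; rewrite -/A1 in A1v A1t.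
have R2 := conv A1 c u v al be V1 A1p ci A1u u1 A1v v1 pv u1'.
set u' := al *: u + be *: v in u1' R2 *.
have [v1' E] := proj_rotate u1 v1 uv u1'; set v' := - be^* *: u + al^* *: v in v1' E.
rewrite -/u' in E.
set A2 := rotate_op A1 c i u u' in R2; have [V2 A2p] := reach_V V1 A1p R2.
have S3 : swap A2 (rotate_op A c b u u') i v' b t.
  split => //.
  - rewrite /A2 /rotate_op /v' (vertexD V1) !(vertexZ V1) A1u A1v !dotlE !dotrE u1 v1.
    rewrite uv (dotC0 uv) /u'; vec dot.
  - rewrite /A2 /rotate_op A1t /u' dotDr !dotZr (dotC0 ut) (dotC0 vt).
    by rewrite !mulr0 addr0 !scale0r subr0 scaler0 addr0.
  move=> x; rewrite /A2 /rotate_op (swapE S1).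
  have -> : '[x, v'] *: v' = '[x, u] *: u + '[x, v] *: v - '[x, u'] *: u'.
    by rewrite -(E x) addrC addKr.
  by vec dot.
apply: (ReachS S1 pt); apply: (reach_trans R2); apply: (reach1 S3).
by rewrite /v' dotDr !dotZr pu pv !mulr0 addr0.
Qed.

Lemma eigcomp_decomp A (w : 'I_k -> H) x : V A -> x = \sum_i w i ->
  (forall i, A (w i) = a i *: w i) -> forall i, eigcomp A i x = w i.
Proof.
move=> VA xE Aw i; apply: eigcomp_uniq => // z Az.
rewrite xE (bigD1 i) //= addrAC subrr add0r dot_suml big1 // => j ji.
exact: (eig_orth VA ji (Aw j) Az).
Qed.

(* Rotating, colour by colour, the component of [y] of colour [b != c] into
   colour [c] makes [y] an eigenvector of colour [c]. *)
Lemma reach_absorb A i p c y u0 : V A -> A p = a i *: p ->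
  '[y, y] = 1 -> '[p, y] = 0 -> A u0 = a c *: u0 -> '[u0, u0] = 1 -> '[p, u0] = 0 ->
  exists A', [/\ reach i p A A', A' y = a c *: y & forall e n, A e = a n *: e ->
    '[e, y] = 0 -> '[e, u0] = 0 -> A' e = a n *: e].
Proof.
move=> + + y1 py; pose supp B := [set b | (b != c) && (eigcomp B b y != 0)]%SET.
have [N leN] := ubnP #|supp A|; elim: N A u0 leN => // N IH A u0 leN VA Ap Au0 u01 pu0.
have [s0|[b]] := set_0Vmem (supp A).
  exists A; split => //; first exact: Reach0.
  rewrite -{1 2}(eigcomp_sum y VA) (bigD1 c) //= big1 ?addr0 ?(eigcompE c y VA) // => n nc.
  apply/eqP/negPn/negP => h; have : n \in supp A by rewrite inE nc h.
  by rewrite s0 inE.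
move=> bs; have := bs; rewrite inE => /andP[bc /eqP z0]; set z := eigcomp A b y in z0.
have cb : c != b by rewrite eq_sym.
have [ka ka0 v1] := normalize dot z0; set v := ka *: z in v1.
have Az : A z = a b *: z by exact: eigcompE.
have Av : A v = a b *: v by rewrite /v (vertexZ VA) Az !scalerA mulrC.
pose x := eigcomp A c y; have Ax : A x = a c *: x by exact: eigcompE.
have pz : '[p, z] = 0 by apply: dotC0; apply: (eigcomp_dot0 b VA Ap); exact: dotC0.
have px : '[p, x] = 0 by apply: dotC0; apply: (eigcomp_dot0 c VA Ap); exact: dotC0.
have [u [xi [Au u1 pu xE eu]]] : exists u xi, [/\ A u = a c *: u, '[u, u] = 1, '[p, u] = 0,
    x = xi *: u & forall e n, A e = a n *: e -> '[e, y] = 0 -> '[e, u0] = 0 -> '[e, u] = 0].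
  (* [u0] stands in when [y] has no component of colour [c]. *)
  have [x0|x0] := pselect (x = 0).
    by exists u0, 0; split => //; rewrite scale0r.
  have [la la0 u1] := normalize dot x0; exists (la *: x), la^-1; split => //.
  - by rewrite (vertexZ VA) Ax !scalerA mulrC.
  - by rewrite dotZr px mulr0.
  - by rewrite scalerA mulVf // scale1r.
  move=> e n Ae ey _; rewrite dotZr; apply/eqP; rewrite mulf_eq0; apply/orP; right.
  by apply/eqP; apply: dotC0; apply: (eigcomp_dot0 c VA Ae); exact: dotC0.
have ev e n : A e = a n *: e -> '[e, y] = 0 -> '[e, v] = 0.
  move=> Ae ey; rewrite /v dotZr [X in _ * X](_ : _ = 0) ?mulr0 //.
  by apply: dotC0; apply: (eigcomp_dot0 b VA Ae); exact: dotC0.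
have xz := eig_orth VA cb Ax Az.
have g0 : x + z <> 0.
  move=> g0; apply: z0; apply: (@dot_eq0P _ _ dot).
  have : '[z, x + z] = 0 by rewrite g0 dot0r.
  by rewrite dotDr (dotC0 xz) add0r.
have [la la0 u1'] := normalize dot g0.
have uE : la *: (x + z) = (la * xi) *: u + (la / ka) *: v.
  by rewrite scalerDr {1}xE /v !scalerA divfK.
rewrite uE in u1'; have pv : '[p, v] = 0 by rewrite /v dotZr pz mulr0.
have R := reach_rotate VA Ap cb Au u1 pu Av v1 pv u1'.
set u' := (la * xi) *: u + _ in uE u1' R; set A1 := rotate_op _ _ _ _ _ in R.
have [V1 A1p] := reach_V VA Ap R.
have uv := eig_orth VA cb Au Av.
have A1u' : A1 u' = a c *: u'.
  rewrite /A1 /rotate_op u1' {1 2}/u' (vertexD VA) (vertexZ VA) (vertexZ VA) Au Av dotDl dotZl dotZl u1 (dotC0 uv).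
  by rewrite /u'; vec dot.
have A1e e n : A e = a n *: e -> '[e, u] = 0 -> '[e, v] = 0 -> A1 e = a n *: e.
  move=> Ae eu' ev'; rewrite /A1 /rotate_op Ae /u' dotDr dotZr dotZr eu' ev'.
  by rewrite !mulr0 addr0 !scale0r subr0 scaler0 addr0.
have A1g : A1 (x + z) = a c *: (x + z).
  apply: (scalerI la0); rewrite -(vertexZ V1) uE A1u' -uE !scalerA; congr (_ *: _); ring.
(* The components of [y] at [A1]: that of colour [b] has been merged into colour [c], so the support
   shrinks. *)
pose w n := if n == c then x + z else if n == b then 0 else eigcomp A n y.
have Aw n : A1 (w n) = a n *: w n.
  rewrite /w; case: eqVneq => [-> //|nc]; case: eqVneq => [_|nb].
    by rewrite (vertex0 V1) scaler0.
  have An := eigcompE n y VA.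
  by apply: (A1e _ _ An); [exact: (eig_orth VA nc An Au)|exact: (eig_orth VA nb An Av)].
have yE : y = \sum_n w n.
  rewrite -{1}(eigcomp_sum y VA) (bigD1 c) //= (bigD1 b) //= [RHS](bigD1 c) //= [in RHS](bigD1 b) //=.
  rewrite /w !eqxx (negPf bc) add0r -addrA; congr (_ + _); congr (_ + _).
  by apply: eq_bigr => n /andP[/negPf -> /negPf ->].
have cmpw := eigcomp_decomp V1 yE Aw.
have lt1 : (#|supp A1| < N)%N.
  rewrite -ltnS; apply: leq_trans leN; rewrite ltnS; apply: proper_card.
  apply/properP; split; last first.
    by exists b => //; rewrite inE bc /= cmpw /w (negPf bc) eqxx eqxx.
  apply/fintype.subsetP => n; rewrite !inE cmpw /w => /andP[nc].
  by rewrite nc (negPf nc) /=; case: (n == b) => //; rewrite eqxx.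
have pu' : '[p, u'] = 0 by rewrite /u' dotDr dotZr dotZr pu pv !mulr0 addr0.
have [A' [R' A'y A'e]] := IH A1 u' lt1 V1 A1p A1u' u1' pu'.
exists A'; split => //; first exact: (reach_trans R R').
move=> e n Ae ey eu0; have eu' := eu e n Ae ey eu0; have ev' := ev e n Ae ey.
apply: A'e => //; first exact: A1e.
by rewrite /u' dotDr dotZr dotZr eu' ev' !mulr0 addr0.
Qed.

Lemma span_of_full A c (s : seq H) n x : V A -> d c = Some n -> (n <= size s)%N ->
  pairwise_orthogonal dot s ->
  (forall e, e \in s -> A e = a c *: e /\ '[e, e] = 1) -> A x = a c *: x ->
  x = \sum_(e <- s) '[x, e] *: e.
Proof.
move=> VA dc ns os hs Ax; apply/eqP; rewrite -subr_eq0; apply: contraT => nz.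
set x' := _ - _ in nz; have := oc_dim ocV VA c; rewrite dc /= => hc.
have /pairwise_orthogonalP [/= /andP[_ us] ps] := os.
have x's e : e \in s -> '[x', e] = 0.
  move=> es; rewrite /x' dotBl dot_suml (bigD1_seq e) //= dotZl (hs e es).2 mulr1.
  rewrite big_seq_cond big1 ?addr0 ?subrr // => f /andP[fs fe].
  by rewrite dotZl (ps f e fs es fe) mulr0.
have Ax' : A x' = a c *: x'.
  rewrite /x' (vertexB VA) Ax scalerBr; congr (_ - _).
  rewrite (big_morph A (vertexD VA) (vertex0 VA)) scaler_sumr big_seq [RHS]big_seq.
  by apply: eq_bigr => e es; rewrite (vertexZ VA) (hs e es).1 !scalerA mulrC.
have [ka ka0 k1] := normalize dot (elimN eqP nz).
have : (size (ka *: x' :: s) <= n)%N; last by rewrite /= leqNgt ltnS ns.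
apply: (orthogonal_le_basis hc (dot := dot)).
  by apply: orthogonal_cons_unit => // e es; rewrite dotZl x's // mulr0.
move=> e; rewrite inE => /predU1P[->|/hs [] //].
by rewrite /= (vertexZ VA) Ax' !scalerA mulrC.
Qed.

(** [reach_absorb] creates common eigenvectors one at a time and keeps the earlier ones, which are
    orthogonal to [y] and [u0]. Once all colours but [c0] agree, [c0] agrees as their complement. *)
Lemma reach_all A A' i p : V A -> V A' -> '[p, p] = 1 -> A p = a i *: p ->
  A' p = a i *: p -> reach i p A A'.
Proof.
move=> VA VA' p1 Ap A'p.
(* Induction on the part of the dimensions of the finite colours that is not
   yet filled by common eigenvectors [L] of [B] and [A']. *)
pose n c := odflt 0%N (d c).
pose inv B (L : 'I_k -> seq H) := forall c, pairwise_orthogonal dot (L c) /\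
  forall e, e \in L c -> [/\ B e = a c *: e, A' e = a c *: e & '[e, e] = 1].
suff main N B (L : 'I_k -> seq H) : (\sum_(c | c != c0) (n c - size (L c)) < N)%N ->
    V B -> inv B L -> p \in L i -> reach i p B A'.
  pose L c := if c == i then [:: p] else [::].
  apply: (main _ A L (ltnSn _) VA); last by rewrite /L eqxx inE.
  move=> c; rewrite /L; case: eqVneq => [->|_]; last first.
    by split => //; rewrite /pairwise_orthogonal.
  split; last by move=> e; rewrite inE => /eqP ->.
  by apply: orthogonal_cons_unit => //; rewrite /pairwise_orthogonal.
elim: N B L => // N IH B L leN VB invL pL.
have [Bp _ _] := (invL i).2 p pL.
have [[c [y [cc0 A'y y1 yL]]]|none] := pselect (exists c y,
    [/\ c != c0, A' y = a c *: y, '[y, y] = 1 & forall e, e \in L c -> '[y, e] = 0]).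
  have yorth c' e : e \in L c' -> '[y, e] = 0.
    move=> eL; have [_ A'e _] := (invL c').2 e eL.
    have [e'|nc] := eqVneq c c'; first by subst c'; exact: yL.
    exact: (eig_orth VA' nc A'y A'e).
  have [oL hL] := invL c.
  have oyL : pairwise_orthogonal dot (y :: L c) by exact: orthogonal_cons_unit.
  have szL : dim_gt (size (L c)) (d c).
    have := oc_dim ocV VA' c; case dc: (d c) => [m|//] /= hc.
    apply: (orthogonal_le_basis hc oyL) => e; rewrite inE => /predU1P[-> //|].
    by case/hL.
  have [u0 [Bu0 u01 u0L]] := orth_in VB szL.
  have uorth c' e : e \in L c' -> '[u0, e] = 0.
    move=> eL; have [Be _ _] := (invL c').2 e eL.
    have [e'|nc] := eqVneq c c'; first by subst c'; exact: u0L.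
    exact: (eig_orth VB nc Bu0 Be).
  have [B' [R B'y B'e]] := reach_absorb VB Bp y1 (dotC0 (yorth _ _ pL)) Bu0 u01
    (dotC0 (uorth _ _ pL)).
  have [VB' _] := reach_V VB Bp R.
  apply: (reach_trans R).
  pose L' c' := if c' == c then y :: L c else L c'.
  apply: (IH B' L') => //.
  - rewrite -ltnS; apply: leq_trans leN; rewrite ltnS.
    rewrite (bigD1 c) //= [X in (_ < X)%N](bigD1 c) //= /L' eqxx -addSn leq_add //.
      rewrite /= subnS prednK // subn_gt0; move: szL; rewrite /n.
      by case dc: (d c) => [m|] //=; have := d_fin cc0.
    by apply: leq_sum => c' /andP[_ /negPf ->].
  - move=> c'; rewrite /L'; case: eqVneq => [->|nc].
      split => // e; rewrite inE => /predU1P[-> //|eL].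
      have [Be A'e e1] := hL e eL; split => //.
      by apply: B'e => //; apply: dotC0; [exact: (yorth c)|exact: (uorth c)].
    have [oc' hc'] := invL c'; split => // e eL.
    have [Be A'e e1] := hc' e eL; split => //.
    by apply: B'e => //; apply: dotC0; [exact: (yorth c')|exact: (uorth c')].
  by rewrite /L'; case: eqVneq => // ic; rewrite inE -ic pL orbT.
suff -> : B = A' by exact: Reach0.
apply: (@vertex_eq_but_one _ _ c0) => // c cc0 x.
case dc: (d c) => [m|]; last by have := d_fin cc0.
have [oL hL] := invL c.
have ms : (m <= size (L c))%N.
  rewrite leqNgt; apply/negP => sm; apply: none.
  have [|y [A'y y1 ys]] := orth_in (s := L c) (l := c) VA'; first by rewrite dc.
  by exists c, y.
split => hx.
  rewrite (span_of_full VB dc ms oL _ hx); last by move=> e /hL [].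
  rewrite (big_morph A' (vertexD VA') (vertex0 VA')) scaler_sumr big_seq [RHS]big_seq.
  by apply: eq_bigr => e /hL [_ A'e _]; rewrite (vertexZ VA') A'e !scalerA mulrC.
rewrite (span_of_full VA' dc ms oL _ hx); last by move=> e /hL [].
rewrite (big_morph B (vertexD VB) (vertex0 VB)) scaler_sumr big_seq [RHS]big_seq.
by apply: eq_bigr => e /hL [Be _ _]; rewrite (vertexZ VB) Be !scalerA mulrC.
Qed.

(** * Action of an automorphism on coloured lines *)

(** The inverse [g] is part of the data, so that transfers along [f] are reversed by [aut_sym]. *)
Definition vertex_aut (f g : (H -> H) -> (H -> H)) :=
  [/\ forall A, V A -> V (f A), forall A, V A -> V (g A),
      forall A, V A -> g (f A) = A, forall A, V A -> f (g A) = A &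
      forall A B, V A -> V B -> adj A B <-> adj (f A) (f B)].

Lemma aut_sym f g : vertex_aut f g -> vertex_aut g f.
Proof.
move=> [Vf Vg gf fg adjf]; split => // A B VA VB.
by rewrite (adjf (g A) (g B)) ?fg //; [exact: Vg|exact: Vg].
Qed.

Lemma aut_adj f g A B : vertex_aut f g -> adj A B -> adj (f A) (f B).
Proof. by move=> [_ _ _ _ adjf] AB; have [VA VB _ _] := AB; apply/(adjf _ _ VA VB). Qed.

Lemma aut_adjr f g A B : vertex_aut f g -> V A -> adj (f A) B -> adj A (g B).
Proof.
by move=> fg VA /(aut_adj (aut_sym fg)); case: fg => _ _ gf _ _; rewrite gf.
Qed.

Lemma common2_aut f g A B D : vertex_aut f g -> V A -> V B -> V D ->
  common2 A B D -> common2 (f A) (f B) (f D).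
Proof.
move=> fg VA VB VD [u [v [uv [au bu du] [av bv dv] h]]].
have [_ _ gf fgK _] := fg; have [_ Vu _ _] := au; have [_ Vv _ _] := av.
exists (f u), (f v); split.
- by move=> e; apply: uv; rewrite -(gf u Vu) e gf.
- by split; apply: (aut_adj fg).
- by split; apply: (aut_adj fg).
move=> w aw bw dw; have [_ Vw _ _] := aw.
rewrite -(fgK w Vw).
by case: (h (g w) (aut_adjr fg VA aw) (aut_adjr fg VB bw) (aut_adjr fg VD dw)) => ->;
  [left|right].
Qed.

Lemma row_aut f g A B C0 D : vertex_aut f g -> row A B C0 D -> row (f A) (f B) (f C0) (f D).
Proof.
move=> fg [[AB AC AD BC CD] h]; split; first by split; apply: (aut_adj fg).
have [Vf Vg gf _ _] := fg; have [VA VB _ _] := AB; have [_ VD _ _] := AD.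
case: h => [->|BD|nc]; [exact: Or31|apply: Or32; exact: (aut_adj fg BD)|apply: Or33].
move=> c2; apply: nc; have := common2_aut (aut_sym fg) (Vf _ VA) (Vf _ VB) (Vf _ VD) c2.
by rewrite !gf.
Qed.

Lemma pencil_aut f g A B C0 D : vertex_aut f g -> pencil A B C0 D ->
  pencil (f A) (f B) (f C0) (f D).
Proof. by move=> fg [E [h1 h2]]; exists (f E); split; apply: (row_aut fg). Qed.

Lemma pencil_autr f g A B C0 D : vertex_aut f g -> V A -> V B -> V C0 ->
  pencil (f A) (f B) (f C0) D -> pencil A B C0 (g D).
Proof.
by move=> fg VA VB VC /(pencil_aut (aut_sym fg)); case: fg => _ _ gf _ _; rewrite !gf.
Qed.

Lemma good_aut f g A B C0 : vertex_aut f g -> good A B C0 -> good (f A) (f B) (f C0).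
Proof.
move=> fg [AB BC AC [D hD DB]].
split; [exact: (aut_adj fg)|exact: (aut_adj fg)|exact: (aut_adj fg)|].
exists (f D); first exact: (pencil_aut fg).
have [_ _ gf _ _] := fg; have [_ VB _ _] := AB.
have [E [_ [[_ _ [_ VD _ _] _ _] _]]] := hD.
by move=> e; apply: DB; rewrite -(gf D VD) e gf.
Qed.

Lemma labelled_V A B C0 i p l : labelled A B C0 i p l -> [/\ V A, V B & V C0].
Proof. by case=> VA _ [q [r [AB AC _]]]; split => //; apply: swap_V VA _; eassumption. Qed.

Lemma labelled_aut f g A B C0 i p l : vertex_aut f g -> labelled A B C0 i p l ->
  exists i' p' l', labelled (f A) (f B) (f C0) i' p' l'.
Proof. by move=> fg /labelled_good /(good_aut fg) /good_lab. Qed.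

Lemma step1_aut f g A B C0 A' B' C0' : vertex_aut f g -> V B -> V C0 -> V B' -> V C0' ->
  step1 A B C0 A' B' C0' -> step1 (f A) (f B) (f C0) (f A') (f B') (f C0').
Proof.
move=> fg VB VC VB' VC' [AA' n1 n2 [D h1 h2]]; have [VA VA' _ _] := AA'.
have [_ _ gf _ _] := fg; split; first exact: (aut_adj fg).
- by move=> /(pencil_autr fg VA VB VC); rewrite gf.
- by move=> /(pencil_autr fg VA' VB' VC'); rewrite gf.
by exists (f D); apply: (pencil_aut fg).
Qed.

Lemma step2_aut f g A B C0 A' B' C0' : vertex_aut f g -> V B -> V C0 -> V B' -> V C0' ->
  step2 A B C0 A' B' C0' -> step2 (f A) (f B) (f C0) (f A') (f B') (f C0').
Proof.
move=> fg VB VC VB' VC' [AA' h]; have [VA VA' _ _] := AA'.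
have [_ _ gf fgK _] := fg; split; first exact: (aut_adj fg).
move=> D hD; have [E [_ [[_ _ [_ VD _ _] _ _] _]]] := hD.
have [D' [h1 h2 h3 h4 h5]] := h _ (pencil_autr fg VA VB VC hD).
have [VD' _ _ _] := h3.
exists (f D'); split.
- exact: (pencil_aut fg).
- by move=> e; apply: h2; rewrite -(gf _ VD') e gf.
- exact: (aut_adj fg).
- by rewrite -(fgK _ VD); exact: (aut_adj fg).
move=> w wA wD; have [Vw _ _ _] := wA.
rewrite -(fgK w Vw); case: (h5 (g w)) => [||->|->]; [| |by left|by right].
  by rewrite -(gf _ VA'); exact: (aut_adj (aut_sym fg)).
exact: (aut_adj (aut_sym fg)).
Qed.

Lemma labelled_ex A i p l r : V A -> '[p, p] = 1 -> A p = a i *: p -> i != l ->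
  dim_gt 2 (d l) -> '[r, r] = 1 -> A r = a l *: r ->
  exists B C0, labelled A B C0 i p l /\ swap A B i p l r.
Proof.
move=> VA p1 Ap il dl r1 Ar; have [s [As s1 sr]] := orth_one l r VA.
exists (swap_op A i l p r), (swap_op A i l p s); split; last exact: swap_swap_op.
by split => //; exists r, s; split; [exact: swap_swap_op|exact: swap_swap_op|exact: dotC0].
Qed.

Lemma labelled_any A i p l : V A -> '[p, p] = 1 -> A p = a i *: p -> i != l ->
  dim_gt 2 (d l) -> exists B C0, labelled A B C0 i p l.
Proof.
move=> VA p1 Ap il dl; have [r [Ar r1 _]] := orth_one l 0 VA.
by have [B [C0 [L _]]] := labelled_ex VA p1 Ap il dl r1 Ar; exists B, C0.
Qed.

Lemma labelled_p A B C0 i p l : labelled A B C0 i p l ->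
  [/\ '[p, p] = 1, A p = a i *: p, i != l & dim_gt 2 (d l)].
Proof.
by case=> VA dl [q [r [AB _ _]]]; split => //; [exact: (swap_p1 AB)|exact: (swap_p AB)|exact: (swap_ne AB)].
Qed.

Lemma labelled_same A B C0 i p l i' p' l' : '[p', p'] = 1 -> labelled A B C0 i p l ->
  same_label i p l i' p' l' -> labelled A B C0 i' p' l'.
Proof.
move=> p1' [VA dl [q [r [AB AC qr]]]] [<- <- pp]; split => //; exists q, r.
by split => //; [apply: (swap_par VA AB)|apply: (swap_par VA AC)] => //;
  rewrite ?(swap_q1 AB) ?(swap_q1 AC) //; apply: par_refl.
Qed.

Lemma same_label_sym i p l i' p' l' : '[p', p'] = 1 ->
  same_label i p l i' p' l' -> same_label i' p' l' i p l.
Proof. by move=> p1' [-> -> pp]; split => //; exact: (par_sym p1' pp). Qed.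

Lemma same_label_trans i p l i' p' l' i'' p'' l'' :
  same_label i p l i' p' l' -> same_label i' p' l' i'' p'' l'' ->
  same_label i p l i'' p'' l''.
Proof. by move=> [-> -> pp] [-> -> pp']; split => //; apply: par_trans pp pp'. Qed.

Lemma step_aut_same f g A B C0 A' B' C0' i p l u m v i1 p1 l1 i2 p2 l2 : vertex_aut f g ->
  labelled A B C0 i p l -> labelled A' B' C0' i p l -> swap A A' i u m v -> '[p, u] = 0 ->
  labelled (f A) (f B) (f C0) i1 p1 l1 -> labelled (f A') (f B') (f C0') i2 p2 l2 ->
  same_label i1 p1 l1 i2 p2 l2.
Proof.
move=> fg L L' s pu L1 L2; have [VA VB VC] := labelled_V L; have [VA' VB' VC'] := labelled_V L'.
have [e|ml] := eqVneq m l.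
  subst m; exact: (step1_same L1 L2 (step1_aut fg VB VC VB' VC' (step1_move L L' s pu))).
exact: (step2_same L1 L2 (step2_aut fg VB VC VB' VC' (step2_move L L' ml s pu))).
Qed.

(** Consecutive vertices on a path from [reach_all] satisfy [step1] or [step2], which [f] preserves,
    so the label of the image is constant along the path. *)
Lemma aut_same f g A B C0 A' B' C0' i p l i1 p1 l1 i2 p2 l2 : vertex_aut f g ->
  labelled A B C0 i p l -> labelled A' B' C0' i p l ->
  labelled (f A) (f B) (f C0) i1 p1 l1 -> labelled (f A') (f B') (f C0') i2 p2 l2 ->
  same_label i1 p1 l1 i2 p2 l2.
Proof.
move=> fg L L' L1 L2; have [VA VB VC] := labelled_V L; have [VA' VB' VC'] := labelled_V L'.
have [u1 Ap il dl] := labelled_p L; have [_ A'p _ _] := labelled_p L'.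
have R := reach_all VA VA' u1 Ap A'p.
elim: R B C0 i1 p1 l1 L L1 VA VB VC Ap VA' VB' VC' L' L2 A'p => {A A'}
    [A|A A' A'' u m v s pu _ IH] B C0 i1 p1 l1 L L1 VA VB VC Ap VA' VB' VC' L' L2 A'p.
  (* Two triples at the same vertex are not related by a step; both are compared with one at a
     neighbouring vertex. *)
  have [u [Au uu up]] := orth_one i p VA; have [v [Av vv _]] := orth_one l 0 VA.
  have s : swap A (swap_op A i l u v) i u l v by apply: swap_swap_op.
  have pu := dotC0 up; have V3 := swap_V VA s.
  have A3p : swap_op A i l u v p = a i *: p by apply: (swap_eig_i VA s Ap pu).
  have [B3 [C3 L3]] := labelled_any V3 u1 A3p il dl.
  have [i3 [p3 [l3 L3']]] := labelled_aut fg L3.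
  have S1 := step_aut_same fg L L3 s pu L1 L3'.
  have S2 := step_aut_same fg L' L3 s pu L2 L3'.
  have [p31 _ _ _] := labelled_p L3'.
  exact: (same_label_trans S1 (same_label_sym p31 S2)).
have V3 := swap_V VA s; have A3p := swap_eig_i VA s Ap pu.
have [B3 [C3 L3]] := labelled_any V3 u1 A3p il dl.
have [i3 [p3 [l3 L3']]] := labelled_aut fg L3; have [_ VB3 VC3] := labelled_V L3.
apply: (same_label_trans (step_aut_same fg L L3 s pu L1 L3')).
exact: (IH B3 C3).
Qed.

Definition line_map (f : (H -> H) -> (H -> H)) i p i' p' :=
  forall A, V A -> A p = a i *: p <-> f A p' = a i' *: p'.

Lemma line_map_sym f g i p i' p' : vertex_aut f g -> line_map f i p i' p' ->
  line_map g i' p' i p.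
Proof.
by move=> [Vf Vg gf fg _] h A VA; rewrite -{1}(fg A VA); apply: iff_sym; apply: h; apply: Vg.
Qed.

Hypothesis V_nonempty : exists A, V A.

Lemma vertex_at i p : '[p, p] = 1 -> exists2 A, V A & A p = a i *: p.
Proof.
move=> p1; have [A VA] := V_nonempty; have [u [Au u1 _]] := orth_one i 0 VA.
by have [B [VB Bp _]] := vertex_through VA Au u1 p1; exists B.
Qed.

Lemma vertex_at2 i p l q : '[p, p] = 1 -> '[q, q] = 1 -> '[p, q] = 0 ->
  exists A, [/\ V A, A p = a i *: p & A q = a l *: q].
Proof.
move=> p1 q1 pq; have [A VA Ap] := vertex_at i p1.
have [u [Au u1 up]] := orth_one l p VA.
have [B [VB Bq Be]] := vertex_through VA Au u1 q1.
by exists B; split => //; apply: Be => //; exact: dotC0.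
Qed.

Lemma vertex_at_same i p q : '[p, p] = 1 -> '[q, q] = 1 ->
  exists A, [/\ V A, A p = a i *: p & A q = a i *: q].
Proof.
move=> p1 q1; have [e|pq] := pselect (par p q).
  have [A VA Ap] := vertex_at i p1; exists A; split => //.
  by case: e => c ->; rewrite (vertexZ VA) Ap !scalerA mulrC.
have [c cn0 c1] : exists2 c, c != 0 &
    '[c *: (q - '[q, p] *: p), c *: (q - '[q, p] *: p)] = 1.
  by apply: normalize; move/(parP q p1).
have [|A [VA Ap Aq]] := vertex_at2 i i p1 c1.
  by rewrite dotZr dotC gram_dot // conjC0 mulr0.
exists A; split => //.
have -> : q = '[q, p] *: p + c^-1 *: (c *: (q - '[q, p] *: p)).
  by rewrite scalerA mulVf // scale1r addrC subrK.
by rewrite (vertexD VA) (vertexZ VA c^-1) (vertexZ VA '[q, p]) Ap Aq; vec dot.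
Qed.

Hypothesis other_color : forall i : 'I_k, exists l, i != l.

(** Different colours would make [p] and [q] orthogonal, and then some vertex has both in colour
    [i]. For equal colours, the part of [q] orthogonal to [p] can be given another colour, which
    keeps [q] out of colour [i]. *)
Lemma line_uniq i p l q : '[p, p] = 1 -> '[q, q] = 1 ->
  (forall A, V A -> A p = a i *: p <-> A q = a l *: q) -> i = l /\ par p q.
Proof.
move=> p1 q1 h.
have il : i = l.
  apply/eqP; apply: contraT => il; have [A VA Ap] := vertex_at i p1.
  have Aq := (h A VA).1 Ap; have pq := eig_orth VA il Ap Aq.
  have [B [VB Bp Bq]] := vertex_at2 i i p1 q1 pq.
  by case: (eig_contra VB il q1 Bq ((h B VB).1 Bp)).
split => //; subst l; apply: contrapT => pq.
have [c cn0 c1] : exists2 c, c != 0 &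
    '[c *: (q - '[q, p] *: p), c *: (q - '[q, p] *: p)] = 1.
  by apply: normalize; move/(parP q p1).
have [l li] := other_color i.
have [|A [VA Ap Aq]] := vertex_at2 i l p1 c1.
  by rewrite dotZr dotC gram_dot // conjC0 mulr0.
have Aq' := (h A VA).1 Ap.
have := eig_orth VA li Aq' Aq; rewrite dotZr => /eqP; rewrite mulf_eq0 conjC_eq0 (negPf cn0).
move=> /eqP e; apply: pq; apply/(parP q p1); apply: (@dot_eq0P _ _ dot).
by rewrite dotBl dotZl e [X in _ * X]dotC gram_dot // conjC0 mulr0 subr0.
Qed.

Lemma line_map_uniq f g i p j q j' q' : vertex_aut f g -> '[q, q] = 1 -> '[q', q'] = 1 ->
  line_map f i p j q -> line_map f i p j' q' -> j = j' /\ par q q'.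
Proof.
move=> fg q1 q1' h h'; have [Vf Vg gf fgK _] := fg.
apply: line_uniq => // A VA; rewrite -{1 2}(fgK A VA).
by rewrite -(h _ (Vg _ VA)) -(h' _ (Vg _ VA)).
Qed.

Lemma line_map_uniql f g i p i' p' j q : vertex_aut f g -> '[p, p] = 1 -> '[p', p'] = 1 ->
  line_map f i p j q -> line_map f i' p' j q -> i = i' /\ par p p'.
Proof. by move=> fg p1 p1' h h'; apply: line_uniq => // A VA; rewrite (h A VA) (h' A VA). Qed.

Lemma line_map_par f i p j q q' : '[q', q'] = 1 -> line_map f i p j q ->
  (forall A, V A -> V (f A)) -> par q' q -> par q q' -> line_map f i p j q'.
Proof.
move=> q1' h Vf [c qE] [c' qE'] A VA; rewrite (h A VA); have VfA := Vf A VA.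
split => e; first by rewrite qE' (vertexZ VfA) e !scalerA mulrC.
by rewrite qE (vertexZ VfA) e !scalerA mulrC.
Qed.

(* Disjointness of the sets of vertices through two coloured lines detects
   orthogonality of lines of different colours. *)
Lemma meet_orth i l p q : i != l -> '[p, p] = 1 -> '[q, q] = 1 ->
  (exists A, [/\ V A, A p = a i *: p & A q = a l *: q]) <-> '[p, q] = 0.
Proof.
move=> il p1 q1; split; last exact: vertex_at2.
by case=> A [VA Ap Aq]; exact: (eig_orth VA il Ap Aq).
Qed.

Lemma line_map_meet f g i p i' p' l q l' q' : vertex_aut f g ->
  line_map f i p i' p' -> line_map f l q l' q' ->
  (exists A, [/\ V A, A p = a i *: p & A q = a l *: q]) <->
  (exists A, [/\ V A, A p' = a i' *: p' & A q' = a l' *: q']).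
Proof.
move=> [Vf Vg gf fg _] h h'; split => -[A [VA Ap Aq]].
  by exists (f A); split; [exact: Vf|apply/(h A VA)|apply/(h' A VA)].
exists (g A); split; first exact: Vg.
  by apply/(h _ (Vg _ VA)); rewrite fg.
by apply/(h' _ (Vg _ VA)); rewrite fg.
Qed.

(* The colours of lines that are the fixed line of some pencil. *)
Definition movable (i : 'I_k) := [exists l, (i != l) && dim_gt 2 (d l)].

Lemma label_map f g i p l : vertex_aut f g -> '[p, p] = 1 -> i != l -> dim_gt 2 (d l) ->
  exists i' p' l', [/\ '[p', p'] = 1, i' != l', dim_gt 2 (d l'), line_map f i p i' p' &
    forall A B C0, labelled A B C0 i p l -> labelled (f A) (f B) (f C0) i' p' l'].
Proof.
move=> fg p1 il dl; have [A VA Ap] := vertex_at i p1.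
have [B [C0 L]] := labelled_any VA p1 Ap il dl.
have [i' [p' [l' L']]] := labelled_aut fg L; have [p1' Ap' il' dl'] := labelled_p L'.
have lm A1 B1 C1 : labelled A1 B1 C1 i p l -> labelled (f A1) (f B1) (f C1) i' p' l'.
  move=> L1; have [i1 [p2 [l1 L1']]] := labelled_aut fg L1.
  exact: (labelled_same p1' L1' (aut_same fg L1 L L1' L')).
exists i', p', l'; split => // A1 VA1; split => [A1p|fA1p].
  have [B1 [C1 /lm L1]] := labelled_any VA1 p1 A1p il dl.
  by have [_ ? _ _] := labelled_p L1.
have [Vf Vg gf fgK _] := fg.
have [B1 [C1 L1]] := labelled_any (Vf _ VA1) p1' fA1p il' dl'.
have [i2 [p2 [l2 L2]]] := labelled_aut (aut_sym fg) L1.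
have [_ VB VC] := labelled_V L.
have L0 : labelled (g (f A)) (g (f B)) (g (f C0)) i p l by rewrite !gf.
have := labelled_same p1 L2 (aut_same (aut_sym fg) L1 L' L2 L0).
by rewrite gf // => /labelled_p [].
Qed.

Lemma movable_map f g i p : vertex_aut f g -> '[p, p] = 1 -> movable i ->
  exists i' p', [/\ '[p', p'] = 1, movable i' & line_map f i p i' p'].
Proof.
move=> fg p1 /existsP [l /andP[il dl]].
have [i' [p' [l' [p1' il' dl' h _]]]] := label_map fg p1 il dl.
by exists i', p'; split => //; apply/existsP; exists l'; rewrite il'.
Qed.

(** For equal colours, vertices through both lines carry no information. Instead [p] and [q] are
    each swapped with the same line [r] of another colour: the results are adjacent, so are their
    images, and [nbr_adj] applies. *)
Lemma line_map_orth f g i p q j p' q' : vertex_aut f g -> movable i -> '[p, p] = 1 -> '[q, q] = 1 ->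
  '[p', p'] = 1 -> '[q', q'] = 1 -> line_map f i p j p' -> line_map f i q j q' ->
  '[p, q] = 0 -> '[p', q'] = 0.
Proof.
move=> fg /existsP [l /andP[il dl]] p1 q1 p1' q1' hp hq pq.
have [A [VA Ap Aq]] := vertex_at2 i i p1 q1 pq; have [Vf Vg gf fgK _] := fg.
have [r [Ar r1 _]] := orth_one l 0 VA.
have [B [C1 [L AB]]] := labelled_ex VA p1 Ap il dl r1 Ar.
have [B' [C1' [L' AB']]] := labelled_ex VA q1 Aq il dl r1 Ar.
have [i1 [p2 [l1 [p21 il1 dl1 h1 lm1]]]] := label_map fg p1 il dl.
have [i2 [q2 [l2 [q21 il2 dl2 h2 lm2]]]] := label_map fg q1 il dl.
have [e1 pp] := line_map_uniq fg p1' p21 hp h1.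
have [e2 qq] := line_map_uniq fg q1' q21 hq h2.
subst i1 i2; have [VfA _ [r1' [_ [AB1 _ _]]]] := lm1 _ _ _ L.
have [_ _ [r2' [_ [AB2 _ _]]]] := lm2 _ _ _ L'.
have BB := aut_adj fg (swap_adj_p VA AB AB' pq).
have e : l1 = l2.
  apply/eqP; have := nbr_adj_color VfA (swap_flip AB1) AB2 BB.
  by rewrite eq_sym (negPf il1).
subst l2; case: (nbr_adj VfA AB1 (swap_adj VfA AB2) BB) => [[s AB3 _]|[s AB3 p2s]].
  have [p2q2 _] := swap_uniq_same VfA AB3 AB2.
  have pq' : par p' q' by apply: par_trans pp (par_trans p2q2 (par_sym q21 qq)).
  have hp' := line_map_par q1' hp Vf (par_sym q1' pq') pq'.
  have [_ pq2] := line_map_uniql fg p1 q1 hp' hq.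
  by case: (npar_orth p1 q1 pq).
have [sq _] := swap_uniq_same VfA AB3 AB2.
have sq' := par_trans sq (par_sym q21 qq).
have : '[p2, q'] = 0 by exact: (par_dot0 sq' p2s).
by move/dotC0 => /(par_dot0 (par_sym p21 pp)) /dotC0.
Qed.

Lemma color_map_at f g p : vertex_aut f g -> '[p, p] = 1 -> exists de : 'I_k -> 'I_k,
  [/\ injective de, forall i, ~~ movable i -> de i = i & forall i, movable i ->
    movable (de i) /\ exists2 p', '[p', p'] = 1 & line_map f i p (de i) p'].
Proof.
move=> fg p1.
have /choice [de deP] i : exists i', (~~ movable i -> i' = i) /\ (movable i ->
    movable i' /\ exists2 p', '[p', p'] = 1 & line_map f i p i' p').
  have [mi|mi] := boolP (movable i); last by exists i; split.
  by have [i' [p' [h1 h2 h3]]] := movable_map fg p1 mi; exists i'; split => // _; split => //; exists p'.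
exists de; split => [i l e|i|i]; try exact: (deP i).1; try exact: (deP i).2.
have [mi|mi] := boolP (movable i); have [ml|ml] := boolP (movable l).
- have [_ [p' p1' h]] := (deP i).2 mi; have [_ [p'' p1'' h']] := (deP l).2 ml.
  (* Two lines of one colour always meet in a vertex; its preimage would give [p] both colours [i]
     and [l]. *)
  rewrite -e in h'; have [A [VA Ap' Ap'']] := vertex_at_same (de i) p1' p1''.
  have [B [VB Bp Bp']] : exists B, [/\ V B, B p = a i *: p & B p = a l *: p].
    by apply/(line_map_meet fg h h'); exists A.
  exact: (eig_inj VB (unit_neq0 p1) Bp Bp').
- by have := ml; rewrite -((deP l).1 ml) -e ((deP i).2 mi).1.
- by have := mi; rewrite -((deP i).1 mi) e ((deP l).2 ml).1.
by rewrite -((deP i).1 mi) -((deP l).1 ml).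
Qed.

Lemma color_map f g : vertex_aut f g -> (exists p, '[p, p] = 1) -> exists de : 'I_k -> 'I_k,
  [/\ injective de, forall i, ~~ movable i -> de i = i & forall i, movable i ->
    movable (de i) /\ forall p, '[p, p] = 1 ->
      exists2 p', '[p', p'] = 1 & line_map f i p (de i) p'].
Proof.
move=> fg [p0 p01].
have /choice [de deP] p : exists de : 'I_k -> 'I_k, '[p, p] = 1 ->
  [/\ injective de, forall i, ~~ movable i -> de i = i & forall i, movable i ->
    movable (de i) /\ exists2 p', '[p', p'] = 1 & line_map f i p (de i) p'].
  have [p1|] := pselect ('[p, p] = 1); last by exists id.
  by have [de h] := color_map_at fg p1; exists de.
(* If the colours differed, some [l] other than [i] would be sent at [q] to the image colour of [i]
   at [p]. Image lines of equal colour meet, hence so do [p] in colour [i] and [q] in colour [l],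
   which makes them orthogonal. *)
have nonorth p q i : '[p, p] = 1 -> '[q, q] = 1 -> '[p, q] <> 0 -> de p i = de q i.
  move=> p1 q1 pq; have [ip fp hp] := deP p p1; have [iq fq hq] := deP q q1.
  have [mi|mi] := boolP (movable i); last by rewrite fp ?fq.
  apply: contrapT => ne; have [mpi [p' p1' h]] := hp i mi.
  have [l le] : exists l, de q l = de p i.
    by have /codomP [l ->] := injF_onto iq (de p i); exists l.
  have il : i != l by apply/eqP => e; apply: ne; rewrite -le e.
  have ml : movable l by apply: contraT => ml; move: mpi; rewrite -le (fq l ml) (negPf ml).
  have [_ [q' q1' h']] := hq l ml; rewrite le in h'.
  apply: pq; apply/(meet_orth il p1 q1)/(line_map_meet fg h h').
  exact: vertex_at_same.
have [ip fp hp] := deP p0 p01.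
exists (de p0); split => // i mi; split; first by have [] := hp i mi.
move=> q q1.
suff e : de q i = de p0 i.
  by have [iq fq hq] := deP q q1; have [_ h] := hq i mi; rewrite -e.
have [pq|pq] := pselect ('[p0, q] = 0); last by apply: esym; apply: nonorth.
(* Orthogonal lines are linked through the line of their sum, which is orthogonal to neither. *)
have n0 : p0 + q <> 0.
  move=> e; have : '[p0, p0 + q] = 0 by rewrite e dot0r.
  by rewrite dotDr p01 pq addr0 => /eqP; rewrite oner_eq0.
have [c cn0 c1] := normalize dot n0.
transitivity (de (c *: (p0 + q)) i).
  apply: nonorth => //; rewrite dotZr dotDr (dotC0 pq) q1 add0r mulr1 => /eqP.
  by rewrite conjC_eq0 (negPf cn0).
apply: nonorth => //; rewrite dotZl dotDl p01 (dotC0 pq) addr0 mulr1 => /eqP.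
by rewrite (negPf cn0).
Qed.

Lemma line_transformation f g : vertex_aut f g -> (exists i, movable i) ->
  exists (de : 'I_k -> 'I_k) (phi : H -> H), [/\ injective de,
    forall i, ~~ movable i -> de i = i,
    forall p, '[p, p] = 1 -> '[phi p, phi p] = 1 /\
      forall i, movable i -> line_map f i p (de i) (phi p),
    forall p q, '[p, p] = 1 -> '[q, q] = 1 -> '[p, q] = 0 <-> '[phi p, phi q] = 0 &
    forall x, '[x, x] = 1 -> exists2 p, '[p, p] = 1 & par (phi p) x].
Proof.
move=> fg [i0 m0]; have gf := aut_sym fg; have [Vf Vg _ _ _] := fg.
have ex1 : exists p, '[p, p] = 1.
  by have [A VA] := V_nonempty; have [p [_ p1 _]] := orth_one i0 0 VA; exists p.
have [de [de_inj de_fix deP]] := color_map fg ex1.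
have [de' [_ _ deP']] := color_map gf ex1.
have [mc0 h0] := deP i0 m0; set c := de i0 in mc0 h0.
have /choice [phi phiP] p : exists p', '[p, p] = 1 -> '[p', p'] = 1 /\ line_map f i0 p c p'.
  have [p1|] := pselect ('[p, p] = 1); last by exists 0.
  by have [p' p1' h] := h0 p p1; exists p'.
have onto x : '[x, x] = 1 -> exists2 p, '[p, p] = 1 & line_map f i0 p c x.
  move=> x1; have [mi' /(_ x x1) [p p1 /(line_map_sym gf) h]] := deP' c mc0.
  exists p => //; suff <- : de' c = i0 by [].
  have [_ /(_ p p1) [x' x1' h']] := deP _ mi'.
  by apply: de_inj; have [] := line_map_uniq fg x1' x1 h' h.
have orth p q : '[p, p] = 1 -> '[q, q] = 1 -> '[p, q] = 0 <-> '[phi p, phi q] = 0.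
  move=> p1 q1; have [hp1 hp] := phiP p p1; have [hq1 hq] := phiP q q1; split.
    exact: (line_map_orth fg m0 p1 q1 hp1 hq1 hp hq).
  exact: (line_map_orth gf mc0 hp1 hq1 p1 q1 (line_map_sym fg hp) (line_map_sym fg hq)).
exists de, phi; split => // [p p1|x x1]; last first.
  have [p p1 h] := onto x x1; exists p => //; have [hp1 hp] := phiP p p1.
  by have [] := line_map_uniq fg hp1 x1 hp h.
have [hp1 hp] := phiP p p1; split => // i mi.
have [e|ni] := eqVneq i i0; first by rewrite e.
have [mi' /(_ p p1) [p' p1' h]] := deP i mi.
suff pp : par (phi p) p'.
  by apply: (line_map_par hp1 h Vf pp (par_sym p1' pp)).
apply: contrapT => npp.
have [ka ka0 k1] : exists2 ka, ka != 0 & '[ka *: (p' - '[p', phi p] *: phi p),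
    ka *: (p' - '[p', phi p] *: phi p)] = 1.
  by apply: normalize; move/(parP p' hp1).
(* [x] is the direction of the part of [p'] orthogonal to [phi p], so it is the image of some [q]
   orthogonal to [p]. As [p] in colour [i] and [q] in colour [i0] meet, [p'] is orthogonal to [x], a
   contradiction. *)
set x := ka *: _ in k1; have [q q1 hq] := onto x k1.
have px : '[phi p, x] = 0 by rewrite /x dotZr dotC gram_dot // conjC0 mulr0.
have pq : '[p, q] = 0.
  exact: (line_map_orth gf mc0 hp1 k1 p1 q1 (line_map_sym fg hp) (line_map_sym fg hq) px).
have ne : de i != c by apply: contra ni => /eqP/de_inj ->.
have px' : '[p', x] = 0.
  apply/(meet_orth ne p1' k1)/(line_map_meet fg h hq).
  exact/(meet_orth ni p1 q1).
apply: npp; apply/(parP p' hp1); apply: (@dot_eq0P _ _ dot); apply/eqP.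
move: px' px; rewrite /x !dotZr => /eqP; rewrite mulf_eq0 conjC_eq0 (negPf ka0) /= => px'.
move=> /eqP; rewrite mulf_eq0 conjC_eq0 (negPf ka0) /= => /eqP px.
by rewrite dotBl dotZl px mulr0 subr0.
Qed.

Hypothesis d_eq2 : forall i j, d i = Some 2%N -> d j = Some 2%N -> i = j.

Lemma dim_cases i : d i = Some 2%N \/ dim_gt 2 (d i).
Proof. by have := d_gt1 i; case: (d i) => [[|[|[|n]]]|] //=; [left|right|right]. Qed.

(** If [i] is not movable, [c] has dimension 2; no other colour has, so [i] itself is large enough
    to make [c] movable. *)
Lemma movable_other i c : ~~ movable i -> c != i -> movable c.
Proof.
move=> /existsPn h ci; have := h c; rewrite eq_sym ci /= => dc.
have {dc} dc : d c = Some 2%N by case: (dim_cases c) => // dc'; rewrite dc' in dc.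
apply/existsP; exists i; rewrite ci /=.
by case: (dim_cases i) => // di; move: ci; rewrite (d_eq2 di dc) eqxx.
Qed.

Lemma movable_ex : (0 < k)%N -> exists i, movable i.
Proof.
move=> k0; have [l il] := other_color (Ordinal k0).
have [m|/movable_other h] := boolP (movable (Ordinal k0)); first by exists (Ordinal k0).
by exists l; apply: h; rewrite eq_sym.
Qed.

Lemma dim3_vertex : (0 < k)%N -> forall x y, exists z, [/\ '[z, z] = 1, '[z, x] = 0 & '[z, y] = 0].
Proof.
move=> k0 x y; have [i /existsP [l /andP[_ dl]]] := movable_ex k0.
have [A VA] := V_nonempty; have [z [_ z1 zs]] := orth_in (s := [:: x; y]) VA dl.
by exists z; split => //; apply: zs; rewrite !inE eqxx ?orbT.
Qed.

(** * Transport of eigenspaces along the semilinear map *)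

Section Transport.
Variables (f g : (H -> H) -> (H -> H)) (de : 'I_k -> 'I_k) (phi U : H -> H) (s : C -> C).
Hypotheses (fg : vertex_aut f g) (de_inj : injective de)
  (de_fix : forall i, ~~ movable i -> de i = i)
  (phi_map : forall p, '[p, p] = 1 -> forall i, movable i -> line_map f i p (de i) (phi p))
  (UD : forall x y, U (x + y) = U x + U y) (UZ : forall c x, U (c *: x) = s c *: U x)
  (U_phi : forall p, '[p, p] = 1 -> par (phi p) (U p))
  (U_unit : forall p, '[p, p] = 1 -> '[U p, U p] = 1)
  (U_orth : forall x y, '[x, y] = 0 -> '[U x, U y] = 0)
  (U_onto : forall y, exists x, U x = y).

Let U0 : U 0 = 0.
Proof. by apply: (addrI (U 0)); rewrite -UD !addr0. Qed.

Lemma transport_line A i p : V A -> movable i -> '[p, p] = 1 ->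
  A p = a i *: p <-> f A (U p) = a (de i) *: U p.
Proof.
move=> VA mi p1; have [Vf _ _ _ _] := fg.
have [c UE] := U_phi p1; rewrite (phi_map p1 mi VA) UE (vertexZ (Vf A VA)).
have cn0 : c != 0 by apply/eqP => cn0; apply: (unit_neq0 (U_unit p1)); rewrite UE cn0 scale0r.
split => [->|e]; first by rewrite !scalerA mulrC.
by apply: (scalerI cn0); rewrite e !scalerA mulrC.
Qed.

(** For movable colours this is the line map. If [i] is not movable, a component of [U x] in another
    colour is the image of a vector of movable colour in [A], orthogonal to [x]; since [U] preserves
    orthogonality, it vanishes. *)
Lemma transport_eig A i x : V A -> A x = a i *: x -> f A (U x) = a (de i) *: U x.
Proof.
move=> VA Ax; have [Vf _ _ _ _] := fg; have VfA := Vf A VA.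
have [->|x0] := pselect (x = 0); first by rewrite U0 (vertex0 VfA) scaler0.
have [mi|mi] := boolP (movable i).
  have [c cn0 c1] := normalize dot x0.
  have Ac : A (c *: x) = a i *: (c *: x) by rewrite (vertexZ VA) Ax !scalerA mulrC.
  have := (transport_line VA mi c1).1 Ac.
  have -> : U x = s c^-1 *: U (c *: x) by rewrite -UZ scalerA mulVf // scale1r.
  by move=> e; rewrite (vertexZ VfA) e !scalerA mulrC.
rewrite (de_fix mi).
suff E n : n != i -> eigcomp (f A) n (U x) = 0.
  rewrite -{1 2}(eigcomp_sum (U x) VfA) (bigD1 i) //= big1 ?addr0; first exact: eigcompE.
  by move=> n /E.
move=> ni; apply: contrapT => z0; set z := eigcomp _ _ _ in z0.
have fAz : f A z = a n *: z by exact: eigcompE.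
have [w Uw] := U_onto z.
have w0 : w <> 0 by move=> w0; apply: z0; rewrite -Uw w0 U0.
have [c cn0 c1] := normalize dot w0.
have /codomP [n' n'E] := injF_onto de_inj n.
have n'i : n' != i by apply: contra ni => /eqP e; rewrite n'E e (de_fix mi).
have mn' := movable_other mi n'i.
have fAp : f A (U (c *: w)) = a (de n') *: U (c *: w).
  by rewrite UZ Uw (vertexZ VfA) fAz -n'E !scalerA mulrC.
have Ap := (transport_line VA mn' c1).2 fAp.
have in' : i != n' by rewrite eq_sym.
have := U_orth (eig_orth VA in' Ax Ap); rewrite UZ Uw dotZr => /eqP.
rewrite mulf_eq0 conjC_eq0 => /orP[/eqP sc|/eqP xz].
  by apply: (unit_neq0 (U_unit c1)); rewrite UZ sc scale0r.
by apply: z0; apply: (@dot_eq0P _ _ dot); rewrite {1}/z eigcomp_dot.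
Qed.

Lemma transport_cmp A i x : V A -> eigcomp (f A) (de i) (U x) = U (eigcomp A i x).
Proof.
move=> VA; have [Vf _ _ _ _] := fg; have VfA := Vf A VA.
have deK : cancel (invF de_inj) de by exact: f_invF.
have -> : eigcomp A i x = eigcomp A (invF de_inj (de i)) x by rewrite invF_f.
apply: (eigcomp_decomp VfA (w := fun n => U (eigcomp A (invF de_inj n) x))) => [|n].
  rewrite -{1}(eigcomp_sum x VA) (big_morph U UD U0).
  by rewrite (reindex_inj (can_inj deK)).
by have := transport_eig VA (eigcompE (invF de_inj n) x VA); rewrite deK.
Qed.

End Transport.

End OrbitClass.

(** * Spectral decomposition and dimensions *)

Section Spectral.
Variables (C : numClosedFieldType) (H : lmodType C) (dot : {dot H for conjC}).
Variables (A : H -> H) (k : nat) (a : 'I_k -> C).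
Implicit Types (x y : H) (p q : {poly C}).
Local Notation "''[' u , v ]" := (dot u v) : ring_scope.

Hypothesis A_lin : linear A.
Hypothesis A_sa : forall x y, '[A x, y] = '[x, A y].
Hypothesis a_real : forall i, (a i)^* = a i.
Hypothesis eigenvalues : forall l x, x <> 0 -> A x = l *: x -> exists i, l = a i.

Let AD x y : A (x + y) = A x + A y.
Proof. by have /(_ 1 x y) := A_lin; rewrite !scale1r. Qed.
Let A0 : A 0 = 0.
Proof. by apply: (addrI (A 0)); rewrite -AD !addr0. Qed.
Let AZ c x : A (c *: x) = c *: A x.
Proof. by have /(_ c x 0) := A_lin; rewrite A0 !addr0. Qed.
Let AB x y : A (x - y) = A x - A y.
Proof. by rewrite AD -scaleN1r AZ scaleN1r. Qed.

Definition eval_op p x := \sum_(i < size p) p`_i *: iter i A x.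

Lemma eval_op_widen p n x : (size p <= n)%N -> eval_op p x = \sum_(i < n) p`_i *: iter i A x.
Proof.
move=> pn; rewrite /eval_op (big_ord_widen n (fun i => p`_i *: iter i A x) pn).
rewrite [RHS](bigID (fun i : 'I_n => i < size p)%N) /= [X in _ + X]big1 ?addr0 // => i.
by rewrite -leqNgt => /leq_sizeP h; rewrite h // scale0r.
Qed.

Lemma eval_opZ c p x : eval_op (c *: p) x = c *: eval_op p x.
Proof.
rewrite (eval_op_widen x (size_scale_leq c p)) /eval_op scaler_sumr.
by apply: eq_bigr => i _; rewrite coefZ scalerA.
Qed.

Lemma eval_op_XsubC r p x : eval_op (('X - r%:P) * p) x = eval_op p (A x - r *: x).
Proof.
have it i : iter i A (A x - r *: x) = iter i.+1 A x - r *: iter i A x.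
  by elim: i => //= i ->; rewrite AB AZ.
have sz : (size (('X - r%:P) * p)%R <= (size p).+1)%N.
  by apply: leq_trans (size_polyMleq _ _) _; rewrite size_XsubC.
rewrite (eval_op_widen x sz) /eval_op.
under eq_bigr => i _ do rewrite mulrBl coefB coefXM coefCM scalerBl.
under [RHS]eq_bigr => i _ do rewrite it scalerBr.
rewrite !sumrB big_ord_recl /= scale0r add0r; congr (_ - _).
rewrite big_ord_recr /= nth_default // mulr0 scale0r addr0.
by apply: eq_bigr => i _; rewrite scalerA mulrC.
Qed.

(** A root [z] is peeled off by dividing the components with [a i] different from [z] by [a i - z].
    The remainder is an eigenvector if [z] is one of the [a j], and 0 otherwise. *)
Lemma decomp_of_roots (r : seq C) x : eval_op (\prod_(z <- r) ('X - z%:P)) x = 0 ->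
  exists xs : 'I_k -> H, x = \sum_i xs i /\ forall i, A (xs i) = a i *: xs i.
Proof.
elim: r x => [|z r IH] x.
  rewrite big_nil /eval_op size_poly1 big_ord_recl big_ord0 /= addr0 coefC /= scale1r => ->.
  by exists (fun=> 0); rewrite big1 //; split => // i; rewrite A0 scaler0.
rewrite big_cons eval_op_XsubC => /IH [ys [yE Ay]].
pose w i := (a i - z)^-1 *: ys i.
have Aw i : A (w i) = a i *: w i by rewrite /w AZ Ay !scalerA mulrC.
have Aw' i : a i <> z -> A (w i) - z *: w i = ys i.
  move=> /eqP az; rewrite Aw -scalerBl /w scalerA mulfV ?scale1r //.
  by rewrite subr_eq0.
have Asum P : A (\sum_(i | P i) w i) = \sum_(i | P i) A (w i).
  exact: (big_morph A AD A0).
have [[j zj]|none] := pselect (exists j, z = a j).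
  pose P i := a i != z; pose x' := x - \sum_(i | P i) w i.
  have Ax' : A x' - z *: x' = \sum_(i | ~~ P i) ys i.
    have -> : A x' - z *: x' = (A x - z *: x) - \sum_(i | P i) (A (w i) - z *: w i).
      by rewrite /x' AB Asum sumrB -scaler_sumr; vec dot.
    rewrite yE (bigID P) /= addrAC (eq_bigr ys) ?subrr ?add0r // => i /eqP.
    exact: Aw'.
  have Ay' : A (\sum_(i | ~~ P i) ys i) = z *: \sum_(i | ~~ P i) ys i.
    rewrite (big_morph A AD A0) scaler_sumr; apply: eq_bigr => i /negPn /eqP <-.
    exact: Ay.
  (* No Jordan block arises: [A x' - z *: x'] lies in the kernel of [A - z], and self-adjointness
     makes it orthogonal to itself. *)
  have {}Ax' : A x' = z *: x'.
    apply/eqP; rewrite -subr_eq0; apply/eqP; apply: (@dot_eq0P _ _ dot).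
    rewrite {2}Ax' dotBl dotZl A_sa Ay' dotZr zj a_real -/(P _).
    by rewrite -zj subrr.
  have Pj : P j = false by rewrite /P zj eqxx.
  exists (fun i => if i == j then x' else if P i then w i else 0); split; last first.
    move=> i; case: eqVneq => [->|_]; first by rewrite -zj.
    by case: (P i); rewrite ?A0 ?scaler0.
  rewrite (bigD1 j) //= eqxx; have -> : x = x' + \sum_(i | P i) w i by rewrite subrK.
  congr (_ + _); rewrite big_mkcond (bigD1 j) //= Pj add0r.
  by apply: eq_bigr => i /negPf ->.
have nz i : a i <> z by move=> e; apply: none; exists i.
exists w; split => //; apply/eqP; rewrite -subr_eq0; apply/eqP; apply: contrapT => n0.
have [|i zi] := @eigenvalues z _ n0; last exact: (nz i).
apply/eqP; rewrite -subr_eq0; apply/eqP.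
have -> : A (x - \sum_i w i) - z *: (x - \sum_i w i) =
    (A x - z *: x) - \sum_i (A (w i) - z *: w i).
  by rewrite AB Asum sumrB -scaler_sumr; vec dot.
by rewrite yE [X in _ - X](eq_bigr ys) ?subrr // => i _; apply: Aw'.
Qed.

(** [n.+1] iterates of [A x] in the range are dependent, which gives a polynomial annihilating
    [A x]; the extra root 0 passes from [A x] to [x]. *)
Lemma finite_rank_decomp n x : has_basis (range A) n ->
  exists xs : 'I_k -> H, x = \sum_i xs i /\ forall i, A (xs i) = a i *: xs i.
Proof.
move=> rkA; pose v (m : 'I_n.+1) := iter m A (A x).
have : ~ indep v.
  move=> /(indep_le_basis rkA) h; suff : (n.+1 <= n)%N by rewrite ltnn.
  by apply: h => m; exists (iter m A x) => //; rewrite /v -iterS iterSr.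
move=> nv; have [c [c0 [m cm]]] : exists c : 'I_n.+1 -> C, \sum_i c i *: v i = 0 /\
    exists i, c i != 0.
  apply: contrapT => h; apply: nv => c c0 i; apply/eqP; apply: contrapT => ci.
  by apply: h; exists c; split => //; exists i; apply/negP.
pose q := \poly_(i < n.+1) c (inord i).
have q0 : q != 0.
  apply/eqP => q0; move: cm; have := coef_poly n.+1 (fun i => c (inord i)) m.
  by rewrite -/q q0 coef0 ltn_ord inord_val => <-; rewrite eqxx.
have qA : eval_op q (A x) = 0.
  rewrite (eval_op_widen (n := n.+1)) ?size_poly // -[RHS]c0; apply: eq_bigr => i _.
  by rewrite coef_poly ltn_ord inord_val.
have [r qE] := closed_field_poly_normal q.
apply: (@decomp_of_roots (0 :: r)); rewrite big_cons eval_op_XsubC scale0r subr0.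
have lq : lead_coef q != 0 by rewrite lead_coef_eq0.
by apply: (scalerI lq); rewrite -eval_opZ -qE qA scaler0.
Qed.

End Spectral.

(** * Dimensions under semilinear maps *)

Section SemilinearTransport.
Variables (C : numClosedFieldType) (H : lmodType C) (U : H -> H) (s : C -> C).
Implicit Types (X Y : set H).
Hypotheses (UD : forall x y, U (x + y) = U x + U y) (UZ : forall c x, U (c *: x) = s c *: U x).
Hypothesis U_inj : forall x, U x = 0 -> x = 0.
Hypotheses (s_onto : forall c, exists b, s b = c) (s_eq0 : forall c, c = 0 -> s c = 0).

Let U0 : U 0 = 0.
Proof. by apply: (addrI (U 0)); rewrite -UD !addr0. Qed.

Lemma has_basis_semilinear X Y n : (forall x, X x <-> Y (U x)) ->
  (forall y, exists x, U x = y) -> has_basis X n -> has_basis Y n.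
Proof.
move=> XY Uonto [e [ie eX]]; exists (fun i => U (e i)); split => [c cU i|].
  have /choice [b sb] j := s_onto (c j).
  rewrite -sb; apply: s_eq0; apply: ie; apply: U_inj; rewrite -[RHS]cU (big_morph U UD U0).
  by apply: eq_bigr => j _; rewrite UZ sb.
apply/seteqP; split => y /=.
  have [x <-] := Uonto y; move/XY; rewrite eX => -[c _ <-].
  exists (fun i => s (c i)) => //; rewrite (big_morph U UD U0).
  by apply: eq_bigr => j _; rewrite UZ.
case=> c _ <-; have /choice [b sb] j := s_onto (c j).
have -> : \sum_i c i *: U (e i) = U (\sum_i b i *: e i).
  by rewrite (big_morph U UD U0); apply: eq_bigr => j _; rewrite UZ sb.
by apply/XY; rewrite eX; exists b.
Qed.

End SemilinearTransport.

Section DimUniqueness.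
Variables (C : numClosedFieldType) (H : lmodType C).

Lemma has_dim_uniq (X : set H) dd dd' : has_dim X dd -> has_dim X dd' -> dd = dd'.
Proof.
have le n m : has_basis X n -> has_basis X m -> (n <= m)%N.
  move=> [e [ie eX]] hm; apply: (indep_le_basis hm ie) => i; rewrite eX.
  exists (fun j => (j == i)%:R) => //; rewrite (bigD1 i) //= eqxx scale1r big1 ?addr0 //.
  by move=> j /negPf ->; rewrite scale0r.
case: dd => [n|]; case: dd' => [m|] //= h h'; last by case: (h m).
  by congr Some; apply/eqP; rewrite eqn_leq !le.
by case: (h' n).
Qed.

End DimUniqueness.

(** * Endomorphisms of the complex field that preserve positivity *)

Section RealTwist.
Local Open Scope complex_scope.
Variables (R : realType) (s : R[i] -> R[i]).
Hypotheses (sD : forall x y, s (x + y) = s x + s y) (sM : forall x y, s (x * y) = s x * s y)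
  (s1 : s 1 = 1) (s_ge0 : forall x, 0 <= x -> 0 <= s x).

Let s0 : s 0 = 0.
Proof. by apply: (addrI (s 0)); rewrite -sD !addr0. Qed.
Let sN x : s (- x) = - s x.
Proof. by apply/eqP; rewrite -addr_eq0 -sD addNr s0. Qed.

(** [s] fixes the rationals and is monotone on the reals, which excludes a rational strictly between
    [r] and its image. *)
Lemma twist_real (r : R) : s r%:C = r%:C.
Proof.
have sB x y : s (x - y) = s x - s y by rewrite sD sN.
pose s' : {rmorphism R[i] -> R[i]} := HB.pack s
  (GRing.isZmodMorphism.Build _ _ s sB) (GRing.isMonoidMorphism.Build _ _ s (s1, sM)).
have sq (q : rat) : s (ratr q : R)%:C = (ratr q : R)%:C.
  by rewrite fmorph_rat; exact: (fmorph_rat s').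
have mono (x y : R) : x <= y -> s x%:C <= s y%:C.
  by move=> xy; rewrite -subr_ge0 -sB; apply: s_ge0; rewrite subr_ge0 lecR.
have sreal : s r%:C \is Num.real.
  have [r0|r0] := lerP 0 r; first by apply: ger0_real; apply: s_ge0; rewrite ler0c.
  rewrite -[r]opprK rmorphN sN rpredN; apply: ger0_real; apply: s_ge0.
  by rewrite ler0c oppr_ge0 ltW.
have /complex_realP [t st] := sreal; rewrite st; congr (_%:C).
apply/eqP; rewrite eq_le; apply/andP; split; rewrite leNgt; apply/negP => /rat_in_itvoo [q];
  rewrite in_itv /= => /andP[q1 q2].
  have := mono _ _ (ltW q1); rewrite st sq lecR => h.
  by have := lt_le_trans q2 h; rewrite ltxx.
have := mono _ _ (ltW q2); rewrite st sq lecR => h.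
by have := le_lt_trans h q1; rewrite ltxx.
Qed.

Lemma twist_cases : (forall c, s c = c) \/ (forall c, s c = conjC c).
Proof.
have si : s 'i * s 'i = -1.
  by rewrite -sM -expr2 sqr_i sN s1.
have : (s 'i - 'i) * (s 'i + 'i) = 0.
  have -> : (s 'i - 'i) * (s 'i + 'i) = s 'i * s 'i - 'i ^+ 2 by ring.
  by rewrite si sqr_i subrr.
move/eqP; rewrite mulf_eq0 subr_eq0 addr_eq0 => /orP[] /eqP e; [left|right] => c.
  by rewrite [in LHS](complexE c) sD sM !twist_real e -complexE.
rewrite [in LHS](complexE c) sD sM !twist_real e [in RHS](complexE c).
rewrite rmorphD rmorphM /=.
rewrite -[RHS]/(conjc _ + conjc _ * conjc _) !conjc_real.
congr (_ + _ * _); apply/eqP; by rewrite eq_complex /= oppr0 !eqxx.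
Qed.

End RealTwist.

(** * Conjugacy classes of finite-rank operators *)

Section ConjugacyClass.
Variables (R : realType) (H : completeNormedModType R[i]) (dot : {dot H for conjC}).
Hypothesis dot_norm : forall x : H, dot x x = `|x| ^+ 2.
Implicit Types (A B : H -> H) (w x y : H).
Local Notation "''[' u , v ]" := (dot u v) : ring_scope.

Section Reflection.
Variable w : H.
Hypothesis w1 : '[w, w] = 1.
Local Notation T := (hreflect dot w).

Let TD x y : T (x + y) = T x + T y. Proof. exact: hreflectD. Qed.
Let TZ c x : T (c *: x) = c *: T x. Proof. exact: hreflectZ. Qed.
Let T0 : T 0 = 0.
Proof. by apply: (addrI (T 0)); rewrite -TD !addr0. Qed.
Let TB x y : T (x - y) = T x - T y.
Proof. by rewrite TD -[- y]scaleN1r TZ scaleN1r. Qed.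

Lemma hreflectK x : T (T x) = x.
Proof.
rewrite /hreflect dotBl dotZl w1; apply: (@dot_inj _ _ dot) => z.
by rewrite !dotlE; ring.
Qed.

Lemma hreflect_sa x y : '[T x, y] = '[x, T y].
Proof.
rewrite /hreflect !(dotlE, dotrE) rmorphM /= -(dotC dot w y) conjC_nat; ring.
Qed.

Lemma hreflect_norm x : `|T x| = `|x|.
Proof.
apply: (pexpIrn (n := 2%N)) => //; rewrite ?nnegrE ?normr_ge0 //.
by rewrite -!dot_norm hreflect_sa hreflectK.
Qed.

Lemma hreflect_continuous : continuous T.
Proof.
move=> x; apply/cvgrPdist_lt => eps e0; near=> y.
rewrite -TB hreflect_norm; near: y.
by apply: (@cvgr_dist_lt _ _ _ _ _ id) => //; exact: cvg_id.
Unshelve. all: by end_near. Qed.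

Let conj A := T \o A \o T.

Let conjK A : conj (conj A) = A.
Proof. by apply/funext => x; rewrite /conj /= !hreflectK. Qed.

Lemma bounded_conj A : bounded_operator A -> bounded_operator (conj A).
Proof.
move=> [lA cA]; split.
  by move=> c x y; rewrite /conj /= TD TZ lA TD TZ.
move=> x; apply: continuous_comp; first exact: hreflect_continuous.
by apply: continuous_comp; [exact: cA|exact: hreflect_continuous].
Qed.

Let basis_conj (X Y : set H) n : (forall x, X x <-> Y (T x)) -> has_basis X n -> has_basis Y n.
Proof.
move=> XY; apply: (has_basis_semilinear (s := id) TD TZ) XY _.
- by move=> x Tx; rewrite -(hreflectK x) Tx T0.
- by move=> c; exists c.
- by [].
by move=> y; exists (T y); exact: hreflectK.
Qed.

(** Inverses of [A - l] are conjugated along; one inclusion suffices because conjugation by a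
    reflection is an involution. *)
Lemma spectrum_conj A : spectrum (conj A) = spectrum A.
Proof.
have sub B l : spectrum (conj B) l -> spectrum B l.
  move=> h [D [bD [BD DB]]]; apply: h; exists (conj D); split; first exact: bounded_conj.
  split => x; rewrite /conj /=.
    by rewrite -{2}(hreflectK x) -TZ -TB hreflectK BD hreflectK.
  by rewrite -TZ -TB hreflectK DB hreflectK.
apply/seteqP; split => l; first exact: sub.
by rewrite -{1}(conjK A); exact: sub.
Qed.

Lemma conj_class_reflect k (a : 'I_k -> R) d A : conj_class dot a d A ->
  conj_class dot a d (conj A).
Proof.
move=> [bA sA [n rA] spA dA]; split.
- exact: bounded_conj.
- by move=> x y; rewrite /conj /= hreflect_sa sA hreflect_sa.
- exists n; apply: basis_conj rA => x; split => [[y _ <-]|[y _ Ty]].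
    by exists (T y) => //; rewrite /conj /= hreflectK.
  by exists (T y) => //; rewrite -[RHS]hreflectK -Ty /conj /= hreflectK.
- by rewrite spectrum_conj.
have E B i x : Defs.eigenspace B (a i)%:C%C x <-> Defs.eigenspace (conj B) (a i)%:C%C (T x).
  rewrite /Defs.eigenspace /conj /= hreflectK; split => [->|h]; first exact: TZ.
  by rewrite -[LHS]hreflectK h TZ hreflectK.
move=> i; have := dA i; case: (d i) => [m|] /=; first exact: basis_conj (E A i).
move=> h m hm; apply: (h m); apply: basis_conj hm => x.
by rewrite -{2}(conjK A); exact: E.
Qed.

End Reflection.

Variables (k : nat) (a : 'I_k -> R) (d : 'I_k -> option nat).
Local Notation V := (conj_class dot a d).
Local Notation ac := (fun i => (a i)%:C%C).

Lemma eigenvalue_spectrum A l x : bounded_operator A -> x <> 0 -> A x = l *: x ->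
  spectrum A l.
Proof.
move=> bA x0 Ax [B [_ [BA _]]]; apply: x0.
rewrite -(BA x) Ax subrr; have := BA 0.
suff -> : A 0 - l *: 0 = 0 by [].
have [lA _] := bA; have := lA 1 0 0; rewrite !scale1r !addr0 => e.
by rewrite scaler0 subr0; apply: (addrI (A 0)); rewrite -e addr0.
Qed.

Lemma conj_class_orbit : orbit_class dot ac d V.
Proof.
split.
- by move=> A [[]].
- by move=> A [].
- move=> A [bA sA [n rA] spA dA] x; have [lA _] := bA.
  apply: (finite_rank_decomp lA sA _ _ _ rA) => [i|l y y0 Ay].
    exact: conjc_real.
  have := eigenvalue_spectrum bA y0 Ay; rewrite spA => -[i _ <-].
  by exists i.
- by move=> A [_ _ _ _ dA].
by move=> A w VA w1; exact: conj_class_reflect.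
Qed.

(** The eigenspace of a nonzero eigenvalue lies in the finite-dimensional range. As [a] will be
    injective, at most one colour is infinite-dimensional. *)
Lemma infinite_dim_kernel A i : V A -> d i = None -> a i = 0.
Proof.
move=> VA di; have [bA sA [n rA] spA dA] := VA; apply/eqP; apply: contraT => ai.
have := dA i; rewrite di => hX.
have sX := eig_subspace conj_class_orbit i VA.
have [e ie Xe] := indep_has_dim (m := n) (dd := None) sX hX isT.
have : (n.+1 <= n)%N; last by rewrite ltnn.
apply: (indep_le_basis rA ie) => j; exists (((a i)%:C%C)^-1 *: e j) => //.
rewrite (vertexZ conj_class_orbit VA) (Xe j) scalerA mulVf ?scale1r //.
by rewrite eq_complex /= negb_and ai.
Qed.

End ConjugacyClass.

Local Open Scope complex_scope.

Theorem theorem5 (R : realType) (H : completeNormedModType R[i])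
  (dot : {dot H for conjC}) (dot_norm : forall x : H, dot x x = `|x| ^+ 2)
  (k : nat) (a : 'I_k -> R) (d : 'I_k -> option nat)
  (a_inj : injective a) (k_ge2 : (2 <= k)%N)
  (d_gt1 : forall i, dim_gt 1 (d i))
  (d_eq2 : forall i j, d i = Some 2%N -> d j = Some 2%N -> i = j)
  (f : (H -> H) -> (H -> H))
  (f_aut : graph_automorphism (conj_class dot a d) (@comm_adjacent R H) f) :
  exists (U : H -> H) (s : 'S_k), s \in dim_perms d /\
    ((unitary dot U /\ forall A, conj_class dot a d A ->
        f A = U \o perm_op dot a s A \o adjoint dot U) \/
     (anti_unitary dot U /\ forall A, conj_class dot a d A ->
        f A = U \o perm_op dot a s A \o anti_adjoint dot U)).
Proof.
have [[A0 VA0]|none] := pselect (exists A, conj_class dot a d A); last first.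
  exists id, 1%g; split; first by rewrite inE; apply/forallP => i; rewrite perm1.
  left; split => [|A VA]; last by case: none; exists A.
  by split => //; exists id.
pose ac i := (a i)%:C; pose V := conj_class dot a d.
have ocV : orbit_class dot ac d V := conj_class_orbit dot_norm a d.
have ac_real i : conjC (ac i) = ac i by exact: conjc_real.
have ac_inj : injective ac by move=> i j /complexI /a_inj.
have Vne : exists A, V A by exists A0.
have k0 : (0 < k)%N by exact: leq_trans k_ge2.
have other (i : 'I_k) : exists l, i != l.
  have [i0|i0] := eqVneq (i : nat) 0%N.
    by exists (Ordinal k_ge2); rewrite -val_eqE /= i0.
  by exists (Ordinal k0); rewrite -val_eqE.
have [c0 d_fin] : exists c0 : 'I_k, forall c, c != c0 -> d c <> None.
  have [[c dc]|h] := pselect (exists c, d c = None); last first.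
    by exists (Ordinal k0) => c _ dc; apply: h; exists c.
  exists c => c' nc dc'; move: nc.
  have e := infinite_dim_kernel dot_norm VA0 dc.
  have e' := infinite_dim_kernel dot_norm VA0 dc'.
  by rewrite (a_inj c' c) ?eqxx // e e'.
have [[f_fun f_inj f_surj] f_edge] := f_aut.
have /choice [g gP] B : exists A, V B -> V A /\ f A = B.
  have [VB|] := pselect (V B); last by exists B.
  by have [A VA fA] := f_surj B VB; exists A.
have fg : vertex_aut V f g.
  have gf A : V A -> g (f A) = A.
    move=> VA; have [Vg fgA] := gP _ (f_fun A VA).
    by apply: f_inj => //; rewrite inE.
  split; [exact: f_fun|move=> A VA|exact: gf|move=> A VA|move=> A B VA VB].
  - by have [] := gP A VA.
  - by have [] := gP A VA.
  have [h1 h2] := f_edge A B VA VB; split => [[_ _ cAB rAB]|[_ _ cAB rAB]].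
    have [c r] := h1 (conj cAB rAB); split => //; exact: f_fun.
  by have [c r] := h2 (conj cAB rAB).
have movex := movable_ex d_gt1 other d_eq2 k0.
have [de [phi [de_inj de_fix phiP phi_orth phi_onto]]] :=
  line_transformation ocV ac_real ac_inj d_fin d_gt1 Vne other fg movex.
have phi_unit p : dot p p = 1 -> dot (phi p) (phi p) = 1 by move=> /phiP [].
have dim3 := dim3_vertex ocV d_gt1 Vne other d_eq2 k0.
(* [e] is the base point of the affine chart, and [x0] the vector at which the twist is read off. *)
have [e [e1 _ _]] := dim3 0 0; have [x0 [x01 x0e _]] := dim3 e e.
pose U := uhlhorn_map dot phi e x0; pose s := twist dot phi e x0.
have UD : forall x y, U (x + y) = U x + U y.
  exact: (uhlhorn_mapD phi_unit phi_orth phi_onto dim3 e1 x01 x0e).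
have UZ : forall c x, U (c *: x) = s c *: U x.
  exact: (uhlhorn_mapZ phi_unit phi_orth phi_onto dim3 e1 x01 x0e).
have U_img x : x <> 0 -> img dot phi x (U x).
  exact: (uhlhorn_map_img phi_unit phi_orth phi_onto dim3 e1 x01 x0e).
have s1 : s 1 = 1 by exact: (twist1 phi_unit phi_orth phi_onto e1 x01 x0e).
have sD := twistD phi_unit phi_orth phi_onto dim3 e1 x01 x0e.
have sM := twistM phi_unit phi_orth phi_onto dim3 e1 x01 x0e.
have s_ge0 := twist_ge0 phi_unit phi_orth phi_onto dim3 e1 x01 x0e.
have s_cases : (forall c, s c = c) \/ (forall c, s c = conjC c).
  exact: (twist_cases sD sM s1 s_ge0).
have s_onto c : exists b, s b = c.
  by case: s_cases => h; [exists c|exists (conjC c)]; rewrite h // conjCK.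
have U_onto y : exists x, U x = y.
  exact: (uhlhorn_map_onto phi_unit phi_orth phi_onto e1 s_onto).
have U_dot x y : dot (U x) (U y) = conjC (s (conjC (dot (x - dot x e *: e)
    (y - dot y e *: e)))) + s (dot x e) * conjC (s (dot y e)).
  exact: (uhlhorn_map_dot phi_unit phi_orth phi_onto dim3 e1 x01 x0e).
clearbody U s; have perp_dot x y : dot (x - dot x e *: e) (y - dot y e *: e) =
    dot x y - dot x e * conjC (dot y e).
  by rewrite !(dotlE, dotrE) e1 (dotC dot e y); ring.
have U_iso : ((forall c, s c = c) /\ forall x y, dot (U x) (U y) = dot x y) \/
    ((forall c, s c = conjC c) /\ forall x y, dot (U x) (U y) = conjC (dot x y)).
  case: s_cases => h; [left|right]; split => // x y; rewrite U_dot perp_dot !h ?conjCK.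
    by ring.
  by rewrite rmorphB rmorphM /= conjCK; ring.
have U_unit p : dot p p = 1 -> dot (U p) (U p) = 1.
  by move=> p1; case: U_iso => -[_ ->]; rewrite p1 ?rmorph1.
have U_orth x y : dot x y = 0 -> dot (U x) (U y) = 0.
  by move=> xy; case: U_iso => -[_ ->]; rewrite xy ?rmorph0.
have U_inj x : U x = 0 -> x = 0.
  move=> Ux; apply: (@dot_eq0P _ _ dot); have : dot (U x) (U x) = 0 by rewrite Ux dot0l.
  by case: U_iso => -[_ ->] // /eqP; rewrite conjC_eq0 => /eqP.
have U_phi p : dot p p = 1 -> par (phi p) (U p).
  move=> p1; have [c _ ->] := img_par phi_unit phi_orth phi_onto
    (img_phi phi_unit phi_orth p1) (U_img p (unit_neq0 p1)).
  by exists c.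
have phi_map p : dot p p = 1 -> forall i, movable d i -> line_map ac V f i p (de i) (phi p).
  by move=> /phiP [].
have U0 : U 0 = 0 by apply: (addrI (U 0)); rewrite -UD !addr0.
have tr A i x : V A -> A x = ac i *: x -> f A (U x) = ac (de i) *: U x.
  exact: (transport_eig ocV ac_real ac_inj d_gt1 d_eq2 fg de_inj de_fix phi_map UD UZ U_phi
    U_unit U_orth U_onto).
have tr_cmp A i x : V A -> eigcomp dot ac (f A) (de i) (U x) = U (eigcomp dot ac A i x).
  exact: (transport_cmp ocV ac_real ac_inj d_gt1 d_eq2 fg de_inj de_fix phi_map UD UZ U_phi
    U_unit U_orth U_onto).
have s0 c : c = 0 -> s c = 0 by move=> ->; case: s_cases => h; rewrite h ?rmorph0.
have s_inv c : s (s c) = c by case: s_cases => h; rewrite !h ?conjCK.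
have s_ac i : s (ac i) = ac i by case: s_cases => h; rewrite h ?ac_real.
have /choice [Ui UiK] y : exists x, U x = y by exact: U_onto.
have UN x : U (- x) = - U x by apply/eqP; rewrite -addr_eq0 -UD addNr U0.
have UK x : Ui (U x) = x.
  apply/eqP; rewrite -subr_eq0; apply/eqP/U_inj.
  by rewrite UD UN UiK subrr.
have fV A : V A -> V (f A) by exact: f_fun.
have eig_map i x : A0 x = ac i *: x <-> f A0 (U x) = ac (de i) *: U x.
  split; first exact: tr.
  move=> fUx; rewrite -{1 2}(eigcomp_sum ocV ac_real ac_inj x VA0) (bigD1 i) //= big1 ?addr0.
    exact: (eigcompE ocV ac_real ac_inj).
  move=> j ji; apply: U_inj; rewrite -tr_cmp //.
  apply: (eigcomp_uniq ocV) => [||z fz]; first exact: fV.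
    by rewrite (vertex0 ocV (fV _ VA0)) scaler0.
  rewrite subr0; apply: (eig_orth ocV ac_real ac_inj (fV _ VA0) _ fUx fz).
  by apply: contra ji => /eqP/de_inj ->.
have d_de i : d (de i) = d i.
  apply: (has_dim_uniq (oc_dim ocV (fV _ VA0) (de i))).
  have := oc_dim ocV VA0 i; case: (d i) => [m|] /=.
    exact: (has_basis_semilinear UD UZ U_inj s_onto s0 (eig_map i) U_onto).
  (* In infinite dimension a finite basis of the image is pulled back by [Ui], semilinear for the
     same [s] because [s] is an involution. *)
  have UiD x y : Ui (x + y) = Ui x + Ui y by apply: (can_inj UK); rewrite UD !UiK.
  have UiZ c x : Ui (c *: x) = s c *: Ui x by apply: (can_inj UK); rewrite UZ !UiK s_inv.
  have Ui_inj x : Ui x = 0 -> x = 0 by move=> Uix; rewrite -(UiK x) Uix U0.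
  move=> h m hm; apply: (h m); apply: (has_basis_semilinear UiD UiZ Ui_inj s_onto s0 _ _ hm).
    by move=> x; rewrite /= -{1 2}(UiK x) -eig_map.
  by move=> x; exists (U x).
(* [f A] has the eigenvalue [a (de i)] on the image of the [i]-th eigenspace, while [perm_op]
   attaches [a i] to the eigenspace of index [t i]; so [t] inverts [de]. *)
pose t : 'S_k := ((perm de_inj)^-1)%g.
have tde i : t (de i) = i by rewrite /t -(permE de_inj) permK.
have fU A x : V A -> f A (U x) = U (perm_op dot a t A x).
  (* The projection to an eigenspace is convertible to [eigcomp]. *)
  move=> VA; have -> : perm_op dot a t A x = \sum_i ac i *: eigcomp dot ac A (t i) x by [].
  rewrite -{1}(eigcomp_sum ocV ac_real ac_inj x VA) !(big_morph U UD U0) (vertex_sum ocV (fV _ VA)).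
  rewrite [RHS](reindex_inj (@perm_inj _ (perm de_inj))); apply: eq_bigr => i _.
  rewrite permE tde UZ s_ac; apply: tr => //; exact: (eigcompE ocV ac_real ac_inj).
exists U, t; split.
  rewrite inE; apply/forallP => i; apply/eqP; have [j <-] : exists j, de j = i.
    by have /codomP [j ->] := injF_onto de_inj i; exists j.
  by rewrite tde d_de.
have bijU : bijective U by exists Ui.
case: U_iso => -[h iso]; [left|right]; (split; first by split => // c x y; rewrite UD UZ h).
  move=> A VA; apply/funext => y; rewrite -{1}(UiK y) fU //=; congr (U (perm_op _ _ _ _ _)).
  (* Since [U] preserves inner products, [Ui y] is the only vector with the defining property, so it
     is what [xget] returns. *)
  rewrite /adjoint; case: xgetP => [z _ hz|/(_ (Ui y)) []].
    apply: (@dot_inj _ _ dot) => x; rewrite -[y]UiK in hz.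
    by rewrite dotC -(iso x) hz -dotC.
  by move=> x /=; rewrite -{1}(UiK y) iso.
move=> A VA; apply/funext => y; rewrite -{1}(UiK y) fU //=; congr (U (perm_op _ _ _ _ _)).
rewrite /anti_adjoint; case: xgetP => [z _ hz|/(_ (Ui y)) []].
  apply: (@dot_inj _ _ dot) => x; rewrite -[y]UiK in hz.
  by rewrite dotC -(iso x) hz -dotC.
by move=> x /=; rewrite -{1}(UiK y) iso.
Qed.
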